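(* Let $N\ge 3$, $\nu>0$ and $p_S<p<p^*$. Then for any $\lambda>0$ the equation $$-U''-\frac{N-1}{r}U'+\frac{\nu^2-\nu_*^2}{r^2}U=U^p\qquad(r>0)$$ admits a unique positive solution $U_\lambda\in C^2(0,\infty)$ such that $$\lim_{r\to 0}\frac{U_\lambda(r)}{r^{-\nu_*+\nu}}=\lambda,\qquad \lim_{r\to\infty}\frac{U_\lambda(r)}{r^{-\frac{2}{p-1}}}=C_{p,\nu}.$$ Moreover, $$U_\lambda(r)=\lambda^{\frac{2}{p-1}}U_1(\lambda r)\qquad\forall\lambda>0.$$ Further, for $\lambda\in(0,\infty]$ (where $U_\infty(r)=C_{p,\nu}r^{-\frac{2}{p-1}}$) the following properties hold: (i) if $pC_{p,\nu}^{p-1}\le\nu^2$ then the solutions $U_\lambda$ are stable and ordered, in the sense that $0<\lambda_1<\lambda_2\le\infty$ implies $U_{\lambda_1}(r)<U_{\lambda_2}(r)$ for every $r>0$, and in addition $$\lim_{r\to\infty}\frac{U_{\lambda_2}(r)-U_{\lambda_1}(r)}{r^{-\nu_*}}>0;$$ (ii) if $pC_{p,\nu}^{p-1}>\nu^2$ then the solutions $U_\lambda$ are unstable and oscillate, in the sense that $0<\lambda_1<\lambda_2\le\infty$ implies that $U_{\lambda_2}(r)-U_{\lambda_1}(r)$ changes sign in $(R,+\infty)$ for arbitrary $R>0$.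
   Context: Notation: $\nu_*:=\frac{N-2}{2}$; $p_S:=\frac{N+2}{N-2}$; $p^*:=1+\frac{2}{\nu_*-\nu}$ if $\nu<\nu_*$ and $p^*:=\infty$ if $\nu\ge\nu_*$; $C_{p,\nu}>0$ is defined by $C_{p,\nu}^{p-1}:=\nu^2-\left(\nu_*-\frac{2}{p-1}\right)^2$, which is positive for $p_S<p<p^*$. The function $U_\infty(x)=C_{p,\nu}|x|^{-\frac{2}{p-1}}$ is an explicit positive solution of $-\Delta u+\frac{\nu^2-\nu_*^2}{|x|^2}u=u^p$ in $\mathbb{R}^N\setminus\{0\}$. A function $U$ on $(0,\infty)$ is identified with the radial function $x\mapsto U(|x|)$ on $\mathbb{R}^N\setminus\{0\}$; positive solutions of the ordinary differential equation correspond to radial positive solutions of this partial differential equation. Stability: a positive solution $u$ of the partial differential equation in $\mathbb{R}^N\setminus\{0\}$ is stable in an open set $\Omega\subset\mathbb{R}^N\setminus\{0\}$ if $$\int|\nabla\varphi|^2\,dx+(\nu^2-\nu_*^2)\int\frac{\varphi^2}{|x|^2}\,dx-p\int u^{p-1}\varphi^2\,dx\ge 0\qquad\forall\varphi\in C_c^\infty(\Omega).$$ ''Stable'' without further qualification means stable in $\mathbb{R}^N\setminus\{0\}$. The solution $u$ is semi-stable if it is stable in $\mathbb{R}^N\setminus\bar B_R$ for some $R>0$ ($B_R$ is the ball of radius $R$ centred at $0$), and unstable if it is not semi-stable.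
   Formalization: The scaling formula is corrected to U_λ(r)=κ^{2/(p-1)}U_1(κr) with κ=λ^{1/γ}, γ=2/(p-1)+ν-ν_*, since the printed one contradicts the limit λ at 0 unless γ=1; the limit of the difference over r^{-ν_*} is taken in (0,+∞]. *)

(* Defs.v *)
From HB Require Import structures.
From mathcomp Require Import all_boot all_order all_algebra.
From mathcomp Require Import all_classical all_reals all_analysis.

Set Implicit Arguments.
Unset Strict Implicit.
Unset Printing Implicit Defensive.

Import Order.TTheory GRing.Theory Num.Theory.
Import numFieldNormedType.Exports.

Local Open Scope classical_set_scope.
Local Open Scope ring_scope.

(** [tuple_measure m1 n] is the [n]-fold product of the sigma-finite measure
    [m1], carried by [n.-tuple T] with its product sigma-algebra. *)
Section tuple_measure.
Context d (T : measurableType d) (R : realType).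
Variable m1 : {sigma_finite_measure set T -> \bar R}.

Definition tuple_cons n (z : T * n.-tuple T) : n.+1.-tuple T :=
  [the n.+1.-tuple T of z.1 :: z.2].

Definition tuple_uncons n (t : n.+1.-tuple T) : T * n.-tuple T :=
  (tnth t ord0, [tuple of behead t]).

Lemma measurable_tuple_cons n : measurable_fun setT (@tuple_cons n).
Proof. by apply: measurable_cons. Qed.

Lemma measurable_tuple_uncons n : measurable_fun setT (@tuple_uncons n).
Proof.
apply: measurable_fun_pair; first exact: measurable_tnth.
exact: measurable_behead.
Qed.

Lemma tuple_consK n : cancel (@tuple_cons n) (@tuple_uncons n).
Proof. by case=> x t; congr (_, _); apply/val_inj. Qed.

Section step.
Variables (n : nat) (m : {sigma_finite_measure set (n.-tuple T) -> \bar R}).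
Let mu := [the measure _ R of (m1 \x m)%E].

Definition cons_measure : set (n.+1.-tuple T) -> \bar R :=
  pushforward mu (@tuple_cons n).

Let cm0 : cons_measure set0 = 0%E.
Proof. by rewrite /cons_measure /pushforward preimage_set0 measure0. Qed.

Let cm_ge0 A : (0 <= cons_measure A)%E.
Proof. exact: (measure_ge0 mu). Qed.

Let cm_sigma_additive : semi_sigma_additive cons_measure.
Proof.
move=> F mF tF mUF; rewrite /cons_measure /pushforward preimage_bigcup.
apply: measure_semi_sigma_additive.
- by move=> k; rewrite -[X in measurable X]setTI; apply: measurable_tuple_cons.
- apply/trivIsetP => /= i j _ _ ij; rewrite -preimage_setI.
  by move/trivIsetP : tF => /(_ _ _ _ _ ij) ->//; rewrite preimage_set0.
- rewrite -preimage_bigcup -[X in measurable X]setTI.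
  exact: measurable_tuple_cons.
Qed.

HB.instance Definition _ := isMeasure.Build _ _ _ cons_measure
  cm0 cm_ge0 cm_sigma_additive.

Let cm_sigma_finite : sigma_finite setT cons_measure.
Proof.
have /sigma_finiteP[F [TF ndF Foo]] := sigma_finiteT m1.
have /sigma_finiteP[G [TG ndG Goo]] := sigma_finiteT m.
exists (fun i => @tuple_uncons n @^-1` (F i `*` G i)) => [|i].
  rewrite -preimage_bigcup -[LHS](preimage_setT (@tuple_uncons n)).
  congr preimage; rewrite -setXTT TF TG predeqE => -[x y]; split.
    move=> [/= [j _ Fjx] [k _ Gky]]; exists (maxn j k) => //; split.
    - by move: x Fjx; exact/subsetPset/ndF/leq_maxl.
    - by move: y Gky; exact/subsetPset/ndG/leq_maxr.
  by move=> [j _ []/= ? ?]; split; exists j.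
have [mFi Fi_oo] := Foo i; have [mGi Gi_oo] := Goo i.
have mFG : measurable (F i `*` G i) by exact: measurableX.
split; first by rewrite -[X in measurable X]setTI; apply: measurable_tuple_uncons.
rewrite /cons_measure /pushforward -comp_preimage.
rewrite (_ : @tuple_uncons n \o _ = id); last exact/funext/tuple_consK.
by rewrite preimage_id /mu/= product_measure1E// lte_mul_pinfty// ge0_fin_numE.
Qed.

HB.instance Definition _ := Measure_isSigmaFinite.Build _ _ _ cons_measure
  cm_sigma_finite.

End step.

Fixpoint tuple_measure n : {sigma_finite_measure set (n.-tuple T) -> \bar R} :=
  if n is n'.+1
  then [the {sigma_finite_measure set (n'.+1.-tuple T) -> \bar R}
          of cons_measure (tuple_measure n')]
  else [the {sigma_finite_measure set (0.-tuple T) -> \bar R}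
          of \d_ [tuple]].

End tuple_measure.

Section euclidean.
Context {R : realType} {n : nat}.
Implicit Types (f u phi : 'rV[R]_n -> R) (x : 'rV[R]_n) (Omega : set 'rV[R]_n).

(** The Lebesgue integral over R^n, vectors being read off from [n]-tuples. *)
Definition integral_rV f : R :=
  \int[tuple_measure (@lebesgue_measure R) n]_t f (\row_i tnth t i).

(** The norm [`|x|] of the library is the sup norm, hence this definition. *)
Definition enorm x : R := Num.sqrt (\sum_i x ord0 i ^+ 2).

Definition partial (i : 'I_n) f : 'rV[R]_n -> R :=
  fun x => 'D_(delta_mx ord0 i) f x.

Definition gradient f x : 'rV[R]_n := \row_i partial i f x.

Fixpoint Ck (k : nat) f : Prop :=
  continuous f /\
  if k is k'.+1 then
    forall i, (forall x, derivable f x (delta_mx ord0 i)) /\ Ck k' (partial i f)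
  else True.

Definition smooth f : Prop := forall k, Ck k f.

Definition tsupport f : set 'rV[R]_n := closure [set x | f x != 0].

Definition test_function Omega phi : Prop :=
  [/\ smooth phi, compact (tsupport phi) & tsupport phi `<=` Omega].

End euclidean.

Section lane_emden_hardy.
Context {R : realType}.
Implicit Types (N : nat) (nu p lam : R) (U : R -> R) (l : \bar R).

Definition nu_star N : R := (N%:R - 2) / 2.

Definition p_S N : R := (N%:R + 2) / (N%:R - 2).

Definition p_star N nu : \bar R :=
  if nu < nu_star N then (1 + 2 / (nu_star N - nu))%:E else +oo%E.

(** For [p_S N < p < p_star N nu] the base is positive, so this is the unique
    positive real with [C_pnu N nu p `^ (p - 1) = base]. *)
Definition C_pnu N nu p : R :=
  (nu ^+ 2 - (nu_star N - 2 / (p - 1)) ^+ 2) `^ (p - 1)^-1.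

Definition C2_pos U : Prop := forall r, 0 < r ->
  [/\ derivable U r 1, derivable (U^`())%classic r 1 & {for r, continuous (U^`(2))%classic}].

Definition solves_ode N nu p U : Prop := forall r, 0 < r ->
  - (U^`(2))%classic r - (N%:R - 1) / r * (U^`())%classic r
    + (nu ^+ 2 - nu_star N ^+ 2) / r ^+ 2 * U r = U r `^ p.

(** Functions on (0, oo) are represented by total functions whose values
    outside (0, oo) are irrelevant. *)
Definition positive_solution N nu p U : Prop :=
  [/\ C2_pos U, forall r, 0 < r -> 0 < U r & solves_ode N nu p U].

Definition is_U_lambda N nu p lam U : Prop :=
  [/\ positive_solution N nu p U,
      U r / r `^ (- nu_star N + nu) @[r --> 0^'+] --> lam &
      U r / r `^ (- (2 / (p - 1))) @[r --> +oo] --> C_pnu N nu p].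

Definition U_infty N nu p : R -> R :=
  fun r => C_pnu N nu p * r `^ (- (2 / (p - 1))).

(** Adds [U_infty] at [+oo] to a family indexed by finite parameters; the value
    at [-oo] is irrelevant. *)
Definition extend_family N nu p (U : R -> R -> R) l : R -> R :=
  match l with
  | lam%:E => U lam
  | +oo%E => U_infty N nu p
  | -oo%E => cst 0
  end.

Definition stable_in N nu p (u : 'rV[R]_N -> R) (Omega : set 'rV[R]_N) : Prop :=
  forall phi, test_function Omega phi ->
    0 <= integral_rV (fun x => enorm (gradient phi x) ^+ 2)
         + (nu ^+ 2 - nu_star N ^+ 2)
             * integral_rV (fun x => phi x ^+ 2 / enorm x ^+ 2)
         - p * integral_rV (fun x => u x `^ (p - 1) * phi x ^+ 2).

Definition stable N nu p (u : 'rV[R]_N -> R) : Prop :=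
  stable_in nu p u [set x | x != 0].

Definition semi_stable N nu p (u : 'rV[R]_N -> R) : Prop :=
  exists2 rho, 0 < rho & stable_in nu p u [set x | rho < enorm x].

Definition unstable N nu p (u : 'rV[R]_N -> R) : Prop := ~ semi_stable nu p u.

Definition radial N U : 'rV[R]_N -> R := fun x => U (enorm x).

Definition changes_sign_on (A : set R) (f : R -> R) : Prop :=
  (exists2 r, A r & 0 < f r) /\ (exists2 r, A r & f r < 0).

End lane_emden_hardy.

(* Main.v *)
(** With [m = 2 / (p - 1)] and [a = nu_star - m], the substitution
    [U r = r^(- m) v (ln r)] turns the equation into the autonomous one
    [v'' + 2 a v' - (nu^2 - a^2) v + v^p = 0], and [p_S < p < p_star] means
    [0 < a < nu]. The behaviour [U r ~ lam r^(nu - nu_star)] at 0 says that [v]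
    lies on the unstable manifold of the origin, [v ~ lam e^((nu - a) t)] at [-oo];
    this is a Volterra equation starting at [-oo], uniquely solvable by contraction. The energy
    [v'^2 / 2 - (nu^2 - a^2) v^2 / 2 + v^(p + 1) / (p + 1)] decreases; being 0 at
    [-oo] it is negative, so [v] stays positive and bounded, is global, and by
    dissipation converges to the equilibrium [C]. Scaling in [lam] is translation
    in [t].

    The gap [g = e^(a t) (v2 - v1)] between two solutions satisfies
    [g'' = nu^2 g - e^(a t) (v2^p - v1^p)]. If [p C^(p - 1) <= nu^2] it is convex as
    long as it is positive, by convexity of [x^p] and [v2 <= C]; hence order and a
    positive limit. If [p C^(p - 1) > nu^2] a gap of constant sign would satisfy
    [g'' <= - delta g] near [+oo], which forces it to vanish there, and then
    everywhere by backward uniqueness.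

    Stability compares the potential [p u^(p - 1)] with the Hardy potential: it is at
    most [nu^2 / |x|^2] in the first case, and the density of the quadratic form plus
    the divergence of [nu_star phi^2 x / |x|^2] is then at least a sum of squares.
    In the second case it is at least [(nu^2 + delta) / |x|^2] far away, and a radial test
    function [|x|^(- nu_star) b (ln |x|)] with a wide bump [b] gives a negative
    value. *)
Require Import Defs.
From mathcomp Require Import all_boot all_order all_algebra.
From mathcomp Require Import all_classical all_reals all_analysis.
From mathcomp Require Import measurable_realfun ring lra.

Set Implicit Arguments.
Unset Strict Implicit.
Unset Printing Implicit Defensive.

Import Order.TTheory GRing.Theory Num.Theory.
Import numFieldNormedType.Exports.

Local Open Scope classical_set_scope.
Local Open Scope ring_scope.

(** * Calculus on the real line *)

(** A contraction wants a bounded, globally Lipschitz nonlinearity, and [x^p] is neither. It is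
    truncated to [[0, lam]] and the truncation removed afterwards: the sign of the derivative gives
    the upper bound, the negative energy the lower one. The contracted unknown is not [v] but
    [z = e^(- (nu - a) t) v], whose limit [lam] at -oo is not zero. The integrations from -oo are
    never written as improper integrals: primitives normalized at -oo, and comparison of functions
    through their derivatives and their limits there, replace them.

    Uniqueness meets an obstacle of its own: the hypotheses prescribe [U] near 0 but say nothing of
    [U'], so the vanishing of the flux at -oo has to be derived.

    The weight [e^(a t)] of the gap removes the first-order term of the equation and turns
    [b = nu^2 - a^2] into [nu^2], which is why the dichotomy is stated in terms of [nu^2]. The
    parameter +oo needs no separate theory: [U_infty] corresponds to the constant solution [C].

    On R^N the integrands vanish near the origin and near infinity, so the singularity of the Hardy
    weight is never met and the divergence theorem needs no boundary terms. *)

Section real_derivatives.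
Context {R : realType}.
Implicit Types (f g F G : R -> R) (x t a b c : R).

Lemma is_derive_add f g x a b : is_derive x 1 f a -> is_derive x 1 g b ->
  is_derive x 1 (fun t => f t + g t) (a + b).
Proof. by move=> fa gb; apply: is_deriveD. Qed.

Lemma is_derive_opp f x a : is_derive x 1 f a -> is_derive x 1 (fun t => - f t) (- a).
Proof. by move=> fa; apply: is_deriveN. Qed.

Lemma is_derive_mul f g x a b : is_derive x 1 f a -> is_derive x 1 g b ->
  is_derive x 1 (fun t => f t * g t) (f x * b + g x * a).
Proof. by move=> fa gb; apply: is_deriveM. Qed.

Lemma is_derive_const c x : is_derive x 1 (fun=> c) 0.
Proof. exact: is_derive_cst. Qed.

Lemma is_derive_idfun x : is_derive x 1 (fun t => t) 1.
Proof. exact: is_derive_id. Qed.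

Lemma is_derive_expRf f x a : is_derive x 1 f a ->
  is_derive x 1 (fun t => expR (f t)) (expR (f x) * a).
Proof. by move=> fa; apply: (@is_derive1_comp _ expR f). Qed.

Lemma is_derive_lnf f x a : 0 < f x -> is_derive x 1 f a ->
  is_derive x 1 (fun t => ln (f t)) ((f x)^-1 * a).
Proof. by move=> fx fa; apply: (@is_derive1_comp _ (@ln R) f); exact: is_derive1_ln. Qed.

Lemma is_derive_powRf f c x a : 0 < f x -> is_derive x 1 f a ->
  is_derive x 1 (fun t => f t `^ c) (c * f x `^ (c - 1) * a).
Proof.
by move=> fx fa; apply: (@is_derive1_comp _ (fun y => y `^ c) f); exact: is_derive1_powR.
Qed.

Lemma is_derive_sqr f x a : is_derive x 1 f a ->
  is_derive x 1 (fun t => f t ^+ 2) (2 * f x * a).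
Proof.
move=> fa; have := is_derive_mul fa fa.
rewrite (_ : f x * a + f x * a = 2 * f x * a); last by ring.
by under eq_fun do rewrite -expr2.
Qed.

Lemma is_derive_inv f x a : f x != 0 -> is_derive x 1 f a ->
  is_derive x 1 (fun t => (f t)^-1) (- (f x ^- 2) * a).
Proof. by move=> fx fa; apply: is_derive_eq. Qed.

Lemma is_derive_continuous f x a : is_derive x 1 f a -> {for x, continuous f}.
Proof. by move=> fa; apply/differentiable_continuous/derivable1_diffP. Qed.

Definition has_derive F f := forall t, is_derive t 1 F (f t).

Lemma has_derive_continuous F f : has_derive F f -> continuous F.
Proof. by move=> Ff t; apply: is_derive_continuous. Qed.

Lemma MVT_is_derive F f x y : x < y ->
  (forall t, x <= t <= y -> is_derive t 1 F (f t)) ->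
  exists2 t, x < t < y & F y - F x = f t * (y - x).
Proof.
move=> xy Ff; have [| |t tab ->] := @MVT _ F f x y xy.
- by move=> t; rewrite in_itv/= => /andP[xt ty]; apply: Ff; rewrite !ltW.
- apply: continuous_in_subspaceT => t; rewrite inE/= in_itv/= => tab.
  exact/is_derive_continuous/Ff.
- by exists t.
Qed.

Lemma ge0_is_derive_le F f x y : x <= y ->
  (forall t, x <= t <= y -> is_derive t 1 F (f t)) ->
  (forall t, x < t < y -> 0 <= f t) -> F x <= F y.
Proof.
rewrite le_eqVlt => /predU1P[->//|xy] Ff f0.
have [t txy E] := MVT_is_derive xy Ff.
by rewrite -subr_ge0 E mulr_ge0 ?f0 ?subr_ge0 ?ltW.
Qed.

Lemma gt0_is_derive_lt F f x y : x < y ->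
  (forall t, x <= t <= y -> is_derive t 1 F (f t)) ->
  (forall t, x < t < y -> 0 < f t) -> F x < F y.
Proof.
move=> xy Ff f0; have [t txy E] := MVT_is_derive xy Ff.
by rewrite -subr_gt0 E mulr_gt0 ?f0 ?subr_gt0.
Qed.

Lemma le0_is_derive_le F f x y : x <= y ->
  (forall t, x <= t <= y -> is_derive t 1 F (f t)) ->
  (forall t, x < t < y -> f t <= 0) -> F y <= F x.
Proof.
move=> xy Ff f0; rewrite -lerN2.
apply: (@ge0_is_derive_le (fun t => - F t) (fun t => - f t)) => // t txy.
  exact/is_derive_opp/Ff.
by rewrite oppr_ge0 f0.
Qed.

Lemma cvgNy_gt0_near F l : F x @[x --> -oo] --> l -> 0 < l ->
  exists T, forall t, t <= T -> 0 < F t.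
Proof.
move=> Fl l0; have /cvgrPdist_lt/(_ _ l0)[T [_ TF]] := Fl.
exists (T - 1) => t tT; have := TF t; rewrite /= ltr_distl => /(_ _)/andP[]; lra.
Qed.

Lemma cvgNy_dist F l : F x @[x --> -oo] --> l <->
  forall e, 0 < e -> exists T, forall t, t <= T -> `|F t - l| < e.
Proof.
split=> [/cvgrPdist_lt Fl e e0|Fl]; last apply/cvgrPdist_lt => e e0.
  have [T [_ TF]] := Fl e e0; exists (T - 1) => t tT.
  by rewrite distrC; apply: TF; rewrite /=; lra.
have [T TF] := Fl e e0; exists T; split; first exact: num_real.
by move=> t /ltW/TF; rewrite distrC.
Qed.

Lemma cvgy_dist F l : F x @[x --> +oo] --> l <->
  forall e, 0 < e -> exists T, forall t, T <= t -> `|F t - l| < e.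
Proof.
split=> [/cvgrPdist_lt Fl e e0|Fl]; last apply/cvgrPdist_lt => e e0.
  have [T [_ TF]] := Fl e e0; exists (T + 1) => t tT.
  by rewrite distrC; apply: TF; rewrite /=; lra.
have [T TF] := Fl e e0; exists T; split; first exact: num_real.
by move=> t /ltW/TF; rewrite distrC.
Qed.

Lemma cvgNy_expR c : 0 < c -> expR (c * x) @[x --> -oo] --> (0 : R).
Proof.
move=> c0; apply/cvgNy_dist => e e0; exists (ln (e / 2) / c) => t tT.
rewrite subr0 ger0_norm ?expR_ge0//; apply: le_lt_trans (_ : e / 2 < e); last by lra.
by rewrite -[leRHS]lnK ?posrE ?divr_gt0// ler_expR -ler_pdivlMl// mulrC.
Qed.

(** Stands in for integrating an inequality from -oo: [G - F] is nondecreasing, hence never below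
    its limit [l' - l]. *)
Lemma le_is_deriveNy F G f g l l' : has_derive F f -> has_derive G g ->
  F x @[x --> -oo] --> l -> G x @[x --> -oo] --> l' ->
  (forall t, f t <= g t) -> l <= l' -> forall t, F t <= G t.
Proof.
move=> Ff Gg Fl Gl fg ll' t.
have GFl : (G x - F x) @[x --> -oo] --> l' - l by apply: cvgB.
suff : l' - l <= G t - F t by move: ll'; lra.
apply: (cvgr_to_le GFl); exists t; split; first exact: num_real.
move=> s /= /ltW st; apply: (@ge0_is_derive_le (fun t => G t - F t) (fun t => g t - f t)) => // u _.
  by apply: is_derive_add => //; apply: is_derive_opp.
by rewrite subr_ge0.
Qed.

Lemma norm_le_is_deriveNy F G f g : has_derive F f -> has_derive G g ->
  F x @[x --> -oo] --> (0 : R) -> G x @[x --> -oo] --> (0 : R) ->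
  (forall t, `|f t| <= g t) -> forall t, `|F t| <= G t.
Proof.
move=> Ff Gg F0 G0 fg t; rewrite ler_norml; apply/andP; split.
  rewrite lerNl; apply: (@le_is_deriveNy (fun t => - F t) G (fun t => - f t) g 0 0) => //.
  - by move=> s; apply: is_derive_opp.
  - by rewrite -oppr0; apply: cvgN.
  - by move=> s; have := fg s; rewrite ler_norml => /andP[]; lra.
apply: (@le_is_deriveNy F G f g 0 0) => // s.
exact: le_trans (ler_norm _) (fg s).
Qed.

(** A convergent function need not have a convergent derivative, but the mean value theorem on a
    unit interval far to the left yields a point where the derivative is small. Monotonicity of the
    derivative then does the rest wherever this is used. *)
Lemma cvgNy_derive_small F f (l : R) : has_derive F f -> F x @[x --> -oo] --> l ->
  forall e T, 0 < e -> exists2 t, t <= T & `|f t| < e.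
Proof.
move=> Ff /cvgNy_dist Fl e T e0.
have [S FS] := Fl (e / 2) ltac:(by rewrite divr_gt0).
pose y := Num.min S T.
have [||t /andP[_ ty] E] := @MVT_is_derive F f (y - 1) y; [lra| by move=> *; apply: Ff|].
exists t; first by rewrite (le_trans (ltW ty))// ge_min lexx orbT.
have -> : f t = (F y - l) - (F (y - 1) - l) by lra.
apply: le_lt_trans (ler_normB _ _) _.
have yS : y <= S by rewrite ge_min lexx.
have := FS y yS; have := FS (y - 1) ltac:(lra); lra.
Qed.

(** The integral from [- n] is a primitive only to the right of [- n]. Normalized to vanish at 0,
    these integrals agree on overlaps and glue together. *)
Lemma has_derive_primitive f : continuous f -> exists F, has_derive F f.
Proof.
move=> cf.
have int a b : lebesgue_measure.-integrable `[a, b] (EFin \o f).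
  by apply: continuous_compact_integrable; [exact: segment_compact|exact: continuous_subspaceT].
pose I (n : nat) x := \int[lebesgue_measure]_(t in `[- n%:R, x]) f t.
have dI n x : - n%:R < x -> is_derive x 1 (I n) (f x).
  move=> nx; have [||||d1 d2] := @continuous_FTC1 _ f (BLeft (- n%:R)) x (x + 1).
  - by rewrite ltrDl.
  - exact: int.
  - by [].
  - exact: cf.
  - have e1 : derivable (I n) x 1 := d1.
    have e2 : (I n)^`()%classic x = f x := d2.
    by apply: (DeriveDef e1); rewrite -derive1E.
pose J n x := I n x - I n 0.
have dJ n x : - n%:R < x -> is_derive x 1 (J n) (f x).
  move=> nx; rewrite -[f x]subr0; apply: is_derive_add; exact: dI.
have JE n k x : (0 < n)%N -> (n <= k)%N -> - n%:R < x -> J n x = J k x.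
  move=> n0 nk nx; have nkR : (- k%:R <= - n%:R :> R) by rewrite lerN2 ler_nat.
  have n0R : (- n%:R < 0 :> R) by rewrite oppr_lt0 ltr0n.
  have d (y : R) : - n%:R < y -> is_derive y 1 (fun t => J n t - J k t) 0.
    move=> ny; rewrite -[X in is_derive _ _ _ X](subrr (f y)).
    apply: is_derive_add; first exact: dJ.
    by apply/is_derive_opp/dJ; exact: le_lt_trans ny.
  have D0 : J n 0 - J k 0 = 0 by rewrite /J !subrr.
  have [x0|x0|->] := ltgtP x 0; last by rewrite /J !subrr.
    have [t _] := @MVT_is_derive (fun t => J n t - J k t) (fun=> 0) x 0 x0
      (fun t h => d t (lt_le_trans nx (proj1 (andP h)))).
    by rewrite D0 mul0r; lra.
  have [t _] := @MVT_is_derive (fun t => J n t - J k t) (fun=> 0) 0 x x0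
      (fun t h => d t (lt_le_trans n0R (proj1 (andP h)))).
  by rewrite D0 mul0r; lra.
pose N x := (Num.truncn `|x|).+1.
have xN x : `|x| < (N x)%:R by rewrite /N; exact: truncnS_gt.
exists (fun x => J (N x) x) => x.
apply: (@near_eq_is_derive _ _ _ (J (N x))); last first.
  by apply: dJ; have := xN x; rewrite ltr_norml => /andP[].
near=> y.
have yNx : `|y| < (N x)%:R by near: y; apply: (cvgr_lt `|x|) => //; apply: cvg_norm.
have [h|h] := leqP (N x) (N y).
  by apply: JE => //; move: yNx; rewrite ltr_norml => /andP[].
apply/esym; apply: JE => //; first exact: ltnW.
by have := xN y; rewrite ltr_norml => /andP[].
Unshelve. all: by end_near. Qed.

(** With [e t = K / c e^(c t)], any primitive [F0] makes [F0 + e] nondecreasing and [F0 - e]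
    nonincreasing. As [e] vanishes at -oo, the infimum of [F0 + e] is the limit of [F0] there;
    subtracting it gives the integral from -oo. *)
Lemma expR_dominated_primitive f K c : continuous f -> 0 < c ->
  (forall t, `|f t| <= K * expR (c * t)) ->
  exists2 F, has_derive F f & forall t, `|F t| <= K / c * expR (c * t).
Proof.
move=> cf c0 fK; have [F0 dF0] := has_derive_primitive cf.
pose e t := K / c * expR (c * t).
have de t : is_derive t 1 e (K * expR (c * t)).
  by apply: is_derive_eq; rewrite /GRing.scale/=; field; rewrite gt_eqF.
have incr s t : s <= t -> F0 s + e s <= F0 t + e t.
  move=> st; apply: (@ge0_is_derive_le (fun t => F0 t + e t) (fun t => f t + K * expR (c * t))) => // u _.
    exact: is_derive_add.
  by have := fK u; rewrite ler_norml => /andP[]; lra.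
have decr s t : s <= t -> F0 t - e t <= F0 s - e s.
  move=> st; apply: (@le0_is_derive_le (fun t => F0 t - e t) (fun t => f t - K * expR (c * t))) => // u _.
    by apply: is_derive_add => //; apply: is_derive_opp.
  by have := fK u; rewrite ler_norml => /andP[]; lra.
have K0 : 0 <= K.
  by have := fK 0; rewrite mulr0 expR0 mulr1; apply: le_trans.
have e0 t : 0 <= e t by rewrite mulr_ge0 ?expR_ge0// divr_ge0// ltW.
have lb s t : F0 t - e t <= F0 s + e s.
  have [st|/ltW ts] := leP s t.
    by have := decr _ _ st; have := e0 s; lra.
  by have := incr _ _ ts; have := e0 t; lra.
pose l := inf (range (fun t => F0 t + e t)).
have has_inf_e : has_inf (range (fun t => F0 t + e t)).
  split; first by exists (F0 0 + e 0), 0.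
  by exists (F0 0 - e 0) => _ [s _ <-].
exists (fun t => F0 t - l) => t.
  by rewrite -[f t]subr0; apply: is_derive_add.
rewrite ler_norml; apply/andP; split.
  suff : l <= F0 t + e t by rewrite /e; lra.
  by apply: ge_inf; [case: has_inf_e|exists t].
suff : F0 t - e t <= l by rewrite /e; lra.
by apply: lb_le_inf; [case: has_inf_e|move=> _ [s _ <-]].
Qed.

End real_derivatives.

(** * The Volterra equation starting at -oo *)

Section volterra.
Context {R : realType}.
Implicit Types (G z A B : R -> R) (t lam L M D K : R).
Variables (k eps : R).
Hypotheses (k0 : 0 < k) (eps0 : 0 < eps).
Local Notation c := (k + eps).
Ltac klra := have ? := k0; have ? := eps0; lra.
Let cn : c != 0. Proof. apply: lt0r_neq0; klra. Qed.
Let en : eps != 0. Proof. exact: lt0r_neq0. Qed.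

Lemma dist_thirds (x y x' y' e : R) : `|x - x'| < e / 3 -> `|x' - y'| < e / 3 ->
  `|y - y'| < e / 3 -> `|x - y| < e.
Proof.
rewrite !ltr_norml => /andP[? ?] /andP[? ?] /andP[? ?].
by apply/andP; split; lra.
Qed.

Lemma le0_geometric (x M : R) : (forall n, x <= M * 2 ^- n) -> x <= 0.
Proof.
move=> xM; rewrite leNgt; apply/negP => x0.
have M0 : 0 <= M by have := xM 0%N; rewrite expr0 invr1 mulr1; lra.
have := xM (Num.truncn (M / x)).+1; set n := (Num.truncn _).+1.
have nM : M / x < n%:R by exact: truncnS_gt.
have n2 : n%:R < 2 ^+ n :> R by rewrite -natrX ltr_nat ltn_expl.
rewrite ler_pdivlMr ?exprn_gt0// leNgt => /negP; apply.
by rewrite mulrC -ltr_pdivrMr//; lra.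
Qed.

(* The system [(e^(k t) A')' = - e^((k + eps) t) G(z)] with [A(-oo) = lam] and
   [(e^(k t) A')(-oo) = 0], in terms of [B = e^(k t) A']. *)
Definition volterra G lam z A B : Prop :=
  [/\ has_derive A (fun t => expR (- (k * t)) * B t),
      has_derive B (fun t => - (expR (c * t) * G (z t))),
      A x @[x --> -oo] --> lam & B x @[x --> -oo] --> (0 : R)].

(* With respect to this weight the map [z |-> A] is a contraction with ratio 1/2,
   whatever the Lipschitz constant [L]: no restriction to small intervals. *)
Definition weight (L t : R) : R := expR (2 * L / (c * eps) * expR (eps * t)).

Lemma weight_ge1 L t : 0 <= L -> 1 <= weight L t.
Proof.
by move=> L0; rewrite -[1]expR0 ler_expR mulr_ge0 ?expR_ge0// divr_ge0 ?mulr_ge0//; klra.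
Qed.

Lemma weight_le L s t : 0 <= L -> s <= t -> weight L s <= weight L t.
Proof.
move=> L0 st; rewrite ler_expR ler_wpM2l//; first by rewrite divr_ge0 ?mulr_ge0//; klra.
by rewrite ler_expR ler_pM2l.
Qed.

Lemma is_derive_weight L t :
  is_derive t 1 (weight L) (2 * L / c * expR (eps * t) * weight L t).
Proof.
rewrite /weight; apply: is_derive_eq; rewrite /GRing.scale/=; field; rewrite cn en.
by [].
Qed.

Lemma cvgNy_weight L : weight L x @[x --> -oo] --> (1 : R).
Proof.
rewrite -[1 in X in _ --> X]expR0 /weight.
apply: continuous_cvg; first exact: continuous_expR.
rewrite -[0 in X in _ --> X](mulr0 (2 * L / (c * eps))).
by apply: cvgMr; exact: cvgNy_expR.
Qed.

(** Two comparisons from -oo, with [W] the weight. The bound [L D / c e^(c t) W] for [B - B'] is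
    admissible because [W] increases: its derivative is the required [L D e^(c t) W] plus a
    nonnegative term. Multiplied by [e^(- k t)] it is exactly [(D / 2) W']; the factor 2 in the
    exponent of the weight is what produces the ratio 1/2. *)
Lemma volterra_contract G L D lam z z' A B A' B' : 0 <= L -> 0 <= D ->
  volterra G lam z A B -> volterra G lam z' A' B' ->
  (forall t, `|G (z t) - G (z' t)| <= L * `|z t - z' t|) ->
  (forall t, `|z t - z' t| <= D * weight L t) ->
  forall t, `|A t - A' t| <= D / 2 * weight L t.
Proof.
move=> L0 D0 [dA dB A0 B0] [dA' dB' A0' B0'] GL zD.
have dBB : forall t, `|B t - B' t| <= L * D / c * expR (c * t) * weight L t.
  pose g t := L * D * expR (c * t) * weight L t +
     L * D / c * expR (c * t) * (2 * L / c * expR (eps * t) * weight L t).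
  apply: (@norm_le_is_deriveNy _ (fun t => B t - B' t) _
    (fun t => - (expR (c * t) * G (z t)) + (expR (c * t) * G (z' t))) g).
  - by move=> t; have := dB t; have := dB' t => ? ?; apply: is_derive_eq; rewrite opprK.
  - move=> t; have := is_derive_weight L t => ?; apply: is_derive_eq.
    rewrite /g /GRing.scale/=; field; rewrite cn//.
  - by rewrite -(subrr (0 : R)); apply: cvgB.
  - rewrite -[0 in X in _ --> X](mul0r 1) -[0 in X in _ --> X](mulr0 (L * D / c)).
    apply: cvgM; last exact: cvgNy_weight.
    by apply: cvgMr; apply: cvgNy_expR; klra.
  - move=> t; rewrite addrC -mulrBr normrM ger0_norm ?expR_ge0//.
    rewrite distrC; apply: (@le_trans _ _ (expR (c * t) * (L * (D * weight L t)))).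
      rewrite ler_wpM2l ?expR_ge0// (le_trans (GL t))// ler_wpM2l//.
    rewrite /g -[leLHS]addr0; apply: lerD; first by rewrite le_eqVlt; apply/orP; left; apply/eqP; ring.
    have w0 := weight_ge1 t L0.
    by do ?apply: mulr_ge0; rewrite ?expR_ge0 ?invr_ge0//; klra.
(* The majorant has to vanish at -oo, where the weight tends to 1; hence [weight - 1]. *)
move=> t; apply: (@le_trans _ _ (D / 2 * (weight L t - 1))); last by rewrite ler_wpM2l//; lra.
move: t; apply: (@norm_le_is_deriveNy _ (fun t => A t - A' t) _
    (fun t => expR (- (k * t)) * B t - expR (- (k * t)) * B' t)
    (fun t => D / 2 * (2 * L / c * expR (eps * t) * weight L t))).
- by move=> t; have := dA t; have := dA' t => ? ?; apply: is_derive_eq.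
- move=> t; have := is_derive_weight L t => ?; apply: is_derive_eq.
  by rewrite /GRing.scale/= oppr0 addr0.
- by rewrite -(subrr lam); apply: cvgB.
- rewrite -[0 in X in _ --> X](mulr0 (D / 2)) -(subrr 1).
  by apply: cvgMr; apply: cvgB; [exact: cvgNy_weight|exact: cvg_cst].
- move=> t; rewrite -mulrBr normrM ger0_norm ?expR_ge0//.
  apply: le_trans (_ : expR (- (k * t)) * (L * D / c * expR (c * t) * weight L t) <= _).
    by rewrite ler_wpM2l ?expR_ge0.
  have -> : expR (eps * t) = expR (- (k * t)) * expR (c * t).
    by rewrite -expRD; congr expR; ring.
  rewrite le_eqVlt; apply/orP; left; apply/eqP; field; rewrite cn//.
Qed.

(** One Picard step: two integrations from -oo with [z] frozen inside [G]. The explicit bound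
    measures how far the first iterate is from the constant [lam]. *)
Lemma volterra_exists G K lam z : continuous z -> continuous G ->
  (forall x, `|G x| <= K) ->
  exists A, (exists B, volterra G lam z A B) /\
    forall t, `|A t - lam| <= K / (c * eps) * expR (eps * t).
Proof.
move=> cz cG GK.
have K0 : 0 <= K by apply: le_trans (GK 0).
have [||t|B dB B0] := @expR_dominated_primitive R (fun t => - (expR (c * t) * G (z t))) K c.
- move=> t; apply: cvgN; apply: cvgM.
    apply: (has_derive_continuous (F := fun t => expR (c * t)) (f := fun t => expR (c * t) * c)) => s.
    by apply: is_derive_eq; rewrite /GRing.scale/= mulr1.
  by apply: continuous_comp; [exact: cz|exact: cG].
- klra.
- by rewrite normrN normrM ger0_norm ?expR_ge0// mulrC ler_wpM2r ?expR_ge0.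
have [||t|A dA A0] := @expR_dominated_primitive R (fun t => expR (- (k * t)) * B t) (K / c) eps.
- move=> t; apply: cvgM.
    apply: (has_derive_continuous (F := fun t => expR (- (k * t))) (f := fun t => expR (- (k * t)) * - k)) => s.
    by apply: is_derive_eq; rewrite /GRing.scale/=; ring.
  exact: has_derive_continuous dB t.
- by [].
- rewrite normrM ger0_norm ?expR_ge0//.
  apply: (@le_trans _ _ (expR (- (k * t)) * (K / c * expR (c * t)))).
    by rewrite ler_wpM2l ?expR_ge0.
  have -> : expR (eps * t) = expR (- (k * t)) * expR (c * t).
    by rewrite -expRD; congr expR; ring.
  rewrite le_eqVlt; apply/orP; left; apply/eqP; ring.
have cvg0 (F : R -> R) M d : 0 < d -> (forall t, `|F t| <= M * expR (d * t)) ->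
    F x @[x --> -oo] --> (0 : R).
  move=> d0 FM; apply: norm_cvg0; apply: (@squeeze_cvgr _ _ _ _ (cst 0) (fun t => M * expR (d * t))).
  - by near=> x; rewrite normr_ge0 FM.
  - exact: cvg_cst.
  - by rewrite -[0 in X in _ --> X](mulr0 M); apply: cvgMr; exact: cvgNy_expR.
exists (fun t => A t + lam); split; last first.
  by move=> t; rewrite addrK (le_trans (A0 t))// ler_wpM2r ?expR_ge0// -mulrA -invfM.
exists B; split.
- by move=> t; have := dA t => ?; apply: is_derive_eq; rewrite addr0.
- exact: dB.
- rewrite -[lam in X in _ --> X]add0r; apply: cvgD; last exact: cvg_cst.
  exact: (cvg0 _ _ _ _ A0).
- by apply: (cvg0 _ _ _ _ B0); klra.
Unshelve. all: by end_near. Qed.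

(** Picard iteration from the constant [lam] in the weighted norm. The limit is built pointwise by
    nested intervals: the bounds [lo] increase, the bounds [hi] decrease, their distance being twice
    the tail of a geometric series. Since the weight is monotone, the convergence is uniform on left
    half-lines, whence continuity of the limit. *)
Lemma volterra_fixpoint G K L lam : (forall x, `|G x| <= K) -> 0 < L ->
  (forall x y, `|G x - G y| <= L * `|x - y|) ->
  exists z B, volterra G lam z z B.
Proof.
move=> GK L0 GL; have K0 : 0 <= K by apply: le_trans (GK 0).
have cG : continuous G.
  move=> x; apply/cvgrPdist_lt => e e0; near=> y.
  apply: (le_lt_trans (GL _ _)); rewrite mulrC -ltr_pdivlMr//.
  by near: y; apply: cvgr_dist_lt; rewrite ?divr_gt0.
pose M := K / (c * eps).
have [T hT] : {T : (R -> R) -> (R -> R) & forall z, continuous z ->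
    (exists B, volterra G lam z (T z) B) /\
    forall t, `|T z t - lam| <= M * expR (eps * t)}.
  apply: (@boolp.choice _ _ (fun z A => continuous z -> (exists B, volterra G lam z A B) /\
    forall t, `|A t - lam| <= M * expR (eps * t))) => z.
  have [cz|ncz] := pselect (continuous z); last by exists z.
  by have [A hA] := volterra_exists lam cz cG GK; exists A.
pose u n := iter n T (cst lam).
have cT z : continuous z -> continuous (T z).
  by move=> /hT[[B [dA _ _ _]] _]; exact: has_derive_continuous dA.
have cu n : continuous (u n).
  by elim: n => [|n IH]; [move=> x; exact: cvg_cst|exact: cT].
have ce0 : 0 < c * eps by rewrite mulr_gt0//; klra.
pose W := weight L.
have W1 t : 1 <= W t by apply: weight_ge1; exact: ltW.
(* The bound [M e^(eps t)] is [D0] times the exponent of the weight, hence at most [D0 W] because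
   [y <= e^y]. *)
pose D0 := M / (2 * L / (c * eps)).
have D00 : 0 <= D0 by rewrite !divr_ge0 ?mulr_ge0//; klra.
have du n t : `|u n.+1 t - u n t| <= D0 * 2 ^- n * W t.
  elim: n t => [t|n IH t].
    rewrite expr0 invr1 mulr1 (le_trans ((hT _ (cu 0%N)).2 t))// /D0 /W /weight.
    rewrite -mulrA ler_wpM2l//; first by rewrite divr_ge0// ltW.
    rewrite ler_pdivlMl; last by rewrite divr_gt0// mulr_gt0.
    by apply: le_trans (expR_ge1Dx _); rewrite lerDr.
  have [[B hB] _] := hT _ (cu n.+1); have [[B' hB'] _] := hT _ (cu n).
  have := volterra_contract (ltW L0) _ hB hB' (fun t => GL _ _) IH.
  rewrite (_ : D0 / 2 ^+ n / 2 = D0 / 2 ^+ n.+1); first by apply; rewrite mulr_ge0// invr_ge0 exprn_ge0.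
  by rewrite exprS invfM mulrA mulrAC.
have nW n t : 0 <= D0 * 2 ^- n * W t.
  apply: mulr_ge0; last exact: le_trans (W1 t).
  by rewrite mulr_ge0// invr_ge0 exprn_ge0.
have half n : D0 * 2 ^- n.+1 = D0 * 2 ^- n / 2.
  by rewrite exprS invfM mulrA mulrAC.
pose lo n t := u n t - 2 * (D0 * 2 ^- n * W t).
pose hi n t := u n t + 2 * (D0 * 2 ^- n * W t).
have lo_incr t : {homo (fun n => lo n t) : m n / (m <= n)%N >-> m <= n}.
  apply: homo_leq => //; first exact: le_trans.
  move=> n; have := du n t; rewrite ler_norml /lo half => /andP[]; have := nW n t.
  by set x := D0 / _ => ???; lra.
have hi_decr t : {homo (fun n => hi n t) : m n / (n <= m)%N >-> m <= n}.
  move=> m n; elim: m => [|m IH]; first by rewrite leqn0 => /eqP->.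
  rewrite leq_eqVlt => /predU1P[->//|]; rewrite ltnS => /IH; apply: le_trans.
  have := du m t; rewrite ler_norml /hi half => /andP[]; have := nW m t.
  by set x := D0 / _ => ???; lra.
have lohi m n t : lo m t <= hi n t.
  apply: (le_trans (lo_incr t _ _ (leq_maxl m n))).
  apply: (le_trans _ (hi_decr t _ _ (leq_maxr m n))).
  by rewrite /lo /hi; have := nW (maxn m n) t; lra.
pose z t := sup (range (fun n => lo n t)).
have zu n t : `|z t - u n t| <= 2 * (D0 * 2 ^- n * W t).
  have hs : has_sup (range (fun n => lo n t)).
    by split; [exists (lo 0%N t), 0%N|exists (hi 0%N t) => _ [m _ <-]].
  have lz : lo n t <= z t by apply: sup_ubound; [case: hs|exists n].
  have zh : z t <= hi n t by apply: ge_sup; [case: hs|move=> _ [m _ <-]].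
  by rewrite ler_norml; move: lz zh; rewrite /lo /hi => ??; apply/andP; split; lra.
have cz : continuous z.
  move=> t; apply/cvgrPdist_lt => e e0.
  have [n hn] : exists n, 2 * (D0 * 2 ^- n * W (t + 1)) < e / 3.
    apply: contrapT => /forallNP h.
    suff : e / 3 <= 0 by lra.
    apply: (@le0_geometric _ (2 * D0 * W (t + 1))) => n.
    have := h n; set a := 2 * _ => /negP; rewrite -leNgt => /le_trans; apply.
    by rewrite /a le_eqVlt; apply/orP; left; apply/eqP; ring.
  near=> s.
  have st : s <= t + 1.
    apply/ltW; near: s; apply: (@cvgr_lt _ _ _ _ _ t); [exact: cvg_id|lra].
  have us : `|u n t - u n s| < e / 3.
    by near: s; apply: cvgr_dist_lt; [exact: cu|rewrite divr_gt0].
  have zs : `|z s - u n s| < e / 3.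
    apply: le_lt_trans (zu n s) (le_lt_trans _ hn).
    rewrite ler_wpM2l// ler_wpM2l ?weight_le ?(ltW L0)//.
    by rewrite mulr_ge0// invr_ge0 exprn_ge0.
  have zt : `|z t - u n t| < e / 3.
    apply: le_lt_trans (zu n t) (le_lt_trans _ hn).
    rewrite ler_wpM2l// ler_wpM2l ?weight_le ?(ltW L0)//; last by lra.
    by rewrite mulr_ge0// invr_ge0 exprn_ge0.
  exact: dist_thirds zt us zs.
have [[B hB] _] := hT _ cz.
suff Tz : T z = z by exists z, B; rewrite -{2}Tz.
apply/funext => t; apply/eqP; rewrite -subr_eq0 -normr_le0.
apply: (@le0_geometric _ (2 * (D0 * W t))) => n.
have [[B' hB'] _] := hT _ (cu n).
have D0n : 0 <= 2 * (D0 / 2 ^+ n) by rewrite mulr_ge0// divr_ge0// exprn_ge0.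
have h1 : `|T z t - u n.+1 t| <= 2 * (D0 / 2 ^+ n) / 2 * W t.
  apply: (volterra_contract (ltW L0) D0n hB hB' (fun t => GL _ _)) => s.
  by rewrite -mulrA; exact: zu.
have h2 := zu n.+1 t; rewrite half in h2.
have {1}-> : T z t - z t = (T z t - u n.+1 t) - (z t - u n.+1 t) by ring.
apply: (le_trans (ler_normB _ _)); apply: (le_trans (lerD h1 h2)).
by rewrite le_eqVlt; apply/orP; left; apply/eqP; field; rewrite expf_neq0.
Unshelve. all: by end_near. Qed.

End volterra.

(** * Convexity and Lipschitz bounds for real powers *)

Section powR_convexity.
Context {R : realType}.
Implicit Types x y p M : R.

(** Mean value theorem together with monotonicity of [t^(p - 1)]. Zero arguments are treated apart,
    since the power is differentiated at positive points only. *)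
Lemma powR_tangent p x y : 1 < p -> 0 <= x -> 0 <= y ->
  y `^ p + p * y `^ (p - 1) * (x - y) <= x `^ p.
Proof.
move=> p1; rewrite le0r => /predU1P[->|x0]; rewrite le0r => /predU1P[->|y0].
- by rewrite !powR0 ?subrr ?mulr0 ?addr0//; lra.
- rewrite powR0 ?gt_eqF//; last lra.
  have -> : y `^ p = y `^ (p - 1) * y by rewrite powRB ?gt_eqF// powRr1 ?ltW// divfK ?gt_eqF.
  have : 0 < y `^ (p - 1) * y by rewrite mulr_gt0// powR_gt0.
  by move=> h; rewrite sub0r; nra.
- rewrite powR0 ?gt_eqF//; last lra.
  rewrite powR0 ?gt_eqF//; last lra.
  by rewrite mulr0 mul0r addr0 powR_ge0.
have der (u v : R) : 0 < u -> u < v -> exists2 t, u < t < v &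
    v `^ p - u `^ p = p * t `^ (p - 1) * (v - u).
  move=> u0 uv; have [|t utv E] := @MVT_is_derive R (fun t => t `^ p) (fun t => p * t `^ (p - 1)) u v uv.
    by move=> s /andP[us _]; apply: is_derive1_powR; exact: lt_le_trans us.
  by exists t.
have mono (u v : R) : 0 < u -> u < v -> u `^ (p - 1) <= v `^ (p - 1).
  by move=> u0 uv; apply: ge0_ler_powR; rewrite ?nnegrE; lra.
have [xy|yx|->] := ltgtP x y; last by rewrite subrr mulr0 addr0.
  have [t /andP[xt ty] E] := der x y x0 xy.
  have yx0 : 0 <= p * (y - x) by rewrite mulr_ge0 ?subr_ge0 ?ltW//; lra.
  have := ler_wpM2l yx0 (mono t y (lt_trans x0 xt) ty); lra.
have [t /andP[yt tx] E] := der y x y0 yx.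
have xy0 : 0 <= p * (x - y) by rewrite mulr_ge0 ?subr_ge0 ?ltW//; lra.
have := ler_wpM2l xy0 (mono y t y0 yt); lra.
Qed.

Lemma powR_lipschitz p M x y : 1 < p -> 0 <= x <= M -> 0 <= y <= M ->
  `|x `^ p - y `^ p| <= p * M `^ (p - 1) * `|x - y|.
Proof.
move=> p1.
wlog xy : x y / x <= y => [H|/andP[x0 xM] /andP[y0 yM]].
  have [/H //|/ltW yx hx hy] := leP x y.
  by rewrite distrC [X in _ * X]distrC; exact: H.
have xyp : x `^ p <= y `^ p by apply: ge0_ler_powR; rewrite ?nnegrE//; lra.
rewrite distrC ger0_norm ?subr_ge0// distrC ger0_norm ?subr_ge0//.
have := powR_tangent p1 x0 y0.
have yM' : y `^ (p - 1) <= M `^ (p - 1).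
  by apply: ge0_ler_powR; rewrite ?nnegrE//; lra.
have yx0 : 0 <= p * (y - x) by rewrite mulr_ge0 ?subr_ge0//; lra.
have := ler_wpM2l yx0 yM'; lra.
Qed.

Lemma ge0_powRS p x : 0 <= x -> p != 0 -> p != 1 -> x `^ p = x `^ (p - 1) * x.
Proof.
rewrite le0r => /predU1P[->|x0 p0 p1]; first by move=> ? ?; rewrite !powR0 ?mulr0// subr_eq0.
have xn := lt0r_neq0 x0.
by rewrite powRB ?xn ?implybT// powRr1 ?ltW// divfK.
Qed.

End powR_convexity.

(** * First nonpositive points and limits at +oo *)

Section real_functions.
Context {R : realType}.
Implicit Types (F f g z : R -> R).

(** The point is the infimum of the set where [z] is nonpositive, which is bounded below by [T] and
    closed. It starts each continuation argument: what positivity implies before [t0] is played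
    against [z t0 <= 0]. *)
Lemma first_nonpos z T t1 : continuous z -> (forall t, t <= T -> 0 < z t) -> z t1 <= 0 ->
  exists2 t0, z t0 <= 0 & forall t, t < t0 -> 0 < z t.
Proof.
move=> cz zT z1.
pose S := [set t | z t <= 0].
have hS : has_inf S.
  split; first by exists t1.
  exists T => t; rewrite /S/= => zt; rewrite leNgt; apply/negP => /ltW/zT; lra.
exists (inf S); last first.
  by move=> t tS; rewrite ltNge; apply/negP => zt; move: tS; rewrite ltNge ge_inf//; case: hS.
rewrite leNgt; apply/negP => zS.
have /cvgrPdist_lt/(_ _ zS)[e /= e0 he] := cz (inf S).
have [s Ss se] := inf_adherent e0 hS.
have := he s; rewrite /ball/= => /(_ _).
have sS : inf S <= s by apply: ge_inf => //; case: hS.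
rewrite distrC ger0_norm ?subr_ge0// ltrBlDl => /(_ se).
by rewrite ltr_norml => /andP[_]; move: Ss; rewrite /S/=; lra.
Qed.

(** On a step of length [h] the mean of [f] is below [e / 2], since [F] has nearly converged, and
    [f] varies by at most [K h < e / 2], since its derivative is bounded by [K]. Using [K + 1] in
    [h] covers [K = 0]. *)
Lemma barbalat F f g (K T l : R) : has_derive F f -> has_derive f g ->
  (forall t, T <= t -> `|g t| <= K) -> F x @[x --> +oo] --> l -> f x @[x --> +oo] --> (0 : R).
Proof.
move=> dF df gK /cvgy_dist Fl; apply/cvgy_dist => e e0.
have K0 : 0 <= K by apply: le_trans (gK T (lexx T)).
pose h := e / (2 * (K + 1)).
have h0 : 0 < h by rewrite divr_gt0//; lra.
have Kh : (K + 1) * h = e / 2 by rewrite /h; field; lra.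
have [S FS] := Fl (e * h / 4) ltac:(by rewrite divr_gt0// mulr_gt0).
exists (Num.max S T) => t; rewrite ge_max subr0 => /andP[St Tt].
have [||x /andP[tx xt] E] := @MVT_is_derive R F f t (t + h); [lra|by move=> *; exact: dF|].
have [||y /andP[ty yx] E'] := @MVT_is_derive R f g t x; [lra|by move=> *; exact: df|].
have := FS t St; have := FS (t + h) ltac:(lra); have := gK y ltac:(lra).
move: E E'; rewrite [t + h]addrC addrK => E E'.
rewrite !ltr_norml !ler_norml => /andP[? ?] /andP[? ?] /andP[? ?].
have fx : - (e / 2) < f x < e / 2.
  by apply/andP; split; rewrite -(ltr_pM2r h0) -?E; lra.
have : - (K * h) <= f x - f t <= K * h.
  by rewrite E'; apply/andP; split; nra.
by move: fx => /andP[? ?] /andP[? ?]; apply/andP; split; nra.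
Qed.

Lemma nonincreasing_cvgy F (M : R) : (forall s t, s <= t -> F t <= F s) ->
  (forall t, M <= F t) -> exists2 l, F x @[x --> +oo] --> l & forall t, l <= F t.
Proof.
move=> dec lb.
have hI : has_inf (range F) by split; [exists (F 0), 0|exists M => _ [t _ <-]].
exists (inf (range F)) => [|t]; last by apply: ge_inf; [case: hI|exists t].
apply/cvgy_dist => e e0; have [_ [T _ <-] FT] := inf_adherent e0 hI.
exists T => t Tt; rewrite ger0_norm ?subr_ge0; last by apply: ge_inf; [case: hI|exists t].
by rewrite ltrBlDl; apply: le_lt_trans FT; exact: dec.
Qed.

End real_functions.

(** * The Emden-Fowler equation *)

Section emden_fowler.
Context {R : realType}.
Implicit Types (G z v w A B : R -> R) (s t x y lam K M T : R).
Variables (nu a p : R).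
Hypotheses (a0 : 0 < a) (anu : a < nu) (p1 : 1 < p).
Local Notation d := (nu - a).
Local Notation k := (2 * nu).
Local Notation eps := ((p - 1) * d).
Local Notation c := (k + eps).
Local Notation b := (nu ^+ 2 - a ^+ 2).
Local Notation C := (b `^ (p - 1)^-1).
Ltac hlra := have ? := a0; have ? := anu; have ? := p1; lra.

Let d0 : 0 < d. Proof. hlra. Qed.
Let k0 : 0 < k. Proof. hlra. Qed.
Let p10 : 0 < p - 1. Proof. hlra. Qed.
Let eps0 : 0 < eps. Proof. exact: mulr_gt0. Qed.
Let c0 : 0 < c. Proof. exact: addr_gt0. Qed.
Let b0 : 0 < b. Proof. by rewrite subr_sqr mulr_gt0 ?subr_gt0//; hlra. Qed.

(* The equation [v'' + 2 a v' - b v + v^p = 0], as a first-order system. *)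
Definition solution v w : Prop :=
  [/\ has_derive v w,
      has_derive w (fun t => - (2 * a * w t) + b * v t - v t `^ p) &
      forall t, 0 < v t].

Definition energy v w t : R :=
  w t ^+ 2 / 2 - b * v t ^+ 2 / 2 + v t `^ (p + 1) / (p + 1).

Definition tends_to_0_from v w : Prop :=
  [/\ v x @[x --> -oo] --> (0 : R), w x @[x --> -oo] --> (0 : R) &
      exists T, forall t, t <= T -> 0 < v t /\ 0 < w t].

Lemma is_derive_energy v w t : 0 < v t -> is_derive t 1 v (w t) ->
  is_derive t 1 w (- (2 * a * w t) + b * v t - v t `^ p) ->
  is_derive t 1 (energy v w) (- (2 * a * w t ^+ 2)).
Proof.
move=> v0 dv dw; have dvp := is_derive_powRf (p + 1) v0 dv.
rewrite addrK in dvp.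
have dv2 := is_derive_sqr dv; have dw2 := is_derive_sqr dw.
rewrite /energy; apply: is_derive_eq; rewrite /GRing.scale/=.
by field; apply: lt0r_neq0; hlra.
Qed.

Lemma energy_lower v w t : 0 < v t -> - (b * v t ^+ 2 / 2) <= energy v w t.
Proof.
move=> v0; rewrite /energy.
have h1 : 0 <= w t ^+ 2 by exact: sqr_ge0.
have h2 : 0 <= v t `^ (p + 1) / (p + 1) by rewrite divr_ge0 ?powR_ge0//; hlra.
by lra.
Qed.

Lemma energy_cvgNy v w : tends_to_0_from v w -> energy v w x @[x --> -oo] --> (0 : R).
Proof.
move=> [v0 w0 [T vT]].
have pp : 0 < p + 1 by hlra.
have -> : 0 = 0 ^+ 2 / 2 - b * 0 ^+ 2 / 2 + 0 `^ (p + 1) / (p + 1) :> R.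
  by rewrite powR0 ?gt_eqF// expr2 !mulr0 !mul0r subrr addr0.
apply: cvgD; last apply: cvgM; last exact: cvg_cst.
  apply: cvgB; apply: cvgM; try exact: cvg_cst.
    by rewrite expr2; apply: cvgM.
  apply: cvgM; first exact: cvg_cst.
  by rewrite expr2; apply: cvgM.
have -> : 0 `^ (p + 1) = 0 :> R by rewrite powR0 ?gt_eqF.
suff n0 : \forall t \near -oo, cst 0 t <= v t `^ (p + 1) <= v t.
  by apply: (squeeze_cvgr n0) => //; exact: cvg_cst.
near=> t; rewrite powR_ge0/=.
have vt0 : 0 < v t by apply: (vT t _).1; near: t; apply: nbhs_ninfty_le; exact: num_real.
have -> : v t `^ (p + 1) = v t `^ p * v t.
  have pn : p + 1 != 1 by apply/eqP; hlra.
  by rewrite (ge0_powRS (ltW vt0) (lt0r_neq0 pp) pn) addrK.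
rewrite -[leRHS]mul1r ler_pM2r//; have <- : 1 `^ p = 1 :> R by rewrite powR1.
have v1 : v t < 1 by near: t; apply: (cvgr_lt 0) => //; exact: ltr01.
by apply: ge0_ler_powR; rewrite ?nnegrE; hlra.
Unshelve. all: by end_near. Qed.

(** Restricted to [t < T] because it also serves before positivity of the solution is known on the
    whole line. *)
Lemma energy_mono v w T :
  (forall t, t < T -> 0 < v t) ->
  (forall t, t < T -> is_derive t 1 v (w t)) ->
  (forall t, t < T -> is_derive t 1 w (- (2 * a * w t) + b * v t - v t `^ p)) ->
  forall s t, s <= t -> t < T -> energy v w t <= energy v w s.
Proof.
move=> v0 dv dw s t st tT.
apply: (@le0_is_derive_le R _ (fun t => - (2 * a * w t ^+ 2))) => // x /andP[sx xt].
  by apply: is_derive_energy; [apply: v0|apply: dv|apply: dw]; lra.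
by rewrite oppr_le0 mulr_ge0 ?sqr_ge0//; hlra.
Qed.

(** The energy decreases from its limit 0, and strictly so on an interval [(s - 1, s)] placed where
    [w] is positive. *)
Lemma energy_lt0 v w T : tends_to_0_from v w ->
  (forall t, t < T -> 0 < v t) ->
  (forall t, t < T -> is_derive t 1 v (w t)) ->
  (forall t, t < T -> is_derive t 1 w (- (2 * a * w t) + b * v t - v t `^ p)) ->
  forall t, t < T -> energy v w t < 0.
Proof.
move=> vw0 v0 dv dw t tT.
have mono := energy_mono v0 dv dw.
have le0 s : s < T -> energy v w s <= 0.
  move=> sT; apply: (cvgr_to_ge (energy_cvgNy vw0)); exists s; split; first exact: num_real.
  by move=> u /ltW us; apply: mono.
have [_ _ [S wS]] := vw0.
pose s := Num.min S t.
have sS : s <= S by rewrite ge_min lexx.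
have st : s <= t by rewrite ge_min lexx orbT.
apply: le_lt_trans (mono _ _ st tT) _.
apply: lt_le_trans (le0 (s - 1) ltac:(lra)).
rewrite -ltrN2; apply: (@gt0_is_derive_lt R (fun t => - energy v w t) (fun t => 2 * a * w t ^+ 2)); first lra.
  move=> x /andP[sx xs]; rewrite -[X in is_derive _ _ _ X]opprK; apply: is_derive_opp.
  by apply: is_derive_energy; [apply: v0|apply: dv|apply: dw]; lra.
move=> x /andP[sx xs]; rewrite mulr_gt0 ?exprn_gt0//; first by hlra.
by apply: (wS x _).2; lra.
Qed.

Section volterra_solution.
Variables (G z B : R -> R) (lam K : R).
Hypotheses (lam0 : 0 < lam) (G0 : forall t, 0 <= G (z t)).
Hypothesis zB : volterra k eps G lam z z B.

(** A nonnegative nonlinearity makes [B] nonincreasing from 0, so [z] decreases from [lam]. This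
    removes the truncation from above. *)
Lemma volterra_le t : B t <= 0 /\ z t <= lam.
Proof.
have [dz dB zl Bl] := zB.
have B0 s : B s <= 0.
  apply: (@le_is_deriveNy R B (cst 0) _ (cst 0) 0 0 dB) => //.
  - by move=> x; exact: is_derive_cst.
  - exact: cvg_cst.
  - by move=> x; rewrite oppr_le0 mulr_ge0 ?expR_ge0.
split=> //; apply: (@le_is_deriveNy R z (cst lam) _ (cst 0) lam lam dz) => //.
- by move=> x; exact: is_derive_cst.
- exact: cvg_cst.
- by move=> x; rewrite mulr_ge0_le0 ?expR_ge0.
Qed.

(** Because [d^2 + 2 a d = b], the substitution [v = e^(d t) z] cancels the term of order zero:
    [z'' + 2 nu z' = - e^(eps t) G(z)], which is the system [volterra] with [k = 2 nu]. The second
    function is the derivative of the first, with [z' = e^(- k t) B]. *)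
Definition emden_v t : R := expR (d * t) * z t.
Definition emden_w t : R := expR (d * t) * (d * z t + expR (- (k * t)) * B t).

Lemma is_derive_emden_v : has_derive emden_v emden_w.
Proof.
move=> t; have [dz _ _ _] := zB; have := dz t => ?.
by apply: is_derive_eq; rewrite /GRing.scale/= /emden_w; ring.
Qed.

Lemma is_derive_emden_w t : is_derive t 1 emden_w
  (- (2 * a * emden_w t) + b * emden_v t - expR (p * (d * t)) * G (z t)).
Proof.
have [dz dB _ _] := zB; have := dz t => ?; have := dB t => ?.
apply: is_derive_eq; rewrite /GRing.scale/= /emden_v /emden_w.
have -> : expR (p * (d * t)) = expR (d * t) * (expR (- (k * t)) * expR (c * t)).
  by rewrite -!expRD; congr expR; ring.
by ring.
Qed.

Hypothesis GK : forall t, G (z t) <= K.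

(** From [|B| <= K / c e^(c t)] the derivative [z'] is of order [e^(eps t)]; thus [v] and [w] behave
    like [lam e^(d t)] and [d lam e^(d t)]. *)
Lemma emden_tends_to_0 : tends_to_0_from emden_v emden_w.
Proof.
have [dz dB zl Bl] := zB.
have K0 : 0 <= K by apply: le_trans (G0 0) (GK 0).
have BK t : `|B t| <= K / c * expR (c * t).
  move: t; apply: (norm_le_is_deriveNy (g := fun t => K * expR (c * t)) dB) => //.
  - by move=> t; apply: is_derive_eq; rewrite /GRing.scale/=; field; exact: lt0r_neq0.
  - by rewrite -(mulr0 (K / c)); apply: cvgMr; exact: cvgNy_expR.
  - by move=> t; rewrite normrN normrM !ger0_norm ?expR_ge0// mulrC ler_wpM2r ?expR_ge0.
have q0 : expR (- (k * t)) * B t @[t --> -oo] --> (0 : R).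
  apply: norm_cvg0; apply: (@squeeze_cvgr _ _ _ _ (cst 0) (fun t => K / c * expR (eps * t))).
  - near=> t; rewrite normr_ge0/= normrM ger0_norm ?expR_ge0//.
    have -> : expR (eps * t) = expR (- (k * t)) * expR (c * t).
      by rewrite -expRD; congr expR; ring.
    by rewrite mulrCA ler_wpM2l ?expR_ge0.
  - exact: cvg_cst.
  - by rewrite -(mulr0 (K / c)); apply: cvgMr; exact: cvgNy_expR.
have m0 : d * z t + expR (- (k * t)) * B t @[t --> -oo] --> d * lam.
  by rewrite -[d * lam]addr0; apply: cvgD => //; apply: cvgMr.
split.
- by rewrite -(mul0r lam); apply: cvgM => //; exact: cvgNy_expR.
- by rewrite -(mul0r (d * lam)); apply: cvgM => //; exact: cvgNy_expR.
- have [|T TP] := cvgNy_gt0_near m0; first exact: mulr_gt0.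
  have [T' TP'] := cvgNy_gt0_near zl lam0.
  exists (Num.min T T') => t; rewrite le_min => /andP[/TP h /TP' h'].
  by rewrite /emden_w /emden_v !mulr_gt0// expR_gt0.
Unshelve. all: by end_near. Qed.

End volterra_solution.

(* [z = e^(- d t) v] tends to [lam] at [-oo] exactly when [U r ~ lam r^(nu - nu_star)]
   at 0, where [U r = r^(- 2 / (p - 1)) v (ln r)]. *)
Definition profile lam z B : Prop :=
  volterra k eps (fun x => x `^ p) lam z z B /\ forall t, 0 < z t.

Lemma profile_solution lam z B : profile lam z B ->
  solution (emden_v z) (emden_w z B).
Proof.
move=> [zB z0]; split.
- exact: is_derive_emden_v zB.
- move=> t; have := is_derive_emden_w zB t; congr is_derive; congr (_ - _).
  rewrite /emden_v powRM ?expR_ge0 ?ltW//; congr (_ * _).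
  by rewrite -expRM mulrC.
- by move=> t; rewrite mulr_gt0 ?expR_gt0.
Qed.

Lemma profile_le lam z B t : profile lam z B -> z t <= lam.
Proof. by move=> [zB _]; apply: (volterra_le _ zB t).2 => s; exact: powR_ge0. Qed.

Lemma profile_tends_to_0 lam z B : 0 < lam -> profile lam z B ->
  tends_to_0_from (emden_v z) (emden_w z B).
Proof.
move=> lam0 zB; apply: (emden_tends_to_0 lam0 _ zB.1 (K := lam `^ p)) => t.
  exact: powR_ge0.
have z0 := zB.2 t; have zl := profile_le t zB.
by apply: ge0_ler_powR; rewrite ?nnegrE; hlra.
Qed.

(** Both profiles lie in [[0, lam]], where the power is Lipschitz. Starting from the crude bound
    [|z - z'| <= lam], the contraction applied [n] times gives [lam 2^(- n)] times the weight. *)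
Lemma profile_unique lam z z' B B' : 0 < lam -> profile lam z B -> profile lam z' B' ->
  z = z'.
Proof.
move=> lam0 zB zB'; pose L := p * lam `^ (p - 1).
have L0 : 0 <= L by rewrite mulr_ge0 ?powR_ge0//; hlra.
have zl t := profile_le t zB; have zl' t := profile_le t zB'.
have [_ z0] := zB; have [_ z0'] := zB'.
have H n t : `|z t - z' t| <= lam / 2 ^+ n * weight k eps L t.
  elim: n t => [|n IH] t.
    apply: (@le_trans _ _ lam).
      have := zl t; have := zl' t; have := z0 t; have := z0' t.
      by rewrite ler_norml => ????; apply/andP; split; lra.
    rewrite expr0 divr1 ler_peMr ?(ltW lam0)// weight_ge1//; exact: eps0.
  have -> : lam / 2 ^+ n.+1 = lam / 2 ^+ n / 2 by rewrite exprS invfM mulrA mulrAC.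
  have D0 : 0 <= lam / 2 ^+ n by rewrite divr_ge0 ?exprn_ge0 ?ltW.
  apply: (volterra_contract k0 eps0 L0 D0 zB.1 zB'.1 _ IH).
  move=> s; apply: powR_lipschitz => //.
    by rewrite zl ltW.
  by rewrite zl' ltW.
apply/funext => t; apply/eqP; rewrite -subr_eq0 -normr_le0.
apply: (@le0_geometric R _ (lam * weight k eps L t)) => n.
by rewrite mulrAC; exact: H.
Qed.

(** Solves the equation with the argument of the power clipped to [[0, lam]], then shows that the
    solution never leaves this interval. Before a first nonpositive point the truncated and the true
    equation coincide, so the energy argument is available up to that point. *)
Lemma profile_exists lam : 0 < lam -> exists z B, profile lam z B.
Proof.
move=> lam0; pose G x := Num.min (Num.max x 0) lam `^ p.
have trunc0 x : 0 <= Num.min (Num.max x 0) lam <= lam.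
  by rewrite ge_min lexx orbT andbT le_min le_max lexx orbT ltW.
have trunc_lip x y : `|Num.min (Num.max x 0) lam - Num.min (Num.max y 0) lam| <= `|x - y|.
  wlog xy : x y / x <= y => [H|].
    by have [/H //|/ltW/H] := leP x y; rewrite distrC [X in _ <= X]distrC.
  rewrite distrC [X in _ <= X]distrC [X in _ <= X]ger0_norm ?subr_ge0//.
  rewrite ler_norml /Order.min /Order.max; apply/andP; split;
    case: (ltP x 0) => ?; case: (ltP y 0) => ?; do 2?case: ltP => ?; lra.
have G0 x : 0 <= G x by exact: powR_ge0.
have GK x : G x <= lam `^ p.
  have /andP[? ?] := trunc0 x.
  by apply: ge0_ler_powR; rewrite ?nnegrE//; hlra.
pose L := p * lam `^ (p - 1).
have L0 : 0 < L by rewrite mulr_gt0 ?powR_gt0//; hlra.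
have [|x y|z [B zB]] := @volterra_fixpoint R k eps k0 eps0 G (lam `^ p) L lam _ L0.
- by move=> x; rewrite ger0_norm.
- apply: (le_trans (powR_lipschitz p1 (trunc0 x) (trunc0 y))).
  by rewrite ler_wpM2l// ltW.
exists z, B.
have zl t : z t <= lam := (volterra_le (fun t => G0 (z t)) zB t).2.
have GE t : 0 <= z t -> G (z t) = z t `^ p.
  by move=> z0; rewrite /G max_l// min_l.
have [dz dB zlam Bl] := zB.
have z0 t1 : 0 < z t1.
  rewrite ltNge; apply/negP => z1.
  have cz : continuous z := has_derive_continuous dz.
  have [T zT] := cvgNy_gt0_near zlam lam0.
  have [t0 zt0 zpos] := first_nonpos cz zT z1.
  have dv := is_derive_emden_v zB; have dw := is_derive_emden_w zB.
  have vw0 := emden_tends_to_0 lam0 (fun t => G0 (z t)) zB (fun t => GK (z t)).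
  have v0 t : t < t0 -> 0 < emden_v z t by move=> /zpos h; rewrite mulr_gt0// expR_gt0.
  have dw' t : t < t0 -> is_derive t 1 (emden_w z B)
      (- (2 * a * emden_w z B t) + b * emden_v z t - emden_v z t `^ p).
    move=> tt0; have := dw t; congr is_derive; congr (_ - _).
    rewrite GE ?ltW ?zpos// /emden_v powRM ?expR_ge0 ?ltW ?zpos//; congr (_ * _).
    by rewrite -expRM mulrC.
  have neg := energy_lt0 vw0 v0 (fun t _ => dv t) dw'.
  have mono := energy_mono v0 (fun t _ => dv t) dw'.
  (* From [t0 - 1] on the energy stays below [e < 0], whereas its lower bound [- b v^2 / 2] tends to
     0 at [t0], where [v] vanishes. *)
  pose e := energy (emden_v z) (emden_w z B) (t0 - 1).
  have e0 : e < 0 by apply: neg; lra.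
  have cv : continuous (emden_v z) := has_derive_continuous dv.
  have cb : - (b * emden_v z t ^+ 2 / 2) @[t --> t0^'-] --> - (b * emden_v z t0 ^+ 2 / 2).
    apply: cvg_at_left_filter.
    apply: cvgN; apply: cvgM; last exact: cvg_cst.
    apply: cvgM; first exact: cvg_cst.
    by rewrite expr2; apply: cvgM; exact: cv.
  have cvl : emden_v z t @[t --> t0^'-] --> emden_v z t0.
    exact/cvg_at_left_filter/cv.
  have vt0 : 0 <= emden_v z t0.
    by apply: (cvgr_to_ge cvl); near=> t; apply/ltW/v0; near: t; exact: nbhs_left_lt.
  have vt0' : emden_v z t0 <= 0 by rewrite /emden_v pmulr_rle0// expR_gt0.
  have : - (b * emden_v z t0 ^+ 2 / 2) <= e.
    apply: (cvgr_to_le cb); near=> t.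
    have tt0 : t < t0 by near: t; exact: nbhs_left_lt.
    apply: (le_trans (energy_lower _ (v0 _ tt0))); apply: mono => //.
    near: t; apply: nbhs_left_ge; lra.
  have -> : emden_v z t0 = 0 by apply/eqP; rewrite eq_le vt0 vt0'.
  have -> : b * 0 ^+ 2 / 2 = 0 by ring.
  by rewrite oppr0 leNgt e0.
split=> //; split=> // t.
by have := dB t; rewrite GE// ltW.
Unshelve. all: by end_near. Qed.

End emden_fowler.

Section has_derive_monotone.
Context {R : realType}.
Implicit Types (F f : R -> R) (x y t : R).

Lemma ge0_has_derive_le F f x y : has_derive F f -> x <= y ->
  (forall t, x < t < y -> 0 <= f t) -> F x <= F y.
Proof. by move=> dF xy; apply: ge0_is_derive_le xy _ => t _; exact: dF. Qed.

Lemma le0_has_derive_le F f x y : has_derive F f -> x <= y ->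
  (forall t, x < t < y -> f t <= 0) -> F y <= F x.
Proof. by move=> dF xy; apply: le0_is_derive_le xy _ => t _; exact: dF. Qed.

Lemma MVT_has_derive F f x y : has_derive F f -> x < y ->
  exists2 t, x < t < y & F y - F x = f t * (y - x).
Proof. by move=> dF xy; apply: MVT_is_derive xy _ => t _; exact: dF. Qed.

End has_derive_monotone.

(** * Asymptotics and comparison of solutions *)

Section asymptotics.
Context {R : realType}.
Implicit Types (z v w A B : R -> R) (s t x y lam K M T : R).
Variables (nu a p : R).
Hypotheses (a0 : 0 < a) (anu : a < nu) (p1 : 1 < p).
Local Notation b := (nu ^+ 2 - a ^+ 2).
Local Notation C := (b `^ (p - 1)^-1).
Local Notation solution := (solution nu a p).
Local Notation profile := (profile nu a p).
Local Notation energy := (energy nu a p).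
Local Notation emden_v := (emden_v nu a).
Local Notation emden_w := (emden_w nu a).
Ltac hlra := have ? := a0; have ? := anu; have ? := p1; lra.

Let d0 : 0 < nu - a. Proof. hlra. Qed.
Let p10 : 0 < p - 1. Proof. hlra. Qed.
Let b0 : 0 < b. Proof. by rewrite subr_sqr mulr_gt0 ?subr_gt0//; hlra. Qed.
Let C0 : 0 < C. Proof. exact: powR_gt0. Qed.

Lemma powR_equilibrium : C `^ (p - 1) = b.
Proof. by rewrite -powRrM mulVf ?lt0r_neq0// powRr1 ?ltW. Qed.

Lemma powR_split x : 0 < x -> x `^ p = x `^ (p - 1) * x.
Proof. by move=> x0; rewrite ge0_powRS ?ltW// ?lt0r_neq0 ?gt_eqF//; hlra. Qed.

Lemma powR_mono (q x y : R) : 0 < q -> 0 < x -> x <= y -> x `^ q <= y `^ q.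
Proof. by move=> q0 x0 xy; apply: ge0_ler_powR; rewrite ?nnegrE; lra. Qed.

(** This solution represents [U_infty], so a comparison with [U_infty] is a comparison of two
    solutions. *)
Lemma solution_equilibrium : solution (cst C) (cst 0).
Proof.
split=> // t; first exact: is_derive_cst.
rewrite /cst mulr0 oppr0 add0r powR_split// powR_equilibrium subrr.
exact: is_derive_cst.
Qed.

Section solution_bounds.
Variables (v w : R -> R).
Hypotheses (vw : solution v w) (vw0 : tends_to_0_from v w).

Lemma solution_energy_lt0 t : energy v w t < 0.
Proof.
have [dv dw v0] := vw.
by apply: (@energy_lt0 R nu a p a0 anu p1 v w (t + 1) vw0) => //; rewrite ltrDl.
Qed.

Lemma solution_energy_mono s t : s <= t -> energy v w t <= energy v w s.
Proof.
have [dv dw v0] := vw => st.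
by apply: (@energy_mono R nu a p a0 anu p1 v w (t + 1)) => //; rewrite ltrDl.
Qed.

Lemma solution_bounded : exists2 M, 0 < M & forall t, v t <= M /\ `|w t| <= M.
Proof.
have [dv dw v0] := vw.
(* The positive zero of [v^(p + 1) / (p + 1) - b v^2 / 2]: beyond it the energy would be
   positive. *)
pose N := (b * (p + 1) / 2) `^ (p - 1)^-1.
have bp0 : 0 < b * (p + 1) / 2 by rewrite divr_gt0// mulr_gt0//; hlra.
have N0 : 0 < N by exact: powR_gt0.
have pp : 0 < p + 1 by hlra.
have vN t : v t <= N.
  rewrite leNgt; apply/negP => Nv.
  have := solution_energy_lt0 t; rewrite /energy.
  have -> : v t `^ (p + 1) = v t `^ (p - 1) * v t ^+ 2.
    have -> : p + 1 = (p - 1) + 2 by ring.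
    rewrite powRD; last by rewrite [_ == _]gt_eqF//; hlra.
    by congr (_ * _); rewrite -powR_mulrn ?ltW.
  have : b * (p + 1) / 2 < v t `^ (p - 1).
    have -> : b * (p + 1) / 2 = N `^ (p - 1).
      by rewrite -powRrM mulVf ?lt0r_neq0// powRr1 ?ltW.
    by apply: gt0_ltr_powR; rewrite ?nnegrE ?ltW.
  rewrite -(ltr_pM2r (exprn_gt0 2 (v0 t))) => h.
  have := sqr_ge0 (w t).
  have : b * (p + 1) / 2 * v t ^+ 2 / (p + 1) < v t `^ (p - 1) * v t ^+ 2 / (p + 1).
    by rewrite ltr_pM2r ?invr_gt0.
  have -> : b * (p + 1) / 2 * v t ^+ 2 / (p + 1) = b * v t ^+ 2 / 2.
    by field; exact: lt0r_neq0.
  lra.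
pose M := N + b * N ^+ 2 + 1.
have N2 : 0 <= b * N ^+ 2 by rewrite mulr_ge0 ?sqr_ge0 ?ltW.
have M0 : 0 < M by rewrite /M; lra.
exists M => // t; split; first by apply: le_trans (vN t) _; rewrite /M; lra.
have E := solution_energy_lt0 t; rewrite /energy in E.
have vp : 0 <= v t `^ (p + 1) / (p + 1) by rewrite divr_ge0 ?powR_ge0// ltW.
have vN2 : b * v t ^+ 2 <= b * N ^+ 2.
  by rewrite ler_pM2l// ler_sqr ?nnegrE ?(ltW N0) ?(ltW (v0 t)).
have w2 : w t ^+ 2 <= M ^+ 2.
  by apply: (@le_trans _ _ (b * N ^+ 2)); [lra|rewrite /M; nra].
by rewrite -(ger0_norm (ltW M0)) -ler_sqr ?nnegrE// ?normr_ge0// !real_normK ?num_real.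
Qed.

(** Barbalat's lemma, applied to the convergent energy, gives [w -> 0], and applied to [w] gives
    [w' -> 0]; the equation then leaves [v (v^(p - 1) - b) -> 0]. The limit 0 is excluded because
    for [t >= 0] the energy is at most its negative value at 0, which keeps [v] above some
    [m > 0]. *)
Lemma solution_cvgy : v x @[x --> +oo] --> C.
Proof.
have [dv dw v0] := vw.
have [M M0 vwM] := solution_bounded.
have [l El lE] : exists2 l, energy v w x @[x --> +oo] --> l & forall t, l <= energy v w t.
  apply: (@nonincreasing_cvgy R _ (- (b * M ^+ 2 / 2))) => [s t|t].
    exact: solution_energy_mono.
  apply: (le_trans _ (energy_lower a0 anu p1 w (v0 t))).
  rewrite lerN2 ler_pM2r// ler_pM2l// ler_sqr ?nnegrE ?(ltW M0) ?(ltW (v0 t))// (vwM t).1//.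
have dE : has_derive (energy v w) (fun t => - (2 * a * w t ^+ 2)).
  by move=> t; apply: is_derive_energy.
pose w' t := - (2 * a * w t) + b * v t - v t `^ p.
pose M' := 2 * a * M + b * M + M `^ p.
have w'M t : `|w' t| <= M'.
  have [vM wM] := vwM t.
  apply: (le_trans (ler_normB _ _)); apply: lerD; last first.
    by rewrite ger0_norm ?powR_ge0//; apply: powR_mono => //; hlra.
  apply: (le_trans (ler_normD _ _)); apply: lerD.
    by rewrite normrN normrM ger0_norm ?ler_wpM2l// ?mulr_ge0//; hlra.
  by rewrite normrM (ger0_norm (ltW b0)) (ger0_norm (ltW (v0 t))) ler_wpM2l// ltW.
have M'0 : 0 <= M' by apply: le_trans (w'M 0).
have w20 : - (2 * a * w x ^+ 2) @[x --> +oo] --> (0 : R).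
  have dw2 : has_derive (fun t => - (2 * a * w t ^+ 2)) (fun t => - (2 * a * (2 * w t * w' t))).
    move=> t; have dwt := is_derive_sqr (dw t).
    by apply: is_derive_eq; rewrite /GRing.scale/=.
  have gK t : 0 <= t -> `|- (2 * a * (2 * w t * w' t))| <= 2 * a * (2 * M * M').
    rewrite normrN normrM ger0_norm => [_|]; last by rewrite mulr_ge0//; hlra.
    rewrite ler_wpM2l ?mulr_ge0//; first by hlra.
    rewrite normrM ler_pM// normrM ger0_norm// ler_wpM2l//; exact: (vwM t).2.
  exact: (barbalat dE dw2 gK El).
have w0 : w x @[x --> +oo] --> (0 : R).
  apply/cvgy_dist => e e0; have [|S h] := (cvgy_dist _ _).1 w20 (2 * a * e ^+ 2).
    by rewrite mulr_gt0 ?exprn_gt0//; hlra.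
  exists S => t /h; rewrite !subr0 normrN ger0_norm; last first.
    by rewrite mulr_ge0 ?sqr_ge0//; hlra.
  rewrite ltr_pM2l; last by hlra.
  by rewrite -real_normK ?num_real// ltr_sqr ?nnegrE// ltW.
have w'0 : w' x @[x --> +oo] --> (0 : R).
  have dw' : has_derive w' (fun t => - (2 * a * w' t) + b * w t - p * v t `^ (p - 1) * w t).
    move=> t; have dvp := is_derive_powRf p (v0 t) (dv t); have := dv t; have := dw t => ? ?.
    by rewrite /w'; apply: is_derive_eq; rewrite /GRing.scale/=.
  have gK t : 0 <= t -> `|- (2 * a * w' t) + b * w t - p * v t `^ (p - 1) * w t| <=
      2 * a * M' + b * M + p * M `^ (p - 1) * M.
    move=> _; have [vM wM] := vwM t.
    apply: (le_trans (ler_normB _ _)); apply: lerD.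
      apply: (le_trans (ler_normD _ _)); apply: lerD.
        rewrite normrN normrM ger0_norm; first by rewrite ler_wpM2l ?w'M ?mulr_ge0//; hlra.
        by rewrite mulr_ge0//; hlra.
      by rewrite normrM (ger0_norm (ltW b0)) ler_wpM2l// ltW.
    rewrite normrM ler_pM// normrM ger0_norm; last by hlra.
    rewrite ler_wpM2l//; first by hlra.
    rewrite ger0_norm ?powR_ge0//.
    exact: powR_mono.
  exact: (barbalat dw dw' gK w0).
pose e0 := - energy v w 0.
have e00 : 0 < e0 by rewrite oppr_gt0 solution_energy_lt0.
pose m := Num.sqrt (2 * e0 / b).
have m0 : 0 < m by rewrite sqrtr_gt0 divr_gt0// mulr_gt0.
have vm t : 0 <= t -> m <= v t.
  move=> t0; rewrite -[leRHS](ger0_norm (ltW (v0 t))) -sqrtr_sqr ler_wsqrtr//.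
  rewrite ler_pdivrMr// mulrC.
  have := energy_lower a0 anu p1 w (v0 t); have := solution_energy_mono t0; rewrite /e0; lra.
have vp : v x `^ (p - 1) @[x --> +oo] --> b.
  apply/cvgy_dist => e e1.
  have [|S h1] := (cvgy_dist _ _).1 w'0 (e * m / 2); first by rewrite divr_gt0// mulr_gt0.
  have [|S' h2] := (cvgy_dist _ _).1 w0 (e * m / (4 * a)).
    by rewrite divr_gt0 ?mulr_gt0//; hlra.
  exists (Num.max 0 (Num.max S S')) => t; rewrite !ge_max => /and3P[t0 /h1 H1 /h2 H2].
  rewrite subr0 in H1; rewrite subr0 in H2.
  have mv := vm t t0.
  rewrite -(ltr_pM2r m0); apply: (@le_lt_trans _ _ (`|v t `^ (p - 1) - b| * v t)).
    by rewrite ler_wpM2l.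
  rewrite -[X in _ * X < _](ger0_norm (ltW (v0 t))) -normrM mulrBl -powR_split//.
  have -> : v t `^ p - b * v t = - w' t - 2 * a * w t by rewrite /w'; ring.
  apply: (le_lt_trans (ler_normB _ _)); rewrite normrN normrM ger0_norm; last by hlra.
  have : 2 * a * `|w t| < 2 * a * (e * m / (4 * a)) by rewrite ltr_pM2l//; hlra.
  have -> : 2 * a * (e * m / (4 * a)) = e * m / 2 by field; exact: lt0r_neq0.
  by move: H1; lra.
have -> : v = fun x => (v x `^ (p - 1)) `^ (p - 1)^-1.
  by apply/funext => x; rewrite -powRrM divff ?lt0r_neq0// powRr1 ?ltW.
have cb : {for b, continuous (fun y => y `^ (p - 1)^-1)}.
  exact/is_derive_continuous/is_derive1_powR.
exact: (@cvg_comp _ _ _ (fun x => v x `^ (p - 1)) (fun y => y `^ (p - 1)^-1) _ _ _ vp cb).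
Qed.

End solution_bounds.

Section comparison.
Variables (v1 w1 v2 w2 : R -> R).
Hypotheses (sol1 : solution v1 w1) (sol2 : solution v2 w2).

Definition gap t : R := expR (a * t) * (v2 t - v1 t).
Definition gap' t : R := expR (a * t) * (a * (v2 t - v1 t) + (w2 t - w1 t)).
Definition gap'' t : R := nu ^+ 2 * gap t - expR (a * t) * (v2 t `^ p - v1 t `^ p).

Lemma is_derive_gap : has_derive gap gap'.
Proof.
have [dv1 dw1 _] := sol1; have [dv2 dw2 _] := sol2.
move=> t; have ? := dv1 t; have ? := dv2 t.
by apply: is_derive_eq; rewrite /GRing.scale/= /gap'; ring.
Qed.

Lemma is_derive_gap' : has_derive gap' gap''.
Proof.
have [dv1 dw1 _] := sol1; have [dv2 dw2 _] := sol2.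
move=> t; have ? := dv1 t; have ? := dv2 t; have ? := dw1 t; have ? := dw2 t.
by apply: is_derive_eq; rewrite /GRing.scale/= /gap'' /gap; ring.
Qed.

Lemma gap_gt0 t : (0 < gap t) = (v1 t < v2 t).
Proof. by rewrite pmulr_rgt0 ?expR_gt0// subr_gt0. Qed.

(* As long as it is positive, the gap is convex: it is [e^(a t)] times a
   difference, and its linearization has potential [nu^2 - p v2^(p-1) >= 0]. *)
Lemma gap_nondecreasing : p * b <= nu ^+ 2 -> (forall t, v2 t <= C) ->
  gap x @[x --> -oo] --> (0 : R) -> (exists T, forall t, t <= T -> 0 < gap t) ->
  (forall t, 0 < gap t) /\ forall s t, s <= t -> gap s <= gap t.
Proof.
move=> stab v2C gap0 [T gapT].
have [_ _ v10] := sol1; have [_ _ v20] := sol2.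
have gap''0 t : 0 < gap t -> 0 <= gap'' t.
  move=> gt; rewrite /gap'' /gap.
  have v12 : v1 t < v2 t by rewrite -gap_gt0.
  have tang := powR_tangent p1 (ltW (v10 t)) (ltW (v20 t)).
  have v2p : v2 t `^ (p - 1) <= b by rewrite -powR_equilibrium; apply: powR_mono.
  rewrite mulrCA -mulrBr mulr_ge0 ?expR_ge0// subr_ge0.
  apply: (@le_trans _ _ (p * v2 t `^ (p - 1) * (v2 t - v1 t))); first by lra.
  rewrite ler_pM2r ?subr_gt0//; apply: le_trans stab; rewrite ler_pM2l//; hlra.
have gap'0 t0 : (forall t, t < t0 -> 0 < gap t) -> forall t, t < t0 -> 0 <= gap' t.
  move=> pos t tt0; rewrite leNgt; apply/negP => neg.
  (* Convexity would keep the derivative of the gap below the negative number [gap' t] on the whole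
     left side, which contradicts the existence of points where it is small. *)
  have [|s st sg] := cvgNy_derive_small is_derive_gap gap0 (e := - gap' t) t.
    by rewrite oppr_gt0.
  have : gap' s <= gap' t.
    apply: (ge0_has_derive_le is_derive_gap' st) => u /andP[su ut].
    by apply/gap''0/pos; lra.
  by move: sg; rewrite ltr_norml => /andP[]; lra.
have mono t0 : (forall t, t < t0 -> 0 < gap t) -> forall s t, s <= t -> t <= t0 -> gap s <= gap t.
  move=> pos s t st tt0.
  apply: (ge0_has_derive_le is_derive_gap st) => u /andP[su ut].
  by apply: (gap'0 t0) => //; lra.
have pos t1 : 0 < gap t1.
  rewrite ltNge; apply/negP => z1.
  have [t0 zt0 zpos] := first_nonpos (has_derive_continuous is_derive_gap) gapT z1.
  pose s := Num.min T t0.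
  have := mono t0 zpos s t0; rewrite ge_min lexx orbT => /(_ isT isT).
  by have := gapT s; rewrite ge_min lexx => /(_ isT); lra.
split=> // s t st; apply: (mono (t + 1)) => //; lra.
Qed.

(* Where the gap is nonnegative and the potential exceeds [nu^2], the gap is
   concave, with second derivative at most [- delta gap]. *)
Lemma gap_eventually_zero T : nu ^+ 2 < p * b -> v1 x @[x --> +oo] --> C ->
  (forall t, T <= t -> v1 t <= v2 t) ->
  exists T', forall t, T' <= t -> v1 t = v2 t.
Proof.
move=> unst v1C v12.
have [_ _ v10] := sol1; have [_ _ v20] := sol2.
pose delta := (p * b - nu ^+ 2) / 2.
have delta0 : 0 < delta by rewrite divr_gt0// subr_gt0.
have v1p : p * v1 x `^ (p - 1) @[x --> +oo] --> p * b.
  apply: cvgMr; rewrite -powR_equilibrium.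
  have cb : {for C, continuous (fun y => y `^ (p - 1))}.
    exact/is_derive_continuous/is_derive1_powR.
  exact: (@cvg_comp _ _ _ v1 (fun y => y `^ (p - 1)) _ _ _ v1C cb).
have [S hS] := (cvgy_dist _ _).1 v1p delta delta0.
pose T' := Num.max S T.
have gap_ge0 t : T' <= t -> 0 <= gap t.
  by rewrite ge_max => /andP[_ /v12 h]; rewrite mulr_ge0 ?expR_ge0// subr_ge0.
have gap''le t : T' <= t -> gap'' t <= - (delta * gap t).
  move=> Tt; move: (Tt); rewrite ge_max => /andP[/hS h /v12 h'].
  (* The tangent is taken at the smaller solution [v1], so only the convergence of [v1] to [C] is
     required. *)
  have tang := powR_tangent p1 (ltW (v20 t)) (ltW (v10 t)).
  have -> : gap'' t = expR (a * t) * (nu ^+ 2 * (v2 t - v1 t) - (v2 t `^ p - v1 t `^ p)).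
    by rewrite /gap'' /gap; ring.
  have -> : - (delta * gap t) = expR (a * t) * (- delta * (v2 t - v1 t)).
    by rewrite /gap; ring.
  rewrite ler_pM2l ?expR_gt0//.
  move: h; rewrite ltr_norml => /andP[h _].
  have h2 : nu ^+ 2 + delta <= p * v1 t `^ (p - 1) by move: h; rewrite /delta; lra.
  have := ler_wpM2r (_ : 0 <= v2 t - v1 t) h2; rewrite subr_ge0 => /(_ h'); lra.
have gap''le0 t : T' <= t -> gap'' t <= 0.
  move=> Tt; apply: (le_trans (gap''le t Tt)).
  by rewrite oppr_le0 mulr_ge0 ?gap_ge0// ltW.
have gap'dec s t : T' <= s -> s <= t -> gap' t <= gap' s.
  move=> Ts st; apply: (le0_has_derive_le is_derive_gap' st) => u /andP[su _].
  by apply: gap''le0; lra.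
have gap'0 s : T' <= s -> 0 <= gap' s.
  move=> Ts; rewrite leNgt; apply/negP => neg.
  (* The tangent at [s] reaches zero after time [gap s / - gap' s]; one more unit makes the concave
     gap strictly negative. *)
  pose h := gap s / - gap' s + 1.
  have ng : 0 < - gap' s by rewrite oppr_gt0.
  have h0 : 0 < h by rewrite ltr_wpDl// divr_ge0 ?gap_ge0// ltW.
  have [|u /andP[su _] E] := @MVT_has_derive R gap gap' s (s + h) is_derive_gap; first lra.
  have : gap' u * (s + h - s) <= gap' s * (s + h - s).
    by rewrite ler_pM2r; [apply: gap'dec => //; lra|lra].
  rewrite -E; have := gap_ge0 (s + h) ltac:(lra).
  have -> : gap' s * (s + h - s) = - gap s + gap' s by rewrite /h; field; rewrite lt_eqF.
  lra.
exists T' => s Ts; apply/eqP/negPn/negP => ne.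
have gs : 0 < gap s.
  by rewrite gap_gt0 lt_neqAle ne v12// (le_trans _ Ts)// le_max lexx orbT.
have gmono t : s <= t -> gap s <= gap t.
  move=> st; apply: (ge0_has_derive_le is_derive_gap st) => u /andP[su _].
  by apply: gap'0; lra.
(* The gap now being nondecreasing, its second derivative is at most [- delta gap s] after [s];
   within time [h] this would push the nonnegative [gap'] strictly below zero. *)
pose h := gap' s / (delta * gap s) + 1.
have dg : 0 < delta * gap s by exact: mulr_gt0.
have h0 : 0 < h by rewrite ltr_wpDl// divr_ge0 ?gap'0// ltW.
have [|u /andP[su _] E] := @MVT_has_derive R gap' gap'' s (s + h) is_derive_gap'; first lra.
have : gap'' u * (s + h - s) <= - (delta * gap s) * (s + h - s).
  rewrite ler_pM2r; last lra.
  apply: (le_trans (gap''le u ltac:(lra))); rewrite lerN2 ler_pM2l// gmono//; lra.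
rewrite -E; have := gap'0 (s + h) ltac:(lra).
have -> : - (delta * gap s) * (s + h - s) = - gap' s - delta * gap s.
  by rewrite /h; field; rewrite ?lt0r_neq0.
lra.
Qed.

(* Gronwall's argument for the squared distance in the phase plane. *)
Lemma solution_backward_unique T M : (forall t, v1 t <= M) -> (forall t, v2 t <= M) ->
  (forall t, T <= t -> v1 t = v2 t) -> forall t, v1 t = v2 t.
Proof.
move=> v1M v2M v12.
have [dv1 dw1 v10] := sol1; have [dv2 dw2 v20] := sol2.
have M0 : 0 < M by apply: lt_le_trans (v10 0) (v1M 0).
pose y t := (v2 t - v1 t) ^+ 2 + (w2 t - w1 t) ^+ 2.
pose L := p * M `^ (p - 1).
have L0 : 0 <= L by rewrite mulr_ge0 ?powR_ge0//; hlra.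
(* Large enough for [y' >= - K y]. Then [e^(K t) y] is nondecreasing and nonnegative, so its zero at
   [T + 1] propagates to the left. *)
pose K := 1 + b + L + 4 * a.
pose y' t := 2 * (v2 t - v1 t) * (w2 t - w1 t) + 2 * (w2 t - w1 t) *
   (- (2 * a * (w2 t - w1 t)) + b * (v2 t - v1 t) - (v2 t `^ p - v1 t `^ p)).
have dy : has_derive y y'.
  move=> t; have ? := dv1 t; have ? := dv2 t; have ? := dw1 t; have ? := dw2 t.
  have dv : is_derive t 1 (fun t => v2 t - v1 t) (w2 t - w1 t) by apply: is_derive_eq.
  have dw : is_derive t 1 (fun t => w2 t - w1 t) (- (2 * a * (w2 t - w1 t)) + b * (v2 t - v1 t) - (v2 t `^ p - v1 t `^ p)).
    by apply: is_derive_eq; ring.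
  have dv2' := is_derive_sqr dv; have dw2' := is_derive_sqr dw.
  by apply: is_derive_add.
have y'K t : 0 <= y' t + K * y t.
  have h1 : 0 <= v1 t <= M by rewrite v1M ltW.
  have h2 : 0 <= v2 t <= M by rewrite v2M ltW.
  have := powR_lipschitz p1 h2 h1; rewrite -/L /y' /y /K.
  move: (v2 t `^ p - v1 t `^ p) (v2 t - v1 t) (w2 t - w1 t) => D u x DL.
  have : `|x * D| <= L * (u ^+ 2 + x ^+ 2) / 2.
    rewrite normrM; apply: (@le_trans _ _ (`|x| * (L * `|u|))); first by rewrite ler_wpM2l.
    rewrite -[u ^+ 2]real_normK ?num_real// -[x ^+ 2]real_normK ?num_real//.
    have := sqr_ge0 (`|x| - `|u|); nra.
  rewrite ler_norml => /andP[_ xD].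
  have s1 := sqr_ge0 (u + x); have s2 := sqr_ge0 (u - x).
  have := mulr_ge0 (ltW b0) s1; have := mulr_ge0 (ltW a0) (sqr_ge0 u).
  have := b0; move: (b) => bb; nra.
have y0 t : 0 <= y t by rewrite addr_ge0 ?sqr_ge0.
(* At [T + 1] rather than [T]: equality of the derivatives requires [v1 = v2] on a two-sided
   neighbourhood. *)
have yT : y (T + 1) = 0.
  have vv : v2 (T + 1) - v1 (T + 1) = 0 by rewrite v12 ?subrr//; lra.
  have ww : w2 (T + 1) = w1 (T + 1).
    have d1 : 'D_1 v1 (T + 1) = w1 (T + 1) by apply: derive_val.
    have d2 : 'D_1 v1 (T + 1) = w2 (T + 1).
      apply: (@derive_val _ _ _ _ _ _ _ _).
      apply: (@near_eq_is_derive _ _ _ v2) => //.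
      near=> t; rewrite v12//; near: t.
      by apply: (cvgr_ge (T + 1)) => //; lra.
    by rewrite -d1 -d2.
  by rewrite /y vv ww subrr expr2 mulr0 addr0.
have yz t : t <= T + 1 -> y t = 0.
  move=> tT; apply/eqP; rewrite eq_le y0 andbT.
  have : expR (K * t) * y t <= expR (K * (T + 1)) * y (T + 1).
    have dKy : has_derive (fun t => expR (K * t) * y t) (fun t => expR (K * t) * (y' t + K * y t)).
      by move=> u; have := dy u => ?; apply: is_derive_eq; rewrite /GRing.scale/=; ring.
    by apply: (ge0_has_derive_le dKy tT) => u _; rewrite mulr_ge0 ?expR_ge0.
  by rewrite yT mulr0 pmulr_rle0// expR_gt0.
move=> t; have [/ltW tT|] := ltP t (T + 1); last by move=> h; apply: v12; lra.
have := yz _ tT; rewrite /y => /eqP.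
rewrite paddr_eq0 ?sqr_ge0// => /andP[]; rewrite sqrf_eq0 subr_eq0 => /eqP-> //.
Unshelve. all: by end_near. Qed.

End comparison.

End asymptotics.

(** * Radial solutions *)

Section logarithmic_variable.
Context {R : realType}.
Implicit Types (U z B : R -> R) (x r t lam : R).

Lemma expR_cvgNy_at_right : expR t @[t --> -oo] --> (0 : R)^'+.
Proof.
move=> A [e /= e0 eA]; exists (ln e); split; first exact: num_real.
move=> t te; apply: eA; last exact: expR_gt0.
by rewrite /= sub0r normrN ger0_norm ?expR_ge0// -[ltRHS](lnK e0) ltr_expR.
Qed.

Lemma ln_cvgy : ln r @[r --> +oo] --> (+oo : set_system R).
Proof.
move=> A [M [_ MA]]; exists (expR M); split; first exact: num_real.
move=> r Mr; apply: MA; rewrite -ltr_expR lnK// posrE.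
exact: lt_trans (expR_gt0 _) Mr.
Qed.

Lemma powR_subr1 x r : 0 < r -> r `^ x = r `^ (x - 1) * r.
Proof.
move=> r0; have rn := lt0r_neq0 r0.
by rewrite powRB ?rn ?implybT// powRr1 ?ltW// divfK.
Qed.

Lemma norm_lt_squeeze (x y g h e : R) : `|y| < e / 2 -> x <= y -> y + g <= x + h ->
  0 <= g -> `|h| < e / 2 -> `|x| < e.
Proof.
rewrite !ltr_norml => /andP[? ?] ? ? ? /andP[? ?].
by apply/andP; split; lra.
Qed.

Section equation.
Variables (N : nat) (nu p : R).
Hypotheses (N3 : (3 <= N)%N) (nu0 : 0 < nu) (pS : p_S N < p) (pT : (p%:E < p_star N nu)%E).
Local Notation ns := (nu_star N : R).
Local Notation m := (2 / (p - 1)).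
Local Notation a := (ns - m).

Let Nge3 : (3 : R) <= N%:R. Proof. by rewrite ler_nat. Qed.

Lemma exponent_gt1 : 1 < p.
Proof.
have ? := Nge3; apply: lt_trans pS; rewrite /p_S ltr_pdivlMr; lra.
Qed.
Local Notation p1 := exponent_gt1.

Lemma damping_gt0 : 0 < a.
Proof.
have N3' := Nge3; have pS' := pS; have p1' := p1; rewrite subr_gt0 /nu_star ltr_pdivrMr; last by lra.
move: pS'; rewrite /p_S ltr_pdivrMr; last by lra.
lra.
Qed.

Lemma damping_lt : a < nu.
Proof.
have p1' := p1; have N3' := Nge3; have m0 : 0 < m by rewrite divr_gt0//; lra.
move: pT; rewrite /p_star; case: ifPn => [nulow|]; last by rewrite -leNgt; lra.
rewrite lte_fin => pT'.
have d0 : 0 < ns - nu by rewrite subr_gt0.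
have : p - 1 < 2 / (ns - nu) by lra.
rewrite ltr_pdivlMr// mulrC -ltr_pdivlMr; last by lra.
lra.
Qed.
Local Notation a0 := damping_gt0.
Local Notation anu := damping_lt.

(** The quotient [U r / r^(nu - nu_star)] at [r = e^t], which has limit [lam] at -oo, and
    [e^(2 nu t)] times its derivative, that is, the unknown [B] of the first-order system. *)
Definition log_profile U t : R := expR ((ns - nu) * t) * U (expR t).
Definition log_flux U t : R := expR (2 * nu * t) *
  (expR ((ns - nu) * t) * ((ns - nu) * U (expR t) + expR t * (U^`())%classic (expR t))).

Lemma emden_vE U t : emden_v nu a (log_profile U) t = expR (m * t) * U (expR t).
Proof. by rewrite /emden_v /log_profile mulrA -expRD; congr (expR _ * _); ring. Qed.

Lemma positive_solution_derive U : positive_solution N nu p U ->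
  forall r, 0 < r -> [/\ is_derive r 1 U ((U^`())%classic r),
   is_derive r 1 (U^`())%classic
    (- ((N%:R - 1) / r * (U^`())%classic r) + (nu ^+ 2 - ns ^+ 2) / r ^+ 2 * U r - U r `^ p) & 0 < U r].
Proof.
move=> [C2 U0 ode] r r0; have [d1 d2 _] := C2 r r0; split; last exact: U0.
  by rewrite derive1E; exact: derivableP.
have <- : (U^`(2))%classic r = - ((N%:R - 1) / r * (U^`())%classic r) +
     (nu ^+ 2 - ns ^+ 2) / r ^+ 2 * U r - U r `^ p.
  by have := ode r r0; lra.
by rewrite derive1nS derive1n1 derive1E; exact: derivableP.
Qed.

(** The delicate clause is the limit of the flux. Far to the left there are points [s] where the
    derivative of the profile is small, and so is the flux, [e^(2 nu s)] being at most 1. Between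
    such an [s] and [t] the flux is nonincreasing, while its sum with [K / c e^(c t)] is
    nondecreasing; so the flux at [t] is small as well. *)
Lemma positive_solution_profile U lam : positive_solution N nu p U ->
  U r / r `^ (- ns + nu) @[r --> 0^'+] --> lam ->
  profile nu a p lam (log_profile U) (log_flux U).
Proof.
move=> /positive_solution_derive Up Ulam.
have c0 : 0 < 2 * nu + (p - 1) * (nu - a).
  by rewrite addr_gt0 ?mulr_gt0 ?subr_gt0 ?anu ?p1.
have z0 t : 0 < log_profile U t.
  by have [_ _ ?] := Up _ (expR_gt0 t); rewrite mulr_gt0 ?expR_gt0.
have dz : has_derive (log_profile U) (fun t => expR (- (2 * nu * t)) * log_flux U t).
  move=> t; have [dU _ _] := Up _ (expR_gt0 t).
  have dUe : is_derive t 1 (fun t => U (expR t)) ((U^`())%classic (expR t) * expR t).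
    exact: (@is_derive1_comp _ U expR).
  apply: is_derive_eq; rewrite /GRing.scale/= /log_flux mulrA -expRD addNr expR0.
  by ring.
have dB : has_derive (log_flux U)
    (fun t => - (expR ((2 * nu + (p - 1) * (nu - a)) * t) * log_profile U t `^ p)).
  move=> t; have [dU dU1 U0] := Up _ (expR_gt0 t).
  have dUe : is_derive t 1 (fun t => U (expR t)) ((U^`())%classic (expR t) * expR t).
    exact: (@is_derive1_comp _ U expR).
  have dU1e := @is_derive1_comp _ (U^`())%classic expR t _ _ dU1 (is_derive_expR t).
  have {}dU1e : is_derive t 1 (fun t => (U^`())%classic (expR t))
    ((- ((N%:R - 1) / expR t * (U^`())%classic (expR t)) +
     (nu ^+ 2 - ns ^+ 2) / expR t ^+ 2 * U (expR t) - U (expR t) `^ p) * expR t) := dU1e.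
  apply: is_derive_eq; rewrite /GRing.scale/= /log_profile powRM ?expR_ge0 ?(ltW U0)//.
  rewrite -expRM.
  have -> : expR ((2 * nu + (p - 1) * (nu - a)) * t) * (expR ((ns - nu) * t * p) * U (expR t) `^ p) =
     expR (2 * nu * t) * expR ((ns - nu) * t) * expR t ^+ 2 * U (expR t) `^ p.
    rewrite mulrA -!expRD expr2 -!expRD; congr (expR _ * _); field; rewrite subr_eq0 gt_eqF//.
    exact: p1.
  have -> : N%:R = 2 * ns + 2 by rewrite /nu_star; field.
  by field; rewrite gt_eqF ?expR_gt0.
have zlam : log_profile U t @[t --> -oo] --> lam.
  have h := @cvg_comp _ _ _ expR (fun r => U r / r `^ (- ns + nu)) _ _ _ expR_cvgNy_at_right Ulam.
  apply: cvg_trans h; apply: near_eq_cvg; near=> t.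
  by rewrite /= /log_profile -expRM mulrC -expRN; congr (expR _ * _); ring.
split=> //; split => //; apply/cvgNy_dist => e e0.
pose c := 2 * nu + (p - 1) * (nu - a).
have [T hT] := (cvgNy_dist _ _).1 zlam 1 ltr01.
pose Z := `|lam| + 1; pose K := Z `^ p.
have K0 : 0 <= K by exact: powR_ge0.
have zK t : t <= T -> log_profile U t `^ p <= K.
  move=> /hT h; apply: powR_mono => //; first by apply: lt_trans p1.
  rewrite /Z; move: h; rewrite ltr_norml => /andP[_ h].
  by have := ler_norm lam; lra.
have g0 : K / c * expR (c * t) @[t --> -oo] --> (0 : R).
  by rewrite -(mulr0 (K / c)); apply: cvgMr; exact: cvgNy_expR.
have [|T1 hT1] := (cvgNy_dist _ _).1 g0 (e / 2); first by rewrite divr_gt0.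
exists (Num.min 0 (Num.min T T1)) => t; rewrite !le_min => /and3P[t0 tT tT1].
have [|s st zs] := cvgNy_derive_small dz zlam (e := e / 2) t; first by rewrite divr_gt0.
have Bs : `|log_flux U s| < e / 2.
  apply: le_lt_trans zs; rewrite [leRHS]normrM (ger0_norm (expR_ge0 _)) ler_peMl//.
  rewrite -[1]expR0 ler_expR oppr_ge0 mulr_ge0_le0 ?(le_trans st t0)//.
  by rewrite mulr_ge0// ltW.
have h1 : log_flux U t <= log_flux U s.
  apply: (le0_has_derive_le dB st) => u _.
  by rewrite oppr_le0 mulr_ge0 ?expR_ge0 ?powR_ge0.
have h2 : log_flux U s + K / c * expR (c * s) <= log_flux U t + K / c * expR (c * t).
  have dg : has_derive (fun t => log_flux U t + K / c * expR (c * t))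
     (fun t => - (expR (c * t) * log_profile U t `^ p) + K * expR (c * t)).
    move=> u; have := dB u => ?; apply: is_derive_eq; rewrite /GRing.scale/=.
    by congr (_ + _); field; exact: lt0r_neq0.
  apply: (ge0_has_derive_le dg st) => u /andP[su ut].
  rewrite addrC subr_ge0 mulrC ler_wpM2r ?expR_ge0// zK//; lra.
have h3 := hT1 t tT1.
have h4 : 0 <= K / c * expR (c * s) by rewrite mulr_ge0 ?expR_ge0// divr_ge0// ltW.
move: h3; rewrite !subr0 => h3.
apply: (@norm_lt_squeeze _ _ _ _ e Bs h1 h2 h4 h3).
Unshelve. all: by end_near. Qed.

Definition radial_profile z r : R := r `^ (nu - ns) * z (ln r).

Lemma radial_profile_cvg0 z lam : z t @[t --> -oo] --> lam ->
  radial_profile z r / r `^ (- ns + nu) @[r --> 0^'+] --> lam.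
Proof.
move=> zlam; have h := @cvg_comp _ _ _ (@ln R) z _ _ _ (@lnNy R) zlam.
apply: cvg_trans h; apply: near_eq_cvg; near=> r.
have r0 : 0 < r by near: r; exact: nbhs_right_gt.
by rewrite /= /radial_profile [- ns + nu]addrC mulrAC divff ?mul1r// gt_eqF// powR_gt0.
Unshelve. all: by end_near. Qed.

Lemma radial_profile_cvgy z (l : R) : emden_v nu a z t @[t --> +oo] --> l ->
  radial_profile z r / r `^ (- m) @[r --> +oo] --> l.
Proof.
move=> zl; have h := @cvg_comp _ _ _ (@ln R) (emden_v nu a z) _ _ _ ln_cvgy zl.
apply: cvg_trans h; apply: near_eq_cvg; near=> r.
have r0 : 0 < r by near: r; apply: nbhs_pinfty_gt; exact: num_real.
rewrite /= /radial_profile /emden_v mulrAC; congr (_ * _).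
rewrite -powRN opprK -powRD; last by rewrite (gt_eqF r0) implybT.
by rewrite /powR gt_eqF//; congr expR; ring.
Unshelve. all: by end_near. Qed.

Lemma radial_profile_solution lam z B : profile nu a p lam z B ->
  positive_solution N nu p (radial_profile z).
Proof.
move=> [[dz dB zl Bl] z0].
set U := radial_profile z.
pose q t := expR (- (2 * nu * t)) * B t.
pose U1 r := r `^ (nu - ns - 1) * ((nu - ns) * z (ln r) + q (ln r)).
have U0 r : 0 < r -> 0 < U r by move=> r0; rewrite mulr_gt0 ?powR_gt0.
pose U2 r := - ((N%:R - 1) / r * U1 r) + (nu ^+ 2 - ns ^+ 2) / r ^+ 2 * U r - U r `^ p.
have dq t : is_derive t 1 q (- (2 * nu) * q t - expR ((p - 1) * (nu - a) * t) * z t `^ p).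
  have := dB t => ?; apply: is_derive_eq; rewrite /GRing.scale/= /q.
  have -> : expR ((2 * nu + (p - 1) * (nu - a)) * t) =
     expR (2 * nu * t) * expR ((p - 1) * (nu - a) * t) by rewrite -expRD; congr expR; ring.
  rewrite expRN; field; rewrite gt_eqF ?expR_gt0//.
have dU r : 0 < r -> is_derive r 1 U (U1 r).
  move=> r0; have dzl := @is_derive1_comp _ z (@ln R) r _ _ (dz (ln r)) (is_derive1_ln r0).
  have dp := @is_derive1_powR _ (nu - ns) r r0.
  apply: is_derive_eq; rewrite /GRing.scale/= /U1 /q.
  have -> : r `^ (nu - ns) = r `^ (nu - ns - 1) * r.
    exact: powR_subr1.
  by field; rewrite gt_eqF.
have dU1 r : 0 < r -> is_derive r 1 U1 (U2 r).
  move=> r0; have dzl := @is_derive1_comp _ z (@ln R) r _ _ (dz (ln r)) (is_derive1_ln r0).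
  have dql := @is_derive1_comp _ q (@ln R) r _ _ (dq (ln r)) (is_derive1_ln r0).
  have dp := @is_derive1_powR _ (nu - ns - 1) r r0.
  have {}dzl : is_derive r 1 (fun r => z (ln r)) (q (ln r) * r^-1) := dzl.
  have {}dql : is_derive r 1 (fun r => q (ln r))
   ((- (2 * nu) * q (ln r) - expR ((p - 1) * (nu - a) * ln r) * z (ln r) `^ p) * r^-1) := dql.
  apply: is_derive_eq; rewrite /GRing.scale/= /U2 /U1 /U /radial_profile.
  have rn : r != 0 by rewrite gt_eqF.
  rewrite powRM ?powR_ge0 ?(ltW (z0 _))// -powRrM.
  have -> : r `^ (nu - ns) = r `^ (nu - ns - 1 - 1) * r ^+ 2.
    rewrite -powR_mulrn ?ltW// -powRD; last by rewrite rn implybT.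
    by congr (_ `^ _); ring.
  have -> : r `^ (nu - ns - 1) = r `^ (nu - ns - 1 - 1) * r.
    exact: powR_subr1.
  have -> : r `^ ((nu - ns) * p) = r `^ (nu - ns - 1 - 1) * expR ((p - 1) * (nu - a) * ln r).
    rewrite /powR (negbTE rn) -expRD; congr expR; field.
    by rewrite subr_eq0 gt_eqF// p1.
  have -> : N%:R = 2 * ns + 2 by rewrite /nu_star; field.
  by field.
have dE r : 0 < r -> (U^`())%classic r = U1 r.
  by move=> r0; have h := dU r r0; rewrite derive1E derive_val.
have near_dE r : 0 < r -> \forall s \near r, U1 s = (U^`())%classic s.
  by move=> r0; near=> s; rewrite dE//; near: s; exact: lt_nbhsr.
have dU' r : 0 < r -> is_derive r 1 (U^`())%classic (U2 r).
  by move=> r0; apply: (near_eq_is_derive (near_dE r r0)); exact: dU1.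
have dE2 r : 0 < r -> (U^`(2))%classic r = U2 r.
  by move=> r0; have h := dU' r r0; rewrite derive1nS derive1n1 derive1E derive_val.
split=> // r r0; last by rewrite dE2// dE// /U2; ring.
split; first by have h := dU r r0; exact: ex_derive.
  by have h := dU' r r0; exact: ex_derive.
(* [U2], the second derivative expressed through the equation, is itself differentiable; this yields
   the continuity demanded by C^2. *)
have dU2 : exists l, is_derive r 1 U2 l.
  have h1 := dU r r0; have h2 := dU1 r r0.
  have rn : r != 0 by rewrite gt_eqF.
  have rn2 : r ^+ 2 != 0 by rewrite expf_neq0.
  have h3 := is_derive_powRf p (U0 r r0) h1.
  have h4 := is_derive_inv rn (is_derive_idfun r).
  have h5 := is_derive_inv (f := fun r => r ^+ 2) rn2 (is_derive_sqr (is_derive_idfun r)).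
  have h6 := is_derive_mul (is_derive_mul (is_derive_const (N%:R - 1) r) h4) h2.
  have h7 := is_derive_mul (is_derive_mul (is_derive_const (nu ^+ 2 - ns ^+ 2) r) h5) h1.
  eexists; exact: (is_derive_add (is_derive_add (is_derive_opp h6) h7) (is_derive_opp h3)).
have [l /is_derive_continuous cU2] := dU2.
rewrite /prop_for/continuous_at dE2//.
apply: cvg_trans cU2; apply: near_eq_cvg; near=> s.
by rewrite dE2//; near: s; exact: lt_nbhsr.
Unshelve. all: by end_near. Qed.

End equation.
End logarithmic_variable.

(** * The family of solutions in the logarithmic variable *)

Section family.
Context {R : realType}.
Implicit Types (z B : R -> R) (r s t lam : R) (l : \bar R).
Variables (N : nat) (nu p : R).
Hypotheses (N3 : (3 <= N)%N) (nu0 : 0 < nu) (pS : p_S N < p) (pT : (p%:E < p_star N nu)%E).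
Local Notation ns := (nu_star N : R).
Local Notation m := (2 / (p - 1)).
Local Notation a := (ns - m).
Local Notation b := (nu ^+ 2 - a ^+ 2).
Local Notation C := (C_pnu N nu p).

Let p1 : 1 < p := exponent_gt1 N3 pS.
Let a0 : 0 < a := damping_gt0 N3 pS.
Let anu : a < nu := damping_lt N3 pS pT.
Let d0 : 0 < nu - a. Proof. by rewrite subr_gt0. Qed.

Lemma is_U_lambda_profile lam W : is_U_lambda N nu p lam W ->
  profile nu a p lam (log_profile N nu W) (log_flux N nu W).
Proof. by move=> [Wsol W0 _]; exact: positive_solution_profile. Qed.

Lemma log_profileK W r : 0 < r -> radial_profile N nu (log_profile N nu W) r = W r.
Proof.
move=> r0; rewrite /radial_profile /log_profile lnK ?posrE// mulrA.
rewrite /powR gt_eqF// -expRD -mulrDl addrC.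
have -> : ns - nu + (nu - ns) = 0 :> R by ring.
by rewrite mul0r expR0 mul1r.
Qed.

Lemma is_U_lambda_exists lam : 0 < lam -> exists W, is_U_lambda N nu p lam W.
Proof.
move=> lam0; have [z [B zB]] := profile_exists a0 anu p1 lam0.
exists (radial_profile N nu z); split.
- exact: radial_profile_solution zB.
- by apply: radial_profile_cvg0; case: zB => -[].
- apply: radial_profile_cvgy.
  apply: (solution_cvgy a0 anu p1 (profile_solution zB)).
  exact: profile_tends_to_0 zB.
Qed.

Lemma is_U_lambda_unique lam W V : 0 < lam -> is_U_lambda N nu p lam W ->
  is_U_lambda N nu p lam V -> forall r, 0 < r -> W r = V r.
Proof.
move=> lam0 /is_U_lambda_profile hW /is_U_lambda_profile hV r r0.
by rewrite -(log_profileK W r0) (profile_unique a0 anu p1 lam0 hW hV) log_profileK.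
Qed.

(** Translation of [v] by [s]: as [z = e^(- (nu - a) t) v], it multiplies [z (t + s)] by
    [e^((nu - a) s)]; the further factor for [B] comes from [B = e^(2 nu t) z']. *)
Lemma profile_shift lam z B s : profile nu a p lam z B ->
  profile nu a p (expR ((nu - a) * s) * lam) (fun t => expR ((nu - a) * s) * z (t + s))
    (fun t => expR ((nu - a) * s - 2 * nu * s) * B (t + s)).
Proof.
move=> [[dz dB zl Bl] z0]; split; last by move=> t; rewrite mulr_gt0 ?expR_gt0.
have shift (f : R -> R) (x : R) : f t @[t --> -oo] --> x -> f (t + s) @[t --> -oo] --> x.
  move=> /cvgNy_dist fx; apply/cvgNy_dist => e /fx[T hT]; exists (T - s) => t tT.
  by apply: hT; lra.
have dsh t : is_derive t 1 (fun t => t + s) 1.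
  by apply: is_derive_eq; rewrite addr0.
split.
- move=> t; have h := @is_derive1_comp _ z (fun t => t + s) t _ _ (dz (t + s)) (dsh t).
  have {}h : is_derive t 1 (fun t => z (t + s)) (expR (- (2 * nu * (t + s))) * B (t + s) * 1) := h.
  apply: is_derive_eq; rewrite /GRing.scale/= mulr1 !mulrA -!expRD.
  by congr (expR _ * _); ring.
- move=> t; have h := @is_derive1_comp _ B (fun t => t + s) t _ _ (dB (t + s)) (dsh t).
  have {}h : is_derive t 1 (fun t => B (t + s)) (- (expR ((2 * nu + (p - 1) * (nu - a)) * (t + s)) * z (t + s) `^ p) * 1) := h.
  apply: is_derive_eq; rewrite /GRing.scale/= mulr1 mulrN powRM ?expR_ge0 ?ltW//.
  by rewrite -expRM !mulrA -!expRD; congr (- (expR _ * _)); ring.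
- by apply: cvgMr; exact: shift.
- by rewrite -(mulr0 (expR ((nu - a) * s - 2 * nu * s))); apply: cvgMr; exact: shift.
Qed.

(** By uniqueness: translated by [ln kappa], the profile of [W1] acquires the limit
    [kappa^(nu - a) = lam], and [nu - a] is the exponent inverted in [kappa]. *)
Lemma is_U_lambda_scaling W1 W lam r : 0 < lam -> 0 < r ->
  is_U_lambda N nu p 1 W1 -> is_U_lambda N nu p lam W ->
  let kappa := lam `^ (m + nu - ns)^-1 in W r = kappa `^ m * W1 (kappa * r).
Proof.
move=> lam0 r0 /is_U_lambda_profile h1 /is_U_lambda_profile hW kappa.
have dE : m + nu - ns = nu - a by ring.
have k0 : 0 < kappa by rewrite powR_gt0.
pose s := ln kappa.
have lamE : expR ((nu - a) * s) * 1 = lam.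
  rewrite mulr1 /s /kappa dE ln_powR mulrA divff ?mul1r ?lnK//.
  exact: lt0r_neq0.
have := profile_shift s h1; rewrite lamE => h1'.
have E := profile_unique a0 anu p1 lam0 hW h1'.
rewrite -(log_profileK W r0) E /radial_profile /log_profile !expRD lnK ?posrE//.
rewrite /s lnK ?posrE// [r * _]mulrC !mulrA; congr (_ * _).
rewrite /powR !gt_eqF// -!expRD; congr expR; ring.
Qed.

Variable U : R -> R -> R.
Hypothesis HU : forall lam, 0 < lam -> is_U_lambda N nu p lam (U lam).
Local Notation Ue := (extend_family N nu p U).

Definition log_family l t : R := expR (m * t) * Ue l (expR t).

Lemma log_familyy : log_family +oo%E = cst C.
Proof.
apply/funext => t; rewrite /log_family /= /U_infty -expRM mulrCA -expRD.
have -> : m * t + t * - m = 0 :> R by ring.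
by rewrite expR0 mulr1.
Qed.

Lemma log_family_fin lam : log_family lam%:E = emden_v nu a (log_profile N nu (U lam)).
Proof. by apply/funext => t; rewrite emden_vE. Qed.

Lemma extend_familyE l r : 0 < r -> Ue l r = r `^ (- m) * log_family l (ln r).
Proof.
move=> r0; rewrite /log_family lnK ?posrE// mulrA /powR gt_eqF// -expRD -mulrDl.
by rewrite addNr mul0r expR0 mul1r.
Qed.

Let C0 : 0 < C.
Proof. by rewrite powR_gt0// subr_sqr mulr_gt0 ?subr_gt0// addr_gt0. Qed.

Lemma log_family_solution l : (0 < l)%E -> exists w, [/\ solution nu a p (log_family l) w,
  log_family l x @[x --> +oo] --> C & exists M, forall t, log_family l t <= M].
Proof.
case: l => [lam|_|//].
  rewrite lte_fin => lam0; rewrite log_family_fin.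
  have zB := is_U_lambda_profile (HU lam0).
  have sol := profile_solution zB.
  have t0 := profile_tends_to_0 a0 anu p1 lam0 zB.
  exists (emden_w nu a (log_profile N nu (U lam)) (log_flux N nu (U lam))); split => //.
    exact: (solution_cvgy a0 anu p1 sol t0).
  by have [M _ hM] := solution_bounded a0 anu p1 sol t0; exists M => t; case: (hM t).
rewrite log_familyy; exists (cst 0); split.
- exact: solution_equilibrium.
- exact: cvg_cst.
- by exists C.
Qed.

Lemma gap_emden_v (a' : R) z1 z2 t : gap a' (emden_v nu a' z1) (emden_v nu a' z2) t =
  expR (nu * t) * (z2 t - z1 t).
Proof.
rewrite /gap /emden_v.
have -> : expR (nu * t) = expR (a' * t) * expR ((nu - a') * t).
  by rewrite -expRD; congr expR; ring.
ring.
Qed.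

(** For finite parameters the gap is [e^(nu t) (z2 - z1)] with [z2 - z1] tending to [lam2 - lam1];
    for [l2 = +oo] it is [e^(a t) (C - v1)] with [v1] tending to 0. Either way its sign near -oo is
    known, which starts the ordering argument and also tells the solutions apart. *)
Lemma log_family_gap l1 l2 : (0 < l1)%E -> (l1 < l2)%E ->
  gap a (log_family l1) (log_family l2) t @[t --> -oo] --> (0 : R) /\
  exists T, forall t, t <= T -> 0 < gap a (log_family l1) (log_family l2) t.
Proof.
case: l1 => [lam1|_ |//]; last by rewrite ltNge leey.
rewrite lte_fin => lam10; case: l2 => [lam2||//]; last first.
  move=> _; rewrite log_familyy log_family_fin.
  have [v0 _ _] := profile_tends_to_0 a0 anu p1 lam10 (is_U_lambda_profile (HU lam10)).
  have Cv : C - emden_v nu a (log_profile N nu (U lam1)) t @[t --> -oo] --> C.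
    by rewrite -[X in _ --> X]subr0; apply: cvgB => //; exact: cvg_cst.
  split; first by rewrite -(mul0r C); apply: cvgM => //; exact: cvgNy_expR.
  have [T hT] := cvgNy_gt0_near Cv C0.
  by exists T => t /hT h; rewrite mulr_gt0 ?expR_gt0.
rewrite lte_fin => lam12; have lam20 := lt_trans lam10 lam12.
rewrite !log_family_fin.
have [[_ _ z1 _] _] := is_U_lambda_profile (HU lam10).
have [[_ _ z2 _] _] := is_U_lambda_profile (HU lam20).
have dz : log_profile N nu (U lam2) t - log_profile N nu (U lam1) t @[t --> -oo] --> lam2 - lam1.
  exact: cvgB.
have E t := gap_emden_v a (log_profile N nu (U lam1)) (log_profile N nu (U lam2)) t.
split.
  rewrite (funext E) -(mul0r (lam2 - lam1)); apply: cvgM => //; exact: cvgNy_expR.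
have [|T hT] := cvgNy_gt0_near dz; first by rewrite subr_gt0.
by exists T => t /hT h; rewrite E mulr_gt0 ?expR_gt0.
Qed.

Lemma C_powR : C `^ (p - 1) = b.
Proof. exact: powR_equilibrium. Qed.

Lemma gap_familyE l1 l2 r : 0 < r ->
  (Ue l2 r - Ue l1 r) / r `^ (- ns) = gap a (log_family l1) (log_family l2) (ln r).
Proof.
move=> r0; rewrite !extend_familyE// -mulrBr /gap mulrAC; congr (_ * _).
by rewrite -powRN opprK /powR gt_eqF// -expRD -mulrDl addrC.
Qed.

Lemma extend_family_lt l1 l2 r : 0 < r ->
  (Ue l1 r < Ue l2 r) = (log_family l1 (ln r) < log_family l2 (ln r)).
Proof. by move=> r0; rewrite !extend_familyE// ltr_pM2l// powR_gt0. Qed.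

(** The comparison with the equilibrium precedes all others: it supplies the bound [v2 <= C] under
    which the gap of two finite parameters is convex. *)
Lemma log_family_stable_le l t : p * C `^ (p - 1) <= nu ^+ 2 -> (0 < l)%E ->
  log_family l t <= C.
Proof.
rewrite C_powR => stab; case: l => [lam|_|//]; last by rewrite log_familyy.
move=> lam0; have [gap0 gapT] := log_family_gap lam0 (ltry lam).
have [w1 [sol1 _ _]] := log_family_solution lam0.
have soly := solution_equilibrium a0 anu p1.
rewrite log_familyy in gap0 gapT.
have [|pos _] := gap_nondecreasing a0 anu p1 sol1 soly stab _ gap0 gapT; first by move=> x; rewrite lexx.
by have := pos t; rewrite gap_gt0 => /ltW.
Qed.

(** The limit is the supremum of the nondecreasing gap, positive because the gap is. It is taken in
    the extended reals, since monotonicity alone gives no finite bound. *)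
Lemma extend_family_ordered l1 l2 : p * C `^ (p - 1) <= nu ^+ 2 ->
  (0 < l1)%E -> (l1 < l2)%E ->
  (forall r, 0 < r -> Ue l1 r < Ue l2 r) /\
  exists2 L : \bar R, (0 < L)%E &
    ((Ue l2 r - Ue l1 r) / r `^ (- ns))%:E @[r --> +oo] --> L.
Proof.
move=> stab l10 l12; have l20 := lt_trans l10 l12.
have [gap0 gapT] := log_family_gap l10 l12.
have [w1 [sol1 _ _]] := log_family_solution l10.
have [w2 [sol2 _ _]] := log_family_solution l20.
have stab' : p * b <= nu ^+ 2 by rewrite -C_powR.
have [pos mono] := gap_nondecreasing a0 anu p1 sol1 sol2 stab'
  (fun t => log_family_stable_le t stab l20) gap0 gapT.
split; first by move=> r r0; rewrite extend_family_lt// -(gap_gt0 a).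
pose g t := (gap a (log_family l1) (log_family l2) t)%:E.
have gL : g t @[t --> +oo] --> ereal_sup (range g).
  by apply: nondecreasing_cvge => x y xy; rewrite lee_fin mono.
exists (ereal_sup (range g)).
  by apply: lt_le_trans (ereal_sup_ubound _); last (by exists 0); rewrite lte_fin.
have h := @cvg_comp _ _ _ (@ln R) g _ _ _ (@ln_cvgy R) gL.
apply: cvg_trans h; apply: near_eq_cvg; near=> r.
have r0 : 0 < r by near: r; apply: nbhs_pinfty_gt; exact: num_real.
by rewrite /= /g gap_familyE.
Unshelve. all: by end_near. Qed.

Lemma log_family_neq l1 l2 : (0 < l1)%E -> (l1 < l2)%E ->
  ~ forall t, log_family l1 t = log_family l2 t.
Proof.
move=> l10 l12 E; have [_ [T /(_ T (lexx T))]] := log_family_gap l10 l12.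
by rewrite gap_gt0 E ltxx.
Qed.

(** Nothing is assumed on the order of [l1] and [l2], so that exchanging them yields both signs of
    the oscillation. *)
Lemma log_family_crossing l1 l2 T : nu ^+ 2 < p * C `^ (p - 1) ->
  (0 < l1)%E -> (0 < l2)%E -> ~ (forall t, log_family l1 t = log_family l2 t) ->
  exists2 t, T < t & log_family l2 t < log_family l1 t.
Proof.
rewrite C_powR => unst l10 l20 ne.
have [w1 [sol1 cv1 [M1 hM1]]] := log_family_solution l10.
have [w2 [sol2 cv2 [M2 hM2]]] := log_family_solution l20.
apply: contrapT => h; apply: ne.
have v12 t : T + 1 <= t -> log_family l1 t <= log_family l2 t.
  by move=> Tt; rewrite leNgt; apply/negP => ?; apply: h; exists t => //; lra.
have [T' E] := gap_eventually_zero a0 anu p1 sol1 sol2 unst cv1 v12.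
apply: (solution_backward_unique a0 anu p1 sol1 sol2 (M := Num.max M1 M2) _ _ E) => t.
  by rewrite le_max hM1.
by rewrite le_max hM2 orbT.
Qed.

Lemma extend_family_oscillate l1 l2 rho : nu ^+ 2 < p * C `^ (p - 1) ->
  (0 < l1)%E -> (l1 < l2)%E -> 0 < rho ->
  changes_sign_on `]rho, +oo[ (fun r => Ue l2 r - Ue l1 r).
Proof.
move=> unst l10 l12 rho0; have l20 := lt_trans l10 l12.
have ne := log_family_neq l10 l12.
have itv t : ln rho < t -> `]rho, +oo[%classic (expR t).
  by move=> h; rewrite /= in_itv/= andbT -[ltLHS]lnK ?posrE// ltr_expR.
split.
  have [t Tt h] := log_family_crossing (ln rho) unst l20 l10 (fun E => ne (fun t => esym (E t))).
  exists (expR t); first exact: itv.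
  by rewrite subr_gt0 extend_family_lt ?expR_gt0// expRK.
have [t Tt h] := log_family_crossing (ln rho) unst l10 l20 ne.
exists (expR t); first exact: itv.
by rewrite subr_lt0 extend_family_lt ?expR_gt0// expRK.
Qed.

Lemma extend_family_gt0 l r : (0 < l)%E -> 0 < r -> 0 < Ue l r.
Proof.
move=> l0 r0; have [w [[_ _ pos] _ _]] := log_family_solution l0.
by rewrite extend_familyE// mulr_gt0// powR_gt0.
Qed.

Lemma extend_family_continuous l r : (0 < l)%E -> 0 < r -> {for r, continuous (Ue l)}.
Proof.
move=> l0 r0; have [w [[dv _ _] _ _]] := log_family_solution l0.
have h := is_derive_mul (@is_derive1_powR _ (- m) r r0)
   (@is_derive1_comp _ (log_family l) (@ln R) r _ _ (dv (ln r)) (is_derive1_ln r0)).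
have /is_derive_continuous c := h.
rewrite /prop_for/continuous_at extend_familyE//.
apply: cvg_trans c; apply: near_eq_cvg; near=> s.
by rewrite /= extend_familyE//; near: s; exact: lt_nbhsr.
Unshelve. all: by end_near. Qed.

(** The exponent [2 / (p - 1)] is the one for which [U^(p - 1)] scales like the Hardy potential. *)
Lemma extend_family_potential l r : (0 < l)%E -> 0 < r ->
  Ue l r `^ (p - 1) = log_family l (ln r) `^ (p - 1) / r ^+ 2.
Proof.
move=> l0 r0; have [w [[_ _ pos] _ _]] := log_family_solution l0.
have pn : p - 1 != 0 by rewrite subr_eq0 gt_eqF.
rewrite extend_familyE// powRM ?powR_ge0 ?ltW// -powRrM mulrC; congr (_ * _).
have -> : - m * (p - 1) = - 2%:R by field.
by rewrite powRN powR_mulrn// ltW.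
Qed.

Lemma extend_family_stable_potential l r : p * C `^ (p - 1) <= nu ^+ 2 -> (0 < l)%E -> 0 < r ->
  p * Ue l r `^ (p - 1) <= nu ^+ 2 / r ^+ 2.
Proof.
move=> stab l0 r0; have [w [[_ _ pos] _ _]] := log_family_solution l0.
rewrite extend_family_potential// mulrA ler_pM2r ?invr_gt0 ?exprn_gt0//.
apply: (le_trans _ stab); rewrite ler_pM2l; last by apply: lt_trans p1.
by apply: powR_mono; [rewrite subr_gt0|exact: pos|exact: log_family_stable_le].
Qed.

Lemma extend_family_unstable_potential l : nu ^+ 2 < p * C `^ (p - 1) -> (0 < l)%E ->
  exists2 delta, 0 < delta & exists T, forall r, 0 < r -> T <= ln r ->
    (nu ^+ 2 + delta) / r ^+ 2 <= p * Ue l r `^ (p - 1).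
Proof.
move=> unst l0; have [w [[_ _ pos] cv _]] := log_family_solution l0.
have vp : p * log_family l x `^ (p - 1) @[x --> +oo] --> p * C `^ (p - 1).
  apply: cvgMr.
  have cb : {for C, continuous (fun y => y `^ (p - 1))}.
    exact/is_derive_continuous/is_derive1_powR.
  exact: (@cvg_comp _ _ _ (log_family l) (fun y => y `^ (p - 1)) _ _ _ cv cb).
pose delta := (p * C `^ (p - 1) - nu ^+ 2) / 2.
have delta0 : 0 < delta by rewrite divr_gt0// subr_gt0.
have [T hT] := (cvgy_dist _ _).1 vp delta delta0.
exists delta => //; exists T => r r0 /hT.
rewrite extend_family_potential// mulrA ler_pM2r ?invr_gt0 ?exprn_gt0//.
by rewrite ltr_norml => /andP[h _]; move: h; rewrite /delta; lra.
Qed.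

End family.

(** * Integration over R^n *)

Section boxes.
Context {R : realType}.
Implicit Types (n : nat) (r e : R).

Lemma rV_norm_ge n (x : 'rV[R]_n) i : `|x ord0 i| <= `|x|.
Proof.
have /mapP[j Hj E] : `|x ord0 i| \in [seq `|x x0.1 x0.2| | x0 : 'I_1 * 'I_n].
  by apply/mapP; exists (ord0, i) => //=; rewrite mem_enum.
by rewrite E [leRHS]/Num.norm /= mx_normrE; apply/bigmax_geP; right => /=; exists j.
Qed.

Lemma rV_norm_lt n (x : 'rV[R]_n) e : 0 < e -> (forall i, `|x ord0 i| < e) -> `|x| < e.
Proof.
move=> e0 xe; have : ball (0 : 'rV[R]_n) e x.
  by split=> // i j; rewrite mxE /ball/= sub0r normrN ord1.
by rewrite mx_norm_ball /ball_/= sub0r normrN.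
Qed.

(** The measure lives on tuples, topology and derivatives on row vectors; this map and the boxes,
    which are sup-norm balls seen on tuples, connect the two. *)
Definition rV_of_tuple n (t : n.-tuple (measurableTypeR R)) : 'rV[R]_n := \row_i tnth t i.

Definition box n (x : 'rV[R]_n) r : set (n.-tuple (measurableTypeR R)) :=
  [set t | forall i, ball (x ord0 i) r (tnth t i)].

Lemma measurable_box n (x : 'rV[R]_n) r : measurable (box x r).
Proof.
have -> : box x r = \bigcap_(i in [set: 'I_n]) ((@tnth n _)^~ i @^-1` ball (x ord0 i) r).
  by apply/seteqP; split => t h i => [_|]; apply: h.
apply: fin_bigcap_measurable => [|i _]; first exact: finite_finset.
rewrite -[X in measurable X]setTI.
by apply: measurable_tnth => //; exact: measurable_ball.
Qed.

(** Tuples carry the product sigma-algebra, so the preimage of an open interval has to be written as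
    a countable union of measurable sets: the boxes with rational centre and radius [1 / (k + 1)]
    that it contains. *)
Lemma continuous_measurable_rV n (f : 'rV[R]_n -> R) : continuous f ->
  measurable_fun setT (fun t : n.-tuple (measurableTypeR R) => f (rV_of_tuple t)).
Proof.
move=> /continuousP cf; apply: (measurability _ (RGenOpens.measurableE R)).
move=> _ [_ [a [b ->] <-]]; rewrite setTI.
have oA : open (f @^-1` `]a, b[) by exact/cf/interval_open.
set A := f @^-1` _ in oA.
pose P (qk : 'rV[rat]_n * nat) := box (map_mx ratr qk.1) (qk.2.+1%:R^-1).
have -> : (fun t => f (rV_of_tuple t)) @^-1` `]a, b[ =
   \bigcup_(qk in [set qk | P qk `<=` (@rV_of_tuple n) @^-1` A]) P qk.
  apply/seteqP; split => t /=; last by move=> [qk /= h /h].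
  move=> At; have {}At : A (rV_of_tuple t) := At.
  have /nbhs_ballP[e /= e0 eA] : nbhs (rV_of_tuple t) A by exact: open_nbhs_nbhs.
  have [k ke] : exists k, k.+1%:R^-1 < e / 2.
    exists (Num.truncn (2 / e)); rewrite -[ltRHS]invrK ltf_pV2 ?posrE ?invr_gt0 ?divr_gt0//.
    by rewrite invf_div truncnS_gt.
  have q (i : 'I_n) : {q : rat | ball (ratr q : R) k.+1%:R^-1 (tnth t i)}.
    apply: cid; have [|q qt] := @rat_in_itvoo R (tnth t i - k.+1%:R^-1) (tnth t i + k.+1%:R^-1).
      by rewrite ltrD2l gtrN// invr_gt0.
    by exists q; move: qt; rewrite in_itv/= /ball/= ltr_distl.
  exists (\row_i sval (q i), k) => /=; last by move=> i; rewrite !mxE; exact: (svalP (q i)).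
  move=> s hs; apply: eA; split => // i j; rewrite !mxE.
  have := hs j; have := svalP (q j); rewrite /= !mxE /ball/= => h1 h2.
  apply: (le_lt_trans (ler_distD (ratr (sval (q j))) _ _)).
  rewrite distrC [ltRHS]splitr; apply: ltrD; first exact: lt_trans h1 ke.
  exact: lt_trans h2 ke.
rewrite bigcup_mkcond; apply: countable_bigcupT_measurable; first exact: countableP.
by move=> qk; case: ifPn => // _; exact: measurable_box.
Qed.

Local Notation tm n := (tuple_measure (@lebesgue_measure R) n).

Lemma tuple_measure_box n (x : 'rV[R]_n) r : 0 <= r -> tm n (box x r) = ((r *+ 2) ^+ n)%:E.
Proof.
move=> r0; elim: n x => [|n IH] x.
  rewrite /= /dirac indicE mem_set//; by case.
rewrite /= /cons_measure /pushforward.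
have -> : @tuple_cons _ _ n @^-1` box x r =
   ball (x ord0 ord0) r `*` box (\row_i x ord0 (lift ord0 i)) r.
  apply/seteqP; split => -[y t] /=.
    move=> h; split; first by have := h ord0; rewrite tnth0.
    by move=> i; have := h (lift ord0 i); rewrite tnthS mxE.
  move=> [h0 h] i; case: (unliftP ord0 i) => [j|] ->; last by rewrite tnth0.
  by have := h j; rewrite tnthS mxE.
rewrite [LHS]product_measure1E; [|exact: measurable_ball|exact: measurable_box].
transitivity ((r *+ 2)%:E * ((r *+ 2) ^+ n)%:E)%E; last by rewrite -EFinM exprS.
by congr (_ * _)%E; [exact: lebesgue_measure_ball|exact: IH].
Qed.

(** Compact support is encoded as vanishing outside a ball of the sup norm. The integrands of the
    quadratic form and of the divergence theorem are all brought into this class, which settles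
    their integrability at once. *)
Definition Cc n (f : 'rV[R]_n -> R) := continuous f /\ exists K, forall x, K < `|x| -> f x = 0.

Lemma Cc_bounded n (f : 'rV[R]_n -> R) : Cc f -> exists M, forall x, `|f x| <= M.
Proof.
move=> [cf [K fK]].
have cB : compact (closed_ball (0 : 'rV[R]_n) (`|K| + 1)).
  apply: bounded_closed_compact; last exact: closed_ball_closed.
  exists (`|K| + 1); split; first exact: num_real.
  move=> M KM x; rewrite closed_ballE ?ltr_wpDl// /closed_ball_/= sub0r normrN => h.
  exact: le_trans h (ltW KM).
have /compact_bounded [M [_ hM]] := continuous_compact (continuous_subspaceT cf) cB.
exists (`|M| + 1) => x.
have [xK|Kx] := leP `|x| (`|K| + 1).
  apply: (hM (`|M| + 1)); first by have := ler_norm M; lra.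
  by exists x => //; rewrite closed_ballE ?ltr_wpDl// /closed_ball_/= sub0r normrN.
rewrite fK ?normr0 ?addr_ge0//.
by have := ler_norm K; lra.
Qed.

Lemma Cc_integrable n (f : 'rV[R]_n -> R) : Cc f ->
  (tm n).-integrable setT (EFin \o (fun t => f (rV_of_tuple t))).
Proof.
move=> ccf; have [cf [K fK]] := ccf; have [M fM] := Cc_bounded ccf.
pose r := `|K| + 1.
have r0 : 0 < r by rewrite ltr_wpDl.
have mB := measurable_box (0 : 'rV[R]_n) r.
have mf := continuous_measurable_rV cf.
have E : EFin \o (fun t => f (rV_of_tuple t)) =
   (EFin \o (fun t => f (rV_of_tuple t))) \_ (box (0 : 'rV[R]_n) r).
  apply/funext => t; rewrite patchE; case: ifPn => //; rewrite notin_setE => h /=.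
  rewrite fK//; apply: contra_notT h; rewrite -leNgt => h i.
  rewrite !mxE /ball/= sub0r normrN; apply: le_lt_trans (_ : K < r); last first.
    by rewrite /r; have := ler_norm K; lra.
  apply: le_trans h; have := rV_norm_ge (rV_of_tuple t) i; by rewrite mxE.
rewrite E -integrable_mkcond//; apply: measurable_bounded_integrable => //.
- apply: (@le_lt_trans _ _ ((r *+ 2) ^+ n)%:E); last exact: ltry.
  by rewrite le_eqVlt; apply/orP; left; apply/eqP; apply: tuple_measure_box; exact: ltW.
- exact: measurable_funTS.
- exists M; split; first exact: num_real.
  by move=> y My t _ /=; apply: le_trans (fM _) (ltW My).
Qed.

Lemma integral_rVE n (f : 'rV[R]_n -> R) :
  integral_rV f = \int[tm n]_t f (rV_of_tuple t).
Proof. by []. Qed.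

Lemma integral_rVD n (f g : 'rV[R]_n -> R) : Cc f -> Cc g ->
  integral_rV (fun x => f x + g x) = integral_rV f + integral_rV g.
Proof. by move=> /Cc_integrable fi /Cc_integrable gi; rewrite !integral_rVE RintegralD. Qed.

Lemma integral_rVZ n c (f : 'rV[R]_n -> R) : Cc f ->
  integral_rV (fun x => c * f x) = c * integral_rV f.
Proof. by move=> /Cc_integrable fi; rewrite !integral_rVE RintegralZl. Qed.

Lemma le_integral_rV n (f g : 'rV[R]_n -> R) : Cc f -> Cc g -> (forall x, f x <= g x) ->
  integral_rV f <= integral_rV g.
Proof.
move=> /Cc_integrable fi /Cc_integrable gi fg; rewrite !integral_rVE.
by apply: le_Rintegral => // t _; exact: fg.
Qed.

Lemma integral_rV_gt0 n (f : 'rV[R]_n -> R) x : Cc f -> (forall y, 0 <= f y) -> 0 < f x ->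
  0 < integral_rV f.
Proof.
move=> ccf f0 fx; have [cf _] := ccf.
have /cvgrPdist_lt/(_ (f x / 2)) := cf x; rewrite divr_gt0// => /(_ isT).
move=> /nbhs_ballP[r /= r0 hr].
have fi := Cc_integrable ccf.
have mB := measurable_box x r.
have -> : integral_rV f = \int[tm n]_t f (rV_of_tuple t) by [].
apply: (@lt_le_trans _ _ (\int[tm n]_(t in box x r) (f x / 2))).
  rewrite Rintegral_cst// mulr_gt0 ?divr_gt0//.
  by rewrite [X in fine X]tuple_measure_box ?ltW//= exprn_gt0// mulr2n addr_gt0.
apply: (@le_trans _ _ (\int[tm n]_(t in box x r) f (rV_of_tuple t))).
  apply: le_Rintegral => //.
  - apply/integrableP; split; first exact: measurable_cst.
    rewrite integral_cst//= [X in (_ * X)%E]tuple_measure_box ?(ltW r0)//.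
    exact: ltry.
  - exact: integrableS fi.
  - move=> t ht; have := hr (rV_of_tuple t).
    have hb : ball x r (rV_of_tuple t) by split => // i j; rewrite ord1 mxE.
    by move=> /(_ hb) /=; rewrite ltr_norml => /andP[? ?]; lra.
rewrite Rintegral_mkcond; apply: le_Rintegral => //.
- by have := integrableS measurableT mB (@subsetT _ _) fi; rewrite integrable_mkcond// restrict_EFin.
- by move=> t _; rewrite patchE; case: ifPn.
Qed.

End boxes.

(** * The divergence theorem for compactly supported fields *)

Section divergence.
Context {R : realType}.
Local Notation tm n := (tuple_measure (@lebesgue_measure R) n).
Local Notation leb := (@lebesgue_measure R).
Implicit Types (n : nat).

(** A directional derivative sees only the function [h |-> f (h v + a)] of one real variable. Hence
    derivatives can be carried over to slices and to spaces of another dimension. *)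
Lemma is_derive_reparam (V W : normedModType R) (f : V -> R) (g : W -> R) a v c w d :
  (forall h : R, f (h *: v + a) = g (h *: w + c)) -> is_derive a v f d -> is_derive c w g d.
Proof.
move=> fg [df fE].
have fg0 : f a = g c by have := fg 0; rewrite !scale0r !add0r.
have E : (fun h : R => h^-1 *: ((f \o shift a) (h *: v) - f a)) =
         (fun h : R => h^-1 *: ((g \o shift c) (h *: w) - g c)).
  by apply/funext => h /=; rewrite fg fg0.
by split; rewrite ?/derivable ?/derive -E.
Qed.

Definition rV_cons n (x : R) (y : 'rV[R]_n) : 'rV[R]_n.+1 :=
  \row_i oapp (y ord0) x (unlift ord0 i).

Lemma rV_cons0 n x (y : 'rV[R]_n) : rV_cons x y ord0 ord0 = x.
Proof. by rewrite mxE unlift_none. Qed.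

Lemma rV_consS n x (y : 'rV[R]_n) i : rV_cons x y ord0 (lift ord0 i) = y ord0 i.
Proof. by rewrite mxE liftK. Qed.

Lemma rV_consP n (u v : 'rV[R]_n.+1) : u ord0 ord0 = v ord0 ord0 ->
  (forall i, u ord0 (lift ord0 i) = v ord0 (lift ord0 i)) -> u = v.
Proof.
move=> h0 hS; apply/matrixP => i j; rewrite ord1.
by case: (unliftP ord0 j) => [k|] ->.
Qed.

Lemma rV_of_tuple_cons n (z : R * n.-tuple (measurableTypeR R)) :
  rV_of_tuple (tuple_cons z) = rV_cons z.1 (rV_of_tuple z.2).
Proof.
apply: rV_consP => [|i]; first by rewrite rV_cons0 mxE tnth0.
by rewrite rV_consS !mxE tnthS.
Qed.

Lemma rV_consB n x y (u v : 'rV[R]_n) : rV_cons x u - rV_cons y v = rV_cons (x - y) (u - v).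
Proof.
apply: rV_consP => [|i]; first by rewrite rV_cons0 !mxE unlift_none.
by rewrite rV_consS !mxE liftK.
Qed.

Lemma rV_cons_norm_lt n x (y : 'rV[R]_n) e : `|x| < e -> `|y| < e -> `|rV_cons x y| < e.
Proof.
move=> xe ye; apply: rV_norm_lt; first exact: le_lt_trans xe.
move=> i; case: (unliftP ord0 i) => [j|] ->; last by rewrite rV_cons0.
by rewrite rV_consS; apply: le_lt_trans ye; exact: rV_norm_ge.
Qed.

Lemma continuous_rV_consl n (y : 'rV[R]_n) : continuous (fun x => rV_cons x y).
Proof.
move=> x; apply/cvgrPdist_lt => e e0; near=> x'.
rewrite rV_consB subrr; apply: rV_cons_norm_lt; last by rewrite normr0.
by near: x'; apply: cvgr_dist_lt.
Unshelve. all: by end_near. Qed.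

Lemma continuous_rV_consr n x : continuous (fun y : 'rV[R]_n => rV_cons x y).
Proof.
move=> y A /nbhs_ballP[e e0 eA]; apply/nbhs_ballP; exists e => // y'.
rewrite mx_norm_ball /ball_/= => yy'; apply: eA.
rewrite mx_norm_ball /ball_/= rV_consB subrr.
by apply: rV_cons_norm_lt; rewrite ?normr0.
Qed.

Lemma rV_cons_norm_ger n x (y : 'rV[R]_n) : `|y| <= `|rV_cons x y|.
Proof.
rewrite leNgt; apply/negP => h; have := ltxx `|y|.
rewrite rV_norm_lt//; first exact: le_lt_trans h.
by move=> i; apply: le_lt_trans h; rewrite -(rV_consS x y); exact: rV_norm_ge.
Qed.

Lemma rV_cons_norm_gel n x (y : 'rV[R]_n) : `|x| <= `|rV_cons x y|.
Proof. by rewrite -{1}(rV_cons0 x y); exact: rV_norm_ge. Qed.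

Lemma Cc_slicer n x (f : 'rV[R]_n.+1 -> R) : Cc f -> Cc (fun y => f (rV_cons x y)).
Proof.
move=> [cf [K fK]]; split.
  by move=> y; apply: continuous_comp; [exact: continuous_rV_consr|exact: cf].
by exists K => y Ky; apply: fK; apply: lt_le_trans Ky _; exact: rV_cons_norm_ger.
Qed.

Lemma Cc_integrable_cons n (f : 'rV[R]_n.+1 -> R) : Cc f ->
  (leb \x tm n)%E.-integrable setT (fun z => (f (rV_cons z.1 (rV_of_tuple z.2)))%:E).
Proof.
move=> ccf; have fi := Cc_integrable ccf.
have mphi := @measurable_tuple_cons _ (measurableTypeR R) n.
have [mf fi'] := (elimT (integrableP _ _ _) fi).
apply/integrableP; split.
  rewrite (_ : (fun z => _) = (EFin \o (fun t => f (rV_of_tuple t))) \o @tuple_cons _ (measurableTypeR R) n).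
    exact: measurableT_comp.
  by apply/funext => z /=; rewrite rV_of_tuple_cons.
move: fi'; rewrite /= [X in (X < _)%E](@ge0_integral_pushforward _ _ _ _ _ _ mphi)//; last first.
  exact: (measurableT_comp (@abse_measurable R setT) mf).
by rewrite preimage_setT; under eq_integral do rewrite /= rV_of_tuple_cons.
Qed.

Lemma integral_tuple_cons n (f : 'rV[R]_n.+1 -> R) : Cc f ->
  (\int[tm n.+1]_t (f (rV_of_tuple t))%:E =
   \int[leb \x tm n]_z (f (rV_cons z.1 (rV_of_tuple z.2)))%:E)%E.
Proof.
move=> ccf; have fi := Cc_integrable_cons ccf.
have mphi := @measurable_tuple_cons _ (measurableTypeR R) n.
have [mf _] := (elimT (integrableP _ _ _) (Cc_integrable ccf)).
rewrite [LHS](@integral_pushforward _ _ _ _ _ _ mphi)//; last first.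
  rewrite preimage_setT; move: fi; congr (_.-integrable _ _).
  by apply/funext => z /=; rewrite rV_of_tuple_cons.
by rewrite preimage_setT; under eq_integral do rewrite /= rV_of_tuple_cons.
Qed.

Lemma integral_derive_eq0 (f g : R -> R) K : has_derive f g -> continuous g ->
  (forall x, K < `|x| -> f x = 0) -> (forall x, K < `|x| -> g x = 0) ->
  (\int[leb]_x (g x)%:E = 0)%E.
Proof.
move=> df cg fK gK; pose r := `|K| + 1.
have r0 : 0 < r by rewrite ltr_wpDl.
have Kr : K < r by have := ler_norm K; rewrite /r; lra.
have -> : (fun x => (g x)%:E) = (fun x => (g x)%:E) \_ `[- r, r].
  apply/funext => x; rewrite patchE; case: ifPn => //; rewrite notin_setE/= in_itv/= => h.
  rewrite gK//; apply: contra_notT h; rewrite -leNgt => h.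
  by rewrite -ler_norml (le_trans h)// ltW.
rewrite -integral_mkcond (@continuous_FTC2 _ g f).
- by rewrite !fK ?subee// ?normrN ger0_norm ?ltW.
- by lra.
- exact: continuous_subspaceT.
- have cf := has_derive_continuous df; split.
  + by move=> x _; have h := df x; exact: ex_derive.
  + exact/cvg_at_right_filter/cf.
  + exact/cvg_at_left_filter/cf.
- by move=> x _; have h := df x; rewrite derive1E derive_val.
Qed.

(** Fubini after splitting off the first coordinate. A derivative along that coordinate integrates
    to zero on every line by the fundamental theorem of calculus; any other one integrates to zero
    on every slice, by induction on the dimension. *)
Lemma integral_partial_eq0 n (i : 'I_n) (f g : 'rV[R]_n -> R) : Cc f -> Cc g ->
  (forall x, is_derive x (delta_mx ord0 i) f (g x)) ->
  (\int[tm n]_t (g (rV_of_tuple t))%:E = 0)%E.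
Proof.
elim: n i f g => [|n IH] i f g ccf ccg dfg; first by case: (i).
rewrite integral_tuple_cons//; have gi := Cc_integrable_cons ccg.
case: (unliftP ord0 i) => [j|] Ei; rewrite {}Ei in dfg.
- rewrite -(integral12_prod_meas1 gi) [LHS]integral0_eq// => x _.
  apply: (IH j (fun y => f (rV_cons x y)) (fun y => g (rV_cons x y))); try exact: Cc_slicer.
  move=> y; apply: is_derive_reparam (dfg (rV_cons x y)) => h; congr f.
  apply: rV_consP => [|k].
    by rewrite rV_cons0 !mxE unlift_none /= mulr0 add0r.
  by rewrite rV_consS !mxE liftK /= (inj_eq lift_inj).
- rewrite -(integral21_prod_meas1 gi) [LHS]integral0_eq// => t _.
  have [cf [K fK]] := ccf; have [cg [K' gK]] := ccg.
  pose y := rV_of_tuple t.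
  apply: (@integral_derive_eq0 (fun x => f (rV_cons x y)) (fun x => g (rV_cons x y)) (Num.max K K')).
  + move=> x; apply: is_derive_reparam (dfg (rV_cons x y)) => h; congr f.
    apply: rV_consP => [|k].
      by rewrite [RHS]rV_cons0 mxE [X in _ + X]rV_cons0 mxE mxE /=.
    by rewrite [RHS]rV_consS mxE [X in _ + X]rV_consS mxE mxE /= mulr0 add0r.
  + by move=> x; apply: continuous_comp; [exact: continuous_rV_consl|exact: cg].
  + move=> x; rewrite gt_max => /andP[Kx _]; apply: fK.
    exact: lt_le_trans (rV_cons_norm_gel _ _).
  + move=> x; rewrite gt_max => /andP[_ Kx]; apply: gK.
    exact: lt_le_trans (rV_cons_norm_gel _ _).
Qed.

Lemma Cc0 n : Cc (fun _ : 'rV[R]_n => 0).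
Proof. by split; [exact: cst_continuous|exists 0]. Qed.

Lemma Cc_add n (f g : 'rV[R]_n -> R) : Cc f -> Cc g -> Cc (fun x => f x + g x).
Proof.
move=> [cf [K fK]] [cg [K' gK]]; split; first exact: (fun x => cvgD (cf x) (cg x)).
by exists (Num.max K K') => x; rewrite gt_max => /andP[h h']; rewrite fK// gK// addr0.
Qed.

Lemma Cc_mull n (f g : 'rV[R]_n -> R) : continuous f -> Cc g -> Cc (fun x => f x * g x).
Proof.
move=> cf [cg [K gK]]; split; first exact: (fun x => cvgM (cf x) (cg x)).
by exists K => x h; rewrite gK// mulr0.
Qed.

Lemma Cc_scale n c (f : 'rV[R]_n -> R) : Cc f -> Cc (fun x => c * f x).
Proof. by apply: Cc_mull; exact: cst_continuous. Qed.

Lemma Cc_sum n m (f : 'I_m -> 'rV[R]_n -> R) : (forall i, Cc (f i)) ->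
  Cc (fun x => \sum_i f i x).
Proof.
move=> ccf; elim: m f ccf => [|m IH] f ccf.
  by under eq_fun do rewrite big_ord0; exact: Cc0.
under eq_fun do rewrite big_ord_recl; apply: Cc_add => //.
exact: IH.
Qed.

Theorem divergence_theorem n (F G : 'I_n -> 'rV[R]_n -> R) :
  (forall i, Cc (F i)) -> (forall i, Cc (G i)) ->
  (forall i x, is_derive x (delta_mx ord0 i) (F i) (G i x)) ->
  integral_rV (fun x => \sum_i G i x) = 0.
Proof.
move=> ccF ccG dFG.
have int0 i : integral_rV (G i) = 0.
  by rewrite integral_rVE /Rintegral (integral_partial_eq0 (ccF i) (ccG i) (dFG i)).
(* The number of summands is separated from the dimension, which allows an induction on the
   former. *)
suff : forall m (H : 'I_m -> 'rV[R]_n -> R), (forall i, Cc (H i)) ->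
    (forall i, integral_rV (H i) = 0) -> integral_rV (fun x => \sum_i H i x) = 0.
  by apply.
elim=> [|m IH] H ccH int0H.
  under eq_fun do rewrite big_ord0.
  rewrite -[RHS](mul0r (integral_rV (fun _ : 'rV[R]_n => 0))) -integral_rVZ; last exact: Cc0.
  by congr integral_rV; apply/funext => x; rewrite mul0r.
under eq_fun do rewrite big_ord_recl.
rewrite integral_rVD ?int0H ?IH ?addr0//; exact: Cc_sum.
Qed.

End divergence.

(** * Stability *)

Section pointwise.
Context {R : realType} {T : topologicalType}.
Implicit Types (f g : T -> R) (h : R -> R) (x : T).

Lemma continuous_pointM f g x : {for x, continuous f} -> {for x, continuous g} ->
  {for x, continuous (fun y => f y * g y)}.
Proof. exact: cvgM. Qed.

Lemma continuous_pointD f g x : {for x, continuous f} -> {for x, continuous g} ->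
  {for x, continuous (fun y => f y + g y)}.
Proof. exact: cvgD. Qed.

Lemma continuous_point_comp f h x : {for x, continuous f} -> {for f x, continuous h} ->
  {for x, continuous (fun y => h (f y))}.
Proof. exact: continuous_comp. Qed.

Lemma continuous_point_sqr f x : {for x, continuous f} ->
  {for x, continuous (fun y => f y ^+ 2)}.
Proof. by move=> cf; apply: (continuous_pointM cf cf). Qed.

Lemma continuous_pointV f x : f x != 0 -> {for x, continuous f} ->
  {for x, continuous (fun y => (f y)^-1)}.
Proof. by move=> f0 cf; apply: (continuous_point_comp cf); exact: inv_continuous. Qed.

Lemma near_eq_cst_continuous f x c : (\near x, c = f x) -> {for x, continuous f}.
Proof.
move=> h; rewrite /prop_for /continuous_at -(nbhs_singleton h).
apply/cvgrPdist_lt => d d0.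
by apply: filterS h => y <-; rewrite subrr normr0.
Qed.

End pointwise.

Lemma open_ball_subset {R : realType} {V : pseudoMetricType R} (A : set V) x :
  open A -> A x -> exists2 e : R, 0 < e & ball x e `<=` A.
Proof.
move=> oA Ax; have /nbhs_ballP[e /= e0 he] : nbhs x A by exact: open_nbhs_nbhs.
by exists e.
Qed.

Section directional.
Context {R : realType} {V : normedModType R}.
Implicit Types (f g : V -> R) (h : R -> R) (x v : V) (a b : R).

Lemma is_derive_dirD f g x v a b : is_derive x v f a -> is_derive x v g b ->
  is_derive x v (fun y => f y + g y) (a + b).
Proof. exact: is_deriveD. Qed.

Lemma is_derive_dirM f g x v a b : is_derive x v f a -> is_derive x v g b ->
  is_derive x v (fun y => f y * g y) (f x * b + g x * a).
Proof. exact: is_deriveM. Qed.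

Lemma is_derive_dir_cst c x v : is_derive x v (fun=> c : R) 0.
Proof. exact: is_derive_cst. Qed.

Lemma is_derive_dir_comp h f x v a b : is_derive (f x) 1 h b -> is_derive x v f a ->
  is_derive x v (fun y => h (f y)) (b * a).
Proof.
move=> dh df.
have df0 : is_derive (0 : R) 1 (fun t : R => f (t *: v + x)) a.
  by apply: is_derive_reparam df => t; rewrite addr0 [t%:A]mulr1.
have dh0 : is_derive ((fun t : R => f (t *: v + x)) 0) 1 h b by rewrite /= scale0r add0r.
apply: is_derive_reparam (is_derive1_comp dh0 df0) => t /=.
by rewrite addr0 [t%:A]mulr1.
Qed.

End directional.

(** * The Euclidean norm and its partial derivatives *)

Section euclidean_norm.
Context {R : realType} {n : nat}.
Implicit Types (x y : 'rV[R]_n) (i : 'I_n).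

Definition sqsum x : R := \sum_i x ord0 i ^+ 2.

Lemma sqsum_ge0 x : 0 <= sqsum x.
Proof. by apply: sumr_ge0 => i _; exact: sqr_ge0. Qed.

Lemma sqr_enorm x : enorm x ^+ 2 = sqsum x.
Proof. by rewrite sqr_sqrtr// sqsum_ge0. Qed.

Lemma le_coord_enorm x i : `|x ord0 i| <= enorm x.
Proof.
rewrite -[leLHS]sqrtr_sqr; apply: ler_wsqrtr.
by rewrite (bigD1 i)//= lerDl; apply: sumr_ge0 => j _; exact: sqr_ge0.
Qed.

Lemma norm_le_enorm x : `|x| <= enorm x.
Proof.
rewrite leNgt; apply/negP => h; have := ltxx `|x|.
rewrite rV_norm_lt//; first exact: le_lt_trans (sqrtr_ge0 _) h.
by move=> i; apply: le_lt_trans h; exact: le_coord_enorm.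
Qed.

Lemma enorm_gt0 x : x != 0 -> 0 < enorm x.
Proof. by rewrite -normr_gt0 => /lt_le_trans; apply; exact: norm_le_enorm. Qed.

Lemma enorm0 : enorm (0 : 'rV[R]_n) = 0.
Proof. by rewrite /enorm big1 ?sqrtr0// => i _; rewrite mxE expr0n. Qed.

Lemma continuous_coord i : continuous (fun x => x ord0 i).
Proof. exact: coord_continuous. Qed.

Lemma continuous_bigsum (I : Type) (r : seq I) (f : I -> 'rV[R]_n -> R) :
  (forall j, continuous (f j)) -> continuous (fun x => \sum_(j <- r) f j x).
Proof.
move=> cf; elim: r => [|j r IH].
  by under eq_fun do rewrite big_nil; exact: cst_continuous.
under eq_fun do rewrite big_cons.
exact: (fun x => cvgD (cf j x) (IH x)).
Qed.

Lemma continuous_sqsum : continuous sqsum.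
Proof.
apply: continuous_bigsum => i; under eq_fun do rewrite expr2.
by move=> x; apply: continuous_pointM; exact: continuous_coord.
Qed.

Lemma continuous_enorm : continuous (@enorm R n).
Proof.
move=> x; apply: (@continuous_point_comp _ _ sqsum Num.sqrt); first exact: continuous_sqsum.
exact: sqrt_continuous.
Qed.

Lemma is_derive_coord x i j : is_derive x (delta_mx ord0 i) (fun y => y ord0 j) (j == i)%:R.
Proof.
have d : is_derive (x ord0 j) ((j == i)%:R : R) (fun t : R => t) (j == i)%:R by exact: is_derive_id.
apply: is_derive_reparam d => h.
by rewrite [RHS]mxE [X in _ = X + _]mxE [X in _ = _ * X + _]mxE eqxx.
Qed.

Lemma is_derive_sqsum x i : is_derive x (delta_mx ord0 i) sqsum (2 * x ord0 i).
Proof.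
have d (j : 'I_n) : is_derive x (delta_mx ord0 i) (fun y => y ord0 j ^+ 2)
    (2 * x ord0 j * (j == i)%:R).
  have D := is_derive_coord x i j; apply: is_derive_eq (is_derive_dirM D D) _.
  by ring.
have := is_derive_sum d; rewrite (_ : \sum_(j < n) _ = 2 * x ord0 i); last first.
  rewrite (bigD1 i)//= eqxx mulr1 big1 ?addr0// => j /negbTE ->.
  by rewrite mulr0.
rewrite (_ : \sum_(j < n) _ = sqsum)//.
by apply/funext => y; rewrite fct_sumE.
Qed.

End euclidean_norm.

(** * Functions vanishing near the origin and near infinity *)

Section vanishing.
Context {R : realType} {n : nat}.
Implicit Types (f g : 'rV[R]_n -> R) (e K : R) (x : 'rV[R]_n).

(** Products of such a function with powers of [|x|] vanish around the origin, so continuity and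
    differentiability need a check only at [x != 0]. *)
Definition annular e K f := forall x, `|x| < e \/ K < `|x| -> f x = 0.

Lemma annular_near e K f x : annular e K f -> `|x| < e \/ K < `|x| -> \near x, 0 = f x.
Proof.
move=> zf h.
have cn : {for x, continuous (fun y : 'rV[R]_n => `|y|)} by exact: norm_continuous.
case: h => h.
- have : \near x, `|x| < e.
    by apply: (cn [set t | t < e]); exact: lt_nbhsl.
  by apply: filterS => y h'; rewrite zf//; left.
- have : \near x, K < `|x|.
    by apply: (cn [set t | K < t]); exact: lt_nbhsr.
  by apply: filterS => y h'; rewrite zf//; right.
Qed.

Lemma annular_is_derive e K f x v : annular e K f -> `|x| < e \/ K < `|x| ->
  is_derive x v f 0.
Proof.
by move=> zf h; apply: near_eq_is_derive (is_derive_dir_cst 0 x v); exact: annular_near h.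
Qed.

Lemma annular_partial e K f i : annular e K f -> annular e K (partial i f).
Proof. by move=> zf x h; have d := annular_is_derive (delta_mx ord0 i) zf h; exact: derive_val. Qed.

Lemma annular_Cc e K f : 0 < e -> annular e K f -> (forall x, x != 0 -> {for x, continuous f}) ->
  Cc f.
Proof.
move=> e0 zf cf; split; last by exists K => x h; apply: zf; right.
suff cf' x : {for x, continuous f} by [].
have [->|] := eqVneq x 0; last exact: cf.
have h0 : `|0 : 'rV[R]_n| < e \/ K < `|0 : 'rV[R]_n| by left; rewrite normr0.
by apply: near_eq_cst_continuous; exact: annular_near h0.
Qed.

Lemma test_function_annular (f : 'rV[R]_n -> R) : test_function [set x | x != 0] f ->
  exists e K, 0 < e /\ annular e K f.
Proof.
move=> [_ ct st].
have o0 : open (~` tsupport f) by apply: closed_openC; exact: closed_closure.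
have n0 : (~` tsupport f) 0 by move=> /st /=; rewrite eqxx.
have [e e0 he] := open_ball_subset o0 n0.
have [M [_ hM]] := compact_bounded ct.
have tf x : f x != 0 -> tsupport f x by move=> h; exact: subset_closure.
exists e, (M + 1); split => // x [h|h]; apply/eqP; rewrite -[_ == _]negbK; apply/negP => /tf.
  by apply: he; rewrite mx_norm_ball /ball_/= sub0r normrN.
by move=> tx; have /(_ x tx) /= := hM (M + 1) (ltr_pwDr ltr01 (lexx M)); rewrite leNgt h.
Qed.

End vanishing.

Lemma sqsum_gt0 {R : realType} n (x : 'rV[R]_n) : x != 0 -> 0 < sqsum x.
Proof. by move=> x0; rewrite -sqr_enorm exprn_gt0// enorm_gt0. Qed.

Lemma normr0_lt_annulus {R : realType} n (e K : R) : 0 < e ->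
  `|0 : 'rV[R]_n| < e \/ K < `|0 : 'rV[R]_n|.
Proof. by left; rewrite normr0. Qed.

Section stability.
Context {R : realType} {N : nat}.
Variables (nu p : R) (u : 'rV[R]_N -> R).
Implicit Types (phi : 'rV[R]_N -> R) (x : 'rV[R]_N).

Lemma sqr_enorm_gradient phi x :
  enorm (gradient phi x) ^+ 2 = \sum_i partial i phi x ^+ 2.
Proof. by rewrite sqr_enorm; apply: eq_bigr => i _; rewrite mxE. Qed.

Definition energy_density phi x : R := enorm (gradient phi x) ^+ 2
  + (nu ^+ 2 - nu_star N ^+ 2) * (phi x ^+ 2 / enorm x ^+ 2)
  + (- p) * (u x `^ (p - 1) * phi x ^+ 2).

Lemma integral_energy_density phi :
  Cc (fun x => enorm (gradient phi x) ^+ 2) -> Cc (fun x => phi x ^+ 2 / enorm x ^+ 2) ->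
  Cc (fun x => u x `^ (p - 1) * phi x ^+ 2) ->
  Cc (energy_density phi) /\
  integral_rV (energy_density phi) = integral_rV (fun x => enorm (gradient phi x) ^+ 2)
         + (nu ^+ 2 - nu_star N ^+ 2)
             * integral_rV (fun x => phi x ^+ 2 / enorm x ^+ 2)
         - p * integral_rV (fun x => u x `^ (p - 1) * phi x ^+ 2).
Proof.
move=> c1 c2 c3.
have c2' := Cc_scale (nu ^+ 2 - nu_star N ^+ 2) c2.
have c3' := Cc_scale (- p) c3.
have c12 := Cc_add c1 c2'.
split; first exact: Cc_add.
by rewrite [LHS]integral_rVD// integral_rVD// !integral_rVZ// mulNr.
Qed.

Hypothesis u_cont : forall x, x != 0 -> {for x, continuous (fun y => u y `^ (p - 1))}.

(* The right-hand side dominates [|d + nu_star a x / s|^2]; the last sum is, for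
   [d] the gradient of [a], the divergence of the field [a^2 x / s]. *)
Lemma hardy_pointwise (a : R) (x d : 'rV[R]_N) s V :
  s = sqsum x -> 0 < s -> V <= nu ^+ 2 / s ->
  0 <= \sum_i d ord0 i ^+ 2 + (nu ^+ 2 - nu_star N ^+ 2) * (a ^+ 2 / s) - V * a ^+ 2
   + nu_star N * \sum_i (2 * a * d ord0 i * x ord0 i / s
                          + a ^+ 2 * (s^-1 - 2 * x ord0 i ^+ 2 / s ^+ 2)).
Proof.
set ns := nu_star N => sE s0 Vs.
have : 0 <= \sum_i (d ord0 i + ns * a * x ord0 i / s) ^+ 2.
  by apply: sumr_ge0 => i _; exact: sqr_ge0.
have V2 : V * a ^+ 2 <= nu ^+ 2 / s * a ^+ 2 by rewrite ler_wpM2r// sqr_ge0.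
have sS c : c * s = \sum_i c * x ord0 i ^+ 2 by rewrite sE mulr_sumr.
have N2 : N%:R = 2 * ns + 2 :> R by rewrite /ns /nu_star; field.
have -> : \sum_i (d ord0 i + ns * a * x ord0 i / s) ^+ 2 =
   \sum_i d ord0 i ^+ 2 + (2 * ns * a / s) * (\sum_i d ord0 i * x ord0 i)
     + ns ^+ 2 * a ^+ 2 / s ^+ 2 * s.
  rewrite sS !mulr_sumr -!big_split /=; apply: eq_bigr => i _.
  by field; exact: lt0r_neq0.
have -> : \sum_i (2 * a * d ord0 i * x ord0 i / s
                          + a ^+ 2 * (s^-1 - 2 * x ord0 i ^+ 2 / s ^+ 2)) =
   (2 * a / s) * (\sum_i d ord0 i * x ord0 i) + (2 * ns + 2) * (a ^+ 2 / s)
     - 2 * a ^+ 2 / s ^+ 2 * s.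
  rewrite -N2 sS !mulr_sumr.
  rewrite (_ : N%:R * (a ^+ 2 / s) = \sum_(i < N) (a ^+ 2 / s)); last first.
    by rewrite sumr_const card_ord mulr_natl.
  rewrite -sumrN -!big_split /=; apply: eq_bigr => i _.
  by field; exact: lt0r_neq0.
move: V2; set X := \sum_i _ * _; set Y := \sum_i _ ^+ 2 => V2 h.
apply: (le_trans h); rewrite -subr_ge0.
have -> : Y + (nu ^+ 2 - ns ^+ 2) * (a ^+ 2 / s) - V * a ^+ 2 +
  ns * (2 * a / s * X + (2 * ns + 2) * (a ^+ 2 / s) - 2 * a ^+ 2 / s ^+ 2 * s) -
  (Y + 2 * ns * a / s * X + ns ^+ 2 * a ^+ 2 / s ^+ 2 * s) =
  nu ^+ 2 / s * a ^+ 2 - V * a ^+ 2.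
  by field; exact: lt0r_neq0.
by rewrite subr_ge0.
Qed.

Lemma annular_energy_Cc e K phi : 0 < e -> annular e K phi -> continuous phi ->
  (forall i, continuous (partial i phi)) ->
  [/\ Cc (fun x => enorm (gradient phi x) ^+ 2), Cc (fun x => phi x ^+ 2 / enorm x ^+ 2) &
   Cc (fun x => u x `^ (p - 1) * phi x ^+ 2)].
Proof.
move=> e0 za cphi cd.
have z2 : annular e K (fun x => phi x ^+ 2) by move=> x h; rewrite za// expr0n.
have c2 x : {for x, continuous (fun y => phi y ^+ 2)}.
  by apply: continuous_point_sqr; exact: cphi.
split.
- under eq_fun do rewrite sqr_enorm_gradient.
  apply: Cc_sum => i; split.
    by move=> x; apply: continuous_point_sqr; exact: cd.
  by exists K => x h; rewrite (annular_partial _ za) ?expr0n//; right.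
- apply: (@annular_Cc _ _ e K) => // [x h|x x0]; first by rewrite /= z2 ?mul0r.
  rewrite (_ : (fun y => _) = fun y => phi y ^+ 2 * (sqsum y)^-1); last first.
    by apply/funext => y; rewrite sqr_enorm.
  apply: continuous_pointM; first exact: c2.
  apply: continuous_pointV; last exact: continuous_sqsum.
  by rewrite gt_eqF// sqsum_gt0.
- apply: (@annular_Cc _ _ e K) => // [x h|x x0]; first by rewrite /= z2 ?mulr0.
  by apply: continuous_pointM; [exact: u_cont|exact: c2].
Qed.

Theorem hardy_stable : (forall x, x != 0 -> p * u x `^ (p - 1) <= nu ^+ 2 / enorm x ^+ 2) ->
  stable nu p u.
Proof.
move=> hu phi tphi; have [e [K [e0 za]]] := test_function_annular tphi.
have [smo _ _] := tphi.
have [cphi dphi] := smo 1%N.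
have cd i : continuous (partial i phi) by have [_ []] := dphi i.
have dp i x : is_derive x (delta_mx ord0 i) phi (partial i phi x).
  by have [d _] := dphi i; exact: (derivableP (d x)).
have [c1 c2 c3] := annular_energy_Cc e0 za cphi cd.
have [cc4 <-] := integral_energy_density c1 c2 c3.
(* The field [phi^2 x / |x|^2] and the terms of its divergence. The field is differentiable at the
   origin too, since [phi] vanishes nearby. *)
pose F i x := phi x ^+ 2 * (x ord0 i / sqsum x).
pose G i x := 2 * phi x * partial i phi x * x ord0 i / sqsum x
   + phi x ^+ 2 * ((sqsum x)^-1 - 2 * x ord0 i ^+ 2 / sqsum x ^+ 2).
have sc x : x != 0 -> {for x, continuous (fun y => (sqsum y)^-1)}.
  move=> x0; apply: continuous_pointV; last exact: continuous_sqsum.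
  by rewrite gt_eqF// sqsum_gt0.
have zF i : annular e K (F i) by move=> x h; rewrite /F za// expr0n mul0r.
have zG i : annular e K (G i) by move=> x h; rewrite /G za// expr0n mulr0 !mul0r addr0.
have cp2 x : {for x, continuous (fun y => phi y ^+ 2)}.
  by apply: continuous_point_sqr; exact: cphi.
have cx i x : {for x, continuous (fun y : 'rV[R]_N => y ord0 i)} by exact: continuous_coord.
have ccF i : Cc (F i).
  apply: annular_Cc e0 (zF i) _ => x x0.
  by apply: continuous_pointM => //; apply: continuous_pointM => //; exact: sc.
have ccG i : Cc (G i).
  apply: annular_Cc e0 (zG i) _ => x x0; rewrite /G.
  have ck (c : R) : {for x, continuous (fun _ : 'rV[R]_N => c)} by exact: cst_continuous.
  apply: continuous_pointD.
    apply: continuous_pointM; last exact: sc.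
    apply: continuous_pointM => //; apply: continuous_pointM; last exact: cd.
    by apply: continuous_pointM; [exact: ck|exact: cphi].
  apply: continuous_pointM => //; apply: continuous_pointD; first exact: sc.
  rewrite (_ : (fun y : 'rV_N => _) =
    (fun y => - 2 * (y ord0 i * (y ord0 i * ((sqsum y)^-1 * (sqsum y)^-1))))); last first.
    by apply/funext => y; rewrite -exprVn; ring.
  apply: continuous_pointM; first exact: ck.
  do 2![apply: continuous_pointM => //].
  by apply: continuous_pointM; exact: sc.
have dF i x : is_derive x (delta_mx ord0 i) (F i) (G i x).
  have [->|x0] := eqVneq x 0.
    have h0 := @normr0_lt_annulus _ N _ K e0.
    by rewrite (zG i _ h0); exact: annular_is_derive (zF i) h0.
  have s0 := sqsum_gt0 x0; have sn := lt0r_neq0 s0.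
  have dx := is_derive_coord x i i; rewrite eqxx in dx.
  have ds := is_derive_sqsum x i.
  have di : is_derive (sqsum x) 1 (fun t : R => t^-1) (- (sqsum x) ^- 2 * 1).
    by apply: is_derive_inv => //; exact: is_derive_idfun.
  have d1 := is_derive_dirM (is_derive_dirM (dp i x) (dp i x))
               (is_derive_dirM dx (is_derive_dir_comp di ds)).
  apply: is_derive_eq d1 _; rewrite /G /= mulr1n; field.
  exact: sn.
have ccS : Cc (fun x => \sum_i G i x) by exact: Cc_sum.
have := divergence_theorem ccF ccG dF => div0.
have {div0} : integral_rV (fun x => energy_density phi x + nu_star N * \sum_i G i x)
   = integral_rV (energy_density phi).
  by rewrite integral_rVD ?integral_rVZ ?div0 ?mulr0 ?addr0//; exact: Cc_scale.
move=> <-.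
have : integral_rV (fun _ : 'rV[R]_N => 0) = 0 :> R.
  rewrite -[RHS](mul0r (integral_rV (fun _ : 'rV[R]_N => 0))) -integral_rVZ; last exact: Cc0.
  by congr integral_rV; apply/funext => x; rewrite mul0r.
move=> {1}<-; apply: le_integral_rV.
- exact: Cc0.
- by apply: Cc_add => //; exact: Cc_scale.
move=> x; have [->|x0] := eqVneq x 0.
  rewrite /energy_density sqr_enorm_gradient za ?expr0n ?mul0r ?mulr0; last exact: normr0_lt_annulus.
  rewrite !addr0 big1 ?add0r; last first.
    by move=> i _; rewrite (annular_partial _ za) ?expr0n//; exact: normr0_lt_annulus.
  rewrite big1 ?mulr0// => i _.
  by rewrite (zG i)//; exact: normr0_lt_annulus.
have := @hardy_pointwise (phi x) x (gradient phi x) (sqsum x) (p * u x `^ (p - 1)) erefl.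
rewrite sqsum_gt0// -{1}sqr_enorm => /(_ isT (hu x x0)); congr (0 <= _).
rewrite /energy_density sqr_enorm_gradient sqr_enorm mulNr; congr (_ + _ - _ + _ * _).
- by apply: eq_bigr => i _; rewrite mxE.
- exact/esym/mulrA.
- by apply: eq_bigr => i _; rewrite mxE.
Qed.

End stability.

(** * Instability *)

Section smooth_functions.
Context {R : realType}.
Implicit Types (f g : R -> R) (x t : R) (k : nat).

(** The derivative is quantified existentially, so that closure under sums, products and composition
    reduces to short inductions with explicit derivatives. *)
Fixpoint smooth1 k f : Prop :=
  if k is k'.+1 then exists2 f', has_derive f f' & smooth1 k' f' else continuous f.

Lemma smooth1W k f : smooth1 k.+1 f -> smooth1 k f.
Proof.
elim: k f => [|k IH] f [f' df sf']; first exact: has_derive_continuous df.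
by exists f' => //; exact: IH.
Qed.

Lemma smooth1_continuous k f : smooth1 k f -> continuous f.
Proof. by elim: k f => // k IH f /smooth1W; exact: IH. Qed.

Lemma smooth1_cst k c : smooth1 k (fun=> c).
Proof.
elim: k c => [|k IH] c; first exact: cst_continuous.
by exists (fun=> 0); [move=> t; exact: is_derive_const|exact: IH].
Qed.

Lemma smooth1_id k : smooth1 k (fun t => t).
Proof.
case: k => [|k]; first by move=> t; exact: cvg_id.
by exists (fun=> 1); [move=> t; exact: is_derive_idfun|exact: smooth1_cst].
Qed.

Lemma smooth1D k f g : smooth1 k f -> smooth1 k g -> smooth1 k (fun t => f t + g t).
Proof.
elim: k f g => [|k IH] f g; first by move=> cf cg t; exact: continuous_pointD (cf t) (cg t).
move=> [f' df sf] [g' dg sg]; exists (fun t => f' t + g' t); last exact: IH.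
by move=> t; exact: is_derive_add.
Qed.

Lemma smooth1M k f g : smooth1 k f -> smooth1 k g -> smooth1 k (fun t => f t * g t).
Proof.
elim: k f g => [|k IH] f g; first by move=> cf cg t; exact: continuous_pointM (cf t) (cg t).
move=> /[dup] /smooth1W sf [f' df sf'] /[dup] /smooth1W sg [g' dg sg'].
exists (fun t => f t * g' t + g t * f' t); first by move=> t; exact: is_derive_dirM.
by apply: smooth1D; exact: IH.
Qed.

Lemma smooth1_comp k f g : smooth1 k f -> smooth1 k g -> smooth1 k (fun t => f (g t)).
Proof.
elim: k f g => [|k IH] f g.
  by move=> cf cg t; exact: continuous_point_comp (cg t) (cf _).
move=> [f' df sf'] /[dup] /smooth1W sg [g' dg sg'].
exists (fun t => f' (g t) * g' t); first by move=> t; exact: is_derive_dir_comp.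
by apply: smooth1M => //; exact: IH.
Qed.

Lemma smooth1_expR k : smooth1 k expR.
Proof.
elim: k => [|k IH]; first exact: continuous_expR.
by exists expR => // t; exact: is_derive_expR.
Qed.

Lemma is_derive0_sqr_bound f (C : R) : f 0 = 0 -> (forall h, `|f h| <= C * h ^+ 2) ->
  is_derive (0 : R) 1 f 0.
Proof.
move=> f0 fC.
suff cv : h^-1 *: ((f \o shift 0) (h *: 1) - f 0) @[h --> 0^'] --> (0 : R).
  by split; [apply/cvg_ex; exists 0|apply: cvg_lim].
apply/cvgrPdist_lt => e e0.
near=> h.
have h0 : h != 0 by near: h; exact: nbhs_dnbhs_neq.
have hs : `|h| < e / (`|C| + 1).
  near: h; apply: dnbhs0_lt; rewrite divr_gt0// ltr_wpDl//.
rewrite /= addr0 [h%:A]mulr1 f0 subr0 sub0r normrN normrM normfV.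
rewrite ltr_pdivrMl ?normr_gt0//; apply: le_lt_trans (fC h) _.
rewrite -normr_gt0 in h0.
rewrite -(real_normK (num_real h)) expr2 mulrA mulrC ltr_pM2l//.
apply: (@le_lt_trans _ _ ((`|C| + 1) * `|h|)).
  by apply: ler_wpM2r => //; have := ler_norm C; lra.
by move: hs; rewrite ltr_pdivlMr ?ltr_wpDl// mulrC.
Unshelve. all: by end_near. Qed.

(* The powers [x^(- n)] make the family stable under differentiation. *)
Definition flat (n : nat) x : R := if 0 < x then x ^- n * expR (- x^-1) else 0.

Lemma flat_le0 n x : x <= 0 -> flat n x = 0.
Proof. by rewrite /flat leNgt => /negbTE ->. Qed.

Lemma flat_gt0 n x : 0 < x -> 0 < flat n x.
Proof. by move=> x0; rewrite /flat x0 mulr_gt0 ?expR_gt0// invr_gt0 exprn_gt0. Qed.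

Lemma flat_ge0 n x : 0 <= flat n x.
Proof. by have [/(flat_le0 n) ->//|/(flat_gt0 n)/ltW] := leP x 0. Qed.

Lemma flatE n x : 0 < x -> flat n x = x ^- n * flat 0 x.
Proof. by move=> x0; rewrite /flat x0 expr0 invr1 mul1r. Qed.

(** One term of the exponential series: [e^(1 / x)] is at least [x^(- (n + 2)) / (n + 2)!] for
    [x > 0]. A quadratic bound is what differentiability at 0 requires. *)
Lemma flat_bound n x : `|flat n x| <= (n.+2)`!%:R * x ^+ 2.
Proof.
rewrite ger0_norm ?flat_ge0//.
have [x0|x0] := leP x 0; first by rewrite flat_le0// mulr_ge0// sqr_ge0.
rewrite /flat x0 expRN.
have f0 : 0 < (n.+2)`!%:R :> R by rewrite ltr0n fact_gt0.
have : x^-1 ^+ n.+2 / (n.+2)`!%:R <= expR x^-1.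
  by apply: le_trans (expR_ge1Dxn n.+1 _); [rewrite lerDr|rewrite invr_ge0 ltW].
move=> h; rewrite ler_pdivrMr ?expR_gt0//.
apply: (@le_trans _ _ ((n.+2)`!%:R * x ^+ 2 * (x^-1 ^+ n.+2 / (n.+2)`!%:R))); last first.
  by rewrite ler_pM2l// mulr_gt0// exprn_gt0.
rewrite exprVn -addn2 exprD le_eqVlt; apply/orP; left; apply/eqP.
by field; rewrite !gt_eqF//= exprn_gt0.
Qed.

Lemma has_derive_flat n : has_derive (flat n) (fun x => flat n.+2 x - n%:R * flat n.+1 x).
Proof.
move=> x; have [x0|x0|->] := ltgtP x 0.
- rewrite !flat_le0 ?ltW// mulr0 subr0.
  apply: near_eq_is_derive (is_derive_const (0 : R) x).
  have : \near x, x < 0 by exact: lt_nbhsl.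
  by apply: filterS => y y0; rewrite flat_le0// ltW.
(* For [x > 0] the function is the exponential of [- 1 / x - n ln x], and a single chain rule
   suffices. *)
- have d : is_derive x 1 (fun y : R => expR (- y^-1 + - (n%:R * ln y)))
    ((- (- x ^- 2 * 1) + - (n%:R * (x^-1 * 1))) * expR (- x^-1 + - (n%:R * ln x))).
    have xn : (fun y : R => y) x != 0 by rewrite gt_eqF.
    have i1 := is_derive_inv xn (is_derive_idfun x).
    have i2 := is_derive_lnf x0 (is_derive_idfun x).
    have i3 := is_derive_mul (is_derive_const n%:R x) i2.
    apply: is_derive_eq (is_derive_expRf (is_derive_add (is_derive_opp i1) (is_derive_opp i3))) _.
    by ring.
  have fE m (y : R) : 0 < y -> flat m y = expR (- y^-1 + - (m%:R * ln y)).
    move=> y0; rewrite /flat y0 expRD mulrC; congr (_ * _).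
    by rewrite expRN expRM_natl lnK.
  have {d}d : is_derive x 1 (flat n)
    ((- (- x ^- 2 * 1) + - (n%:R * (x^-1 * 1))) * expR (- x^-1 + - (n%:R * ln x))).
    apply: near_eq_is_derive d.
    have : \near x, 0 < x by exact: lt_nbhsr.
    by apply: filterS => y y0; rewrite fE.
  apply: is_derive_eq d _; rewrite -fE// [in RHS]flatE// [flat n.+1 _]flatE// [flat n _]flatE//.
  rewrite !exprSr; field.
  by rewrite expf_neq0 gt_eqF.
- rewrite !flat_le0// mulr0 subr0.
  exact: is_derive0_sqr_bound (flat_le0 n (lexx 0)) (flat_bound n).
Qed.

Lemma smooth1_flat k n : smooth1 k (flat n).
Proof.
elim: k n => [|k IH] n; first exact: has_derive_continuous (has_derive_flat n).
exists (fun x => flat n.+2 x - n%:R * flat n.+1 x); first exact: has_derive_flat.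
rewrite (_ : (fun _ => _) = fun x => flat n.+2 x + (- n%:R) * flat n.+1 x); last first.
  by apply/funext => x; rewrite mulNr.
by apply: smooth1D => //; apply: smooth1M => //; exact: smooth1_cst.
Qed.

Definition supp_in (a b : R) f := forall t, t < a \/ b < t -> f t = 0.

Lemma supp_in_derive a b f f' : has_derive f f' -> supp_in a b f -> supp_in a b f'.
Proof.
move=> df sf t h; have nb : \near t, 0 = f t.
  case: h => h.
  - have : \near t, t < a by exact: lt_nbhsl.
    by apply: filterS => y h'; rewrite sf//; left.
  - have : \near t, b < t by exact: lt_nbhsr.
    by apply: filterS => y h'; rewrite sf//; right.
have d0 := near_eq_is_derive nb (is_derive_const 0 t).
by have d := df t; rewrite -(@derive_val _ _ _ _ _ _ _ d) (@derive_val _ _ _ _ _ _ _ d0).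
Qed.

Lemma supp_inMl a b f g : supp_in a b g -> supp_in a b (fun t => f t * g t).
Proof. by move=> sg t /sg ->; rewrite mulr0. Qed.

Lemma supp_inMr a b f g : supp_in a b f -> supp_in a b (fun t => f t * g t).
Proof. by move=> sg t /sg ->; rewrite mul0r. Qed.

End smooth_functions.

Section continuous_functions.
Context {R : realType} {T : topologicalType}.
Implicit Types (f g : T -> R).

Lemma continuous_funD f g : continuous f -> continuous g -> continuous (fun x => f x + g x).
Proof. by move=> cf cg x; apply: continuous_pointD; [exact: cf|exact: cg]. Qed.

Lemma continuous_funM f g : continuous f -> continuous g -> continuous (fun x => f x * g x).
Proof. by move=> cf cg x; apply: continuous_pointM; [exact: cf|exact: cg]. Qed.

Lemma open_sublevel f c : continuous f -> open [set x | f x < c].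
Proof. by move=> /continuousP cf; apply: (cf [set t | t < c]); exact: open_lt. Qed.

Lemma closed_preimage_itv f a b : continuous f -> closed [set x | f x \in `[a, b]].
Proof. by move=> /continuous_closedP cf; apply: (cf [set` `[a, b]]); exact: interval_closed. Qed.

End continuous_functions.

(** * Closure properties of C^k functions on R^N *)

Section Ck_closure.
Context {R : realType} {N : nat}.
Implicit Types (f g : 'rV[R]_N -> R) (k : nat) (i : 'I_N).

(** Lets the partial derivatives be supplied by explicit formulas instead of the operator
    [partial]. *)
Lemma CkS k f (df : 'I_N -> 'rV[R]_N -> R) :
  (forall i x, is_derive x (delta_mx ord0 i) f (df i x)) -> continuous f ->
  (forall i, Ck k (df i)) -> Ck k.+1 f.
Proof.
move=> d cf cdf; split=> // i; split=> [x|]; first by have di := d i x; exact: ex_derive.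
rewrite (_ : partial i f = df i)//.
by apply/funext => x; have di := d i x; exact: derive_val.
Qed.

Lemma CkW k f : Ck k.+1 f -> Ck k f.
Proof.
elim: k f => [|k IH] f; first by case.
by move=> [cf df]; split=> // i; have [? /IH] := df i.
Qed.

Lemma Ck_continuous k f : Ck k f -> continuous f.
Proof. by case: k => [|k] []. Qed.

Lemma Ck_is_derive k f i x : Ck k.+1 f -> is_derive x (delta_mx ord0 i) f (partial i f x).
Proof. by move=> [_ /(_ i)[d _]]; exact: (derivableP (d x)). Qed.

Lemma Ck_partial k f i : Ck k.+1 f -> Ck k (partial i f).
Proof. by move=> [_ /(_ i)[]]. Qed.

Lemma Ck_cst k (c : R) : Ck k (fun _ : 'rV[R]_N => c).
Proof.
elim: k c => [|k IH] c; first by split=> //; exact: cst_continuous.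
apply: (@CkS _ _ (fun _ _ => 0)) => //; last exact: cst_continuous.
Qed.

Lemma Ck_coord k i : Ck k (fun x : 'rV[R]_N => x ord0 i).
Proof.
case: k => [|k]; first by split=> //; exact: continuous_coord.
apply: (@CkS _ _ (fun j _ => (i == j)%:R)); last by move=> j; exact: Ck_cst.
  by move=> j x; exact: is_derive_coord.
exact: continuous_coord.
Qed.

Lemma CkD k f g : Ck k f -> Ck k g -> Ck k (fun x => f x + g x).
Proof.
elim: k f g => [|k IH] f g kf kg.
  by split; [exact: (continuous_funD (Ck_continuous kf) (Ck_continuous kg))|].
apply: (@CkS _ _ (fun i x => partial i f x + partial i g x)).
- by move=> i x; exact: (is_derive_dirD (Ck_is_derive i x kf) (Ck_is_derive i x kg)).
- exact: (continuous_funD (Ck_continuous kf) (Ck_continuous kg)).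
- by move=> i; apply: IH; exact: Ck_partial.
Qed.

Lemma CkM k f g : Ck k f -> Ck k g -> Ck k (fun x => f x * g x).
Proof.
elim: k f g => [|k IH] f g kf kg.
  by split; [exact: (continuous_funM (Ck_continuous kf) (Ck_continuous kg))|].
apply: (@CkS _ _ (fun i x => f x * partial i g x + g x * partial i f x)).
- by move=> i x; exact: (is_derive_dirM (Ck_is_derive i x kf) (Ck_is_derive i x kg)).
- exact: (continuous_funM (Ck_continuous kf) (Ck_continuous kg)).
- by move=> i; apply: CkD; apply: IH; [exact: CkW|exact: Ck_partial|exact: CkW|exact: Ck_partial].
Qed.

End Ck_closure.

(** * Functions of the logarithm of the radius *)

Section log_radius.
Context {R : realType} {N : nat}.
Implicit Types (g : R -> R) (a b t : R) (k : nat) (x : 'rV[R]_N) (i : 'I_N).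

(** The convention [ln 0 = 0] gives the value 0 at the origin. Profiles are therefore supported in
    [[a, b]] with [a > 0], so that they vanish at the origin as well as around it. *)
Definition log_radius x : R := ln (enorm x).

Lemma log_radiusE x : log_radius x = 2^-1 * ln (sqsum x).
Proof.
rewrite -sqr_enorm /log_radius; have [x0|x0] := leP (enorm x) 0.
  have -> : enorm x = 0 by apply/eqP; rewrite eq_le x0 sqrtr_ge0.
  by rewrite expr0n ln0 ?mulr0.
by rewrite lnXn// -mulr_natl; field.
Qed.

Lemma expR_log_radius x : x != 0 -> expR (- 2 * log_radius x) = (sqsum x)^-1.
Proof.
move=> x0; rewrite -sqr_enorm mulNr expRN expRM_natl lnK//.
by rewrite posrE enorm_gt0.
Qed.

(** Writing [|x|^(- 2)] as [e^(- 2 ln |x|)] makes the derivative of a function of [ln |x|] a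
    coordinate times another such function, which is what the induction in [Ck_log_radius] feeds
    on. *)
Lemma is_derive_log_radius x i : x != 0 ->
  is_derive x (delta_mx ord0 i) log_radius (x ord0 i * expR (- 2 * log_radius x)).
Proof.
move=> x0; have s0 := sqsum_gt0 x0; rewrite expR_log_radius//.
have -> : log_radius = fun x => 2^-1 * ln (sqsum x) by apply/funext => y; exact: log_radiusE.
have d1 := is_derive_mul (is_derive_const 2^-1 (sqsum x))
  (is_derive_lnf (f := fun t : R => t) s0 (is_derive_idfun (sqsum x))).
apply: is_derive_eq (is_derive_dir_comp d1 (is_derive_sqsum x i)) _.
by field; exact: lt0r_neq0.
Qed.

Lemma continuous_log_radius x : x != 0 -> {for x, continuous log_radius}.
Proof.
move=> x0; apply: (@continuous_point_comp _ _ (@enorm R N) (@ln R)); first exact: continuous_enorm.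
by apply: continuous_ln; exact: enorm_gt0.
Qed.

Lemma log_radius0 : log_radius 0 = 0.
Proof. by rewrite /log_radius enorm0 ln0. Qed.

Lemma log_radius_annulus a b : 0 < a -> exists2 e, 0 < e &
  forall g, supp_in a b g -> annular e (expR b) (fun x => g (log_radius x)).
Proof.
move=> a0; have oA : open [set x : 'rV[R]_N | enorm x < expR a].
  by apply: open_sublevel; exact: continuous_enorm.
have [|e e0 he] := @open_ball_subset _ _ _ 0 oA.
  by rewrite /= enorm0 expR_gt0.
exists e => // g sg x [h|h]; apply: sg.
  left; rewrite /log_radius.
  have xa : enorm x < expR a by apply: he; rewrite mx_norm_ball /ball_/= sub0r normrN.
  have [x0|x0] := leP (enorm x) 0; first by rewrite ln0.
  by rewrite -[ltRHS]expRK ltr_ln ?posrE ?expR_gt0.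
right; have bx := lt_le_trans h (norm_le_enorm x).
by rewrite -[ltLHS]expRK /log_radius ltr_ln ?posrE ?expR_gt0// (lt_trans (expR_gt0 b)).
Qed.

Lemma Cc_log_radius a b g : 0 < a -> supp_in a b g -> continuous g ->
  Cc (fun x => g (log_radius x)).
Proof.
move=> a0 sg cg; have [e e0 /(_ g sg) zg] := log_radius_annulus b a0.
apply: (annular_Cc e0 zg) => x x0.
by apply: continuous_point_comp (continuous_log_radius x0) (cg _).
Qed.

Lemma is_derive_comp_log_radius a b g g' x i : 0 < a -> supp_in a b g -> has_derive g g' ->
  is_derive x (delta_mx ord0 i) (fun y => g (log_radius y))
    (x ord0 i * (g' (log_radius x) * expR (- 2 * log_radius x))).
Proof.
move=> a0 sg dg; have [->|x0] := eqVneq x 0.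
  have [e e0 /(_ g sg) zg] := log_radius_annulus b a0.
  have h0 := @normr0_lt_annulus R N e (expR b) e0.
  by rewrite mxE mul0r; exact: annular_is_derive zg h0.
apply: is_derive_eq (is_derive_dir_comp (dg _) (is_derive_log_radius i x0)) _.
by rewrite mulrCA.
Qed.

Lemma Ck_log_radius k a b g : 0 < a -> supp_in a b g -> smooth1 k g ->
  Ck k (fun x => g (log_radius x)).
Proof.
move=> a0; elim: k g => [|k IH] g sg.
  by move=> cg; split=> //; have [] := Cc_log_radius a0 sg cg.
move=> /[dup] /smooth1_continuous cg [g' dg sg'].
have sg1 := supp_in_derive dg sg.
apply: (@CkS _ _ _ _ (fun i x => x ord0 i * (g' (log_radius x) * expR (- 2 * log_radius x)))).
- by move=> i x; exact: is_derive_comp_log_radius a0 sg dg.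
- by have [] := Cc_log_radius a0 sg cg.
- move=> i; apply: CkM; first exact: Ck_coord.
  apply: (IH (fun t => g' t * expR (- 2 * t))); first exact: supp_inMr.
  apply: smooth1M => //; apply: smooth1_comp; first exact: smooth1_expR.
  by apply: smooth1M; [exact: smooth1_cst|exact: smooth1_id].
Qed.

Lemma test_function_log_radius a b rho g : 0 < a -> rho < expR a -> supp_in a b g ->
  (forall k, smooth1 k g) -> test_function [set x | rho < enorm x] (fun x => g (log_radius x)).
Proof.
move=> a0 rhoa sg smg; pose C := [set x : 'rV[R]_N | enorm x \in `[expR a, expR b]].
have clC : closed C.
  by apply: closed_preimage_itv; exact: continuous_enorm.
have sC : tsupport (fun x => g (log_radius x)) `<=` C.
  rewrite [X in _ `<=` X](closure_id _).1//; apply: closure_subset => x /= gx.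
  have xa : ~ (log_radius x < a \/ b < log_radius x) by move=> /sg h; rewrite h eqxx in gx.
  have x0 : 0 < enorm x.
    rewrite ltNge; apply/negP => h; apply: xa; left.
    by rewrite /log_radius ln0.
  have e : expR (log_radius x) = enorm x by rewrite lnK.
  rewrite /C /= in_itv/= -e !ler_expR !leNgt; apply/andP; split; apply/negP => h; apply: xa.
    by left.
  by right.
split.
- by move=> k; exact: Ck_log_radius a0 sg (smg k).
- apply: bounded_closed_compact; last exact: closed_closure.
  exists (expR b); split; first exact: num_real.
  move=> M bM x /sC; rewrite /C/= in_itv/= => /andP[_ h].
  exact: le_trans (norm_le_enorm x) (le_trans h (ltW bM)).
- by move=> x /sC; rewrite /C/= in_itv/= => /andP[h _]; exact: lt_le_trans h.
Qed.

End log_radius.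

(** * A wide bump with controlled second derivative *)

Section bump.
Context {R : realType}.
Variables (c T : R).
Hypothesis c0 : 0 < c.
Implicit Types t : R.

Let q t := 1 - (c * (t - T)) ^+ 2.
Let q' t := - (2 * c * (c * (t - T))).

(** The standard bump [exp(- 1 / (1 - y^2))] at [y = c (t - T)]: centre [T], half-width [1 / c],
    hence wide for small [c]. *)
Definition bump t := flat 0 (q t).
Definition bump' t := flat 2 (q t) * q' t.
Definition bump'' t :=
  (flat 4 (q t) - 2 * flat 3 (q t)) * q' t ^+ 2 - 2 * c ^+ 2 * flat 2 (q t).

Let dq : has_derive q q'.
Proof.
move=> t; have d1 := is_derive_add (is_derive_idfun t) (is_derive_const (- T) t).
have d2 := is_derive_sqr (is_derive_mul (is_derive_const c t) d1).
apply: is_derive_eq (is_derive_add (is_derive_const 1 t) (is_derive_opp d2)) _.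
by rewrite /q'; ring.
Qed.

Lemma has_derive_bump : has_derive bump bump'.
Proof.
move=> t; apply: is_derive_eq (is_derive_dir_comp (has_derive_flat 0 _) (dq t)) _.
by rewrite mul0r subr0.
Qed.

Lemma has_derive_bump' : has_derive bump' bump''.
Proof.
move=> t; have d1 := is_derive_add (is_derive_idfun t) (is_derive_const (- T) t).
have d2 := is_derive_mul (is_derive_const c t) d1.
have d3 := is_derive_opp (is_derive_mul (is_derive_const (2 * c) t) d2).
have d4 := is_derive_dir_comp (has_derive_flat 2 _) (dq t).
apply: is_derive_eq (is_derive_dirM d4 d3) _.
by rewrite /bump'' /q'; ring.
Qed.

Lemma smooth1_bump k : smooth1 k bump.
Proof.
apply: smooth1_comp; first exact: smooth1_flat.
have sl : smooth1 k (fun t => c * (t - T)).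
  apply: smooth1M; first exact: smooth1_cst.
  by apply: smooth1D; [exact: smooth1_id|exact: smooth1_cst].
rewrite (_ : q = fun t => 1 + (-1) * (c * (t - T) * (c * (t - T)))).
  apply: smooth1D; first exact: smooth1_cst.
  by apply: smooth1M; [exact: smooth1_cst|exact: smooth1M].
by apply/funext => t; rewrite /q; ring.
Qed.

Lemma smooth1_bump' k : smooth1 k bump'.
Proof.
have [f df sf] := smooth1_bump k.+1; rewrite (_ : bump' = f)//.
apply/funext => t; have d := df t; have d' := has_derive_bump t.
by rewrite -(@derive_val _ _ _ _ _ _ _ d) (@derive_val _ _ _ _ _ _ _ d').
Qed.

Lemma smooth1_bump'' k : smooth1 k bump''.
Proof.
have [f df sf] := smooth1_bump' k.+1; rewrite (_ : bump'' = f)//.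
apply/funext => t; have d := df t; have d' := has_derive_bump' t.
by rewrite -(@derive_val _ _ _ _ _ _ _ d) (@derive_val _ _ _ _ _ _ _ d').
Qed.

Lemma bump_supp : supp_in (T - c^-1) (T + c^-1) bump.
Proof.
move=> t h; rewrite /bump flat_le0// /q subr_le0.
have cv : c * c^-1 = 1 by rewrite divff// gt_eqF.
rewrite -(real_normK (num_real _)) exprn_ege1//.
rewrite normrM (gtr0_norm c0) -cv ler_pM2l//.
have ci : 0 < c^-1 by rewrite invr_gt0.
by case: h => h; [rewrite ltr0_norm|rewrite gtr0_norm]; lra.
Qed.

Lemma bump_center : 0 < bump T.
Proof. by rewrite /bump flat_gt0// /q subrr mulr0 expr0n subr0. Qed.

(* With [z = 1 - y^2] one has [bump'' / bump = c^2 (4 - 12 z + 6 z^2) / z^4]. *)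
Lemma bump''_ge t : - (162 * c ^+ 2) * bump t ^+ 2 <= bump t * bump'' t.
Proof.
have [z0|z0] := leP (q t) 0.
  by rewrite /bump (flat_le0 0 z0) expr0n mulr0 mul0r.
rewrite /bump'' /bump (flatE 4 z0) (flatE 3 z0) (flatE 2 z0).
have y2 : q' t ^+ 2 = 4 * c ^+ 2 * (1 - q t) by rewrite /q' /q; ring.
rewrite y2; set E := flat 0 (q t); set z := q t in z0 *.
(* Equal to [(18 z^2 - 1)^2 / 2 + 24 (z - 1/4)^2 + 2], with [162 = 18^2 / 2]. *)
have P : 0 <= 162 * z ^+ 4 + 6 * z ^+ 2 - 12 * z + 4.
  by have h1 := sqr_ge0 (18 * z ^+ 2 - 1); have h2 := sqr_ge0 (z - 4^-1); lra.
rewrite -subr_ge0.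
have -> : E * ((z ^- 4 * E - 2 * (z ^- 3 * E)) * (4 * c ^+ 2 * (1 - z))
      - 2 * c ^+ 2 * (z ^- 2 * E)) - - (162 * c ^+ 2) * E ^+ 2
    = E ^+ 2 * c ^+ 2 * (162 * z ^+ 4 + 6 * z ^+ 2 - 12 * z + 4) / z ^+ 4.
  by field; rewrite gt_eqF.
exact: divr_ge0 (mulr_ge0 (mulr_ge0 (sqr_ge0 E) (sqr_ge0 c)) P) (exprn_ge0 4 (ltW z0)).
Qed.

End bump.

Section instability.
Context {R : realType} {N : nat}.
Variables (nu p delta T0 : R) (u : 'rV[R]_N -> R).
Hypothesis N0 : (0 < N)%N.
Hypothesis delta0 : 0 < delta.
Hypothesis u_cont : forall x, x != 0 -> {for x, continuous (fun y => u y `^ (p - 1))}.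
Hypothesis u_large : forall x, x != 0 -> T0 <= log_radius x ->
  (nu ^+ 2 + delta) / enorm x ^+ 2 <= p * u x `^ (p - 1).

Local Notation ns := (nu_star N : R).

Let NE : N%:R = 2 * ns + 2 :> R.
Proof. by rewrite /nu_star; field. Qed.

(* For the test function [e^(- nu_star t) b(t)] with [t = ln |x|], the first term on
   the right is the divergence of [x |-> e^(- N t) (b b' - nu_star b^2) x]. *)
Lemma unstable_pointwise (V s c b b' b'' A : R) :
  162 * c ^+ 2 = delta / 2 -> 0 <= A -> 0 < s ->
  - (162 * c ^+ 2) * b ^+ 2 <= b * b'' ->
  (nu ^+ 2 + delta) / s * (A * b ^+ 2) <= V * (A * b ^+ 2) ->
  A * (b' - ns * b) ^+ 2 / s + (nu ^+ 2 - ns ^+ 2) * (A * b ^+ 2 / s) - V * (A * b ^+ 2)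
  <= A / s * (b' ^+ 2 + b * b'' - 2 * ns * b * b') + - (delta / 2) * (A / s * b ^+ 2).
Proof.
move=> cE A0 s0 hb hV.
have As : 0 <= A / s by exact: divr_ge0 A0 (ltW s0).
have := ler_wpM2l As hb; rewrite cE => h.
rewrite -subr_ge0.
have -> : A / s * (b' ^+ 2 + b * b'' - 2 * ns * b * b') + - (delta / 2) * (A / s * b ^+ 2)
  - (A * (b' - ns * b) ^+ 2 / s + (nu ^+ 2 - ns ^+ 2) * (A * b ^+ 2 / s) - V * (A * b ^+ 2))
  = (A / s * (b * b'') - A / s * (- (delta / 2) * b ^+ 2))
   + (V * (A * b ^+ 2) - (nu ^+ 2 + delta) / s * (A * b ^+ 2)).
  by field; exact: lt0r_neq0.
by rewrite addr_ge0// subr_ge0.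
Qed.

Theorem large_potential_unstable : unstable nu p u.
Proof.
case=> rho rho0 st.
(* Then [162 c^2 = delta / 2]: half of the excess [delta] pays for the second derivative of the
   bump, the other half survives with a negative sign. *)
pose c := Num.sqrt delta / 18.
have c0 : 0 < c by rewrite divr_gt0 ?sqrtr_gt0.
have cE : 162 * c ^+ 2 = delta / 2.
  by rewrite /c -{2}(sqr_sqrtr (ltW delta0)); field.
(* The support of the bump starts at [M + 1]: beyond [ln rho], for an admissible test function;
   beyond [T0], where the potential is large; beyond 0, because [log_radius] is 0 at the origin. *)
pose M := Num.max (ln rho) (Num.max T0 0).
have hM1 : ln rho <= M by rewrite le_max lexx.
have hM2 : T0 <= M by rewrite !le_max lexx orbT.
have hM3 : 0 <= M by rewrite !le_max lexx !orbT.
have M1 : M < M + 1 by rewrite ltrDl.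
pose T := M + 1 + c^-1.
pose a := T - c^-1; pose b := T + c^-1.
have [rhoa T0a a0] : [/\ ln rho < a, T0 < a & 0 < a].
  by rewrite /a /T addrK; split; apply: le_lt_trans M1.
have {}rhoa : rho < expR a by rewrite -[ltLHS]lnK// ltr_expR.
pose psi := bump c T; pose psi1 := bump' c T; pose psi2 := bump'' c T.
have spsi : supp_in a b psi := bump_supp c0.
have dpsi : has_derive psi psi1 by exact: has_derive_bump.
have dpsi1 : has_derive psi1 psi2 by exact: has_derive_bump'.
have spsi1 := supp_in_derive dpsi spsi.
pose X m (t : R) := expR (m * t).
have sX m k : smooth1 k (X m).
  apply: smooth1_comp; first exact: smooth1_expR.
  by apply: smooth1M; [exact: smooth1_cst|exact: smooth1_id].
have dX (m t : R) : is_derive t 1 (X m) (m * X m t).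
  apply: is_derive_eq (is_derive_expRf (is_derive_mul (is_derive_const m t) (is_derive_idfun t))) _.
  by rewrite /X; ring.
pose g t := X (- ns) t * psi t.
pose g1 t := X (- ns) t * (psi1 t - ns * psi t).
have dg : has_derive g g1.
  move=> t; apply: is_derive_eq (is_derive_mul (dX (- ns) t) (dpsi t)) _.
  by rewrite /g1; ring.
have sg : supp_in a b g by exact: supp_inMl.
have smg k : smooth1 k g by apply: smooth1M; [exact: sX|exact: smooth1_bump].
pose phi (x : 'rV[R]_N) := g (log_radius x).
have := st phi (test_function_log_radius a0 rhoa sg smg).
have Cphi : Ck 1 phi by exact: Ck_log_radius a0 sg (smg 1%N).
have [e e0 hz] := @log_radius_annulus R N a b a0.
have cdphi i : continuous (partial i phi) by exact: Ck_continuous (Ck_partial i Cphi).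
have [c1 c2 c3] := annular_energy_Cc u_cont e0 (hz g sg) (Ck_continuous Cphi) cdphi.
have [cen <-] := integral_energy_density nu c1 c2 c3.
(* The field is [H (ln |x|) x], of divergence [N H + H']; the weight [e^(- N t)] in [H] reduces this
   to [e^(- N t) h']. *)
pose h t := psi t * psi1 t - ns * psi t ^+ 2.
pose h1 t := psi1 t ^+ 2 + psi t * psi2 t - 2 * ns * psi t * psi1 t.
pose H t := X (- N%:R) t * h t.
pose H1 t := X (- N%:R) t * (h1 t - N%:R * h t).
have dh : has_derive h h1.
  move=> t; have d1 := is_derive_mul (dpsi t) (dpsi1 t).
  have d2 := is_derive_mul (is_derive_const (- ns) t) (is_derive_sqr (dpsi t)).
  rewrite (_ : h = fun t => psi t * psi1 t + - ns * psi t ^+ 2).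
    by apply: is_derive_eq (is_derive_add d1 d2) _; rewrite /h1; ring.
  by apply/funext => s; rewrite /h mulNr.
have dH : has_derive H H1.
  move=> t; apply: is_derive_eq (is_derive_mul (dX (- N%:R) t) (dh t)) _.
  by rewrite /H1; ring.
have sh : supp_in a b h by move=> t ht; rewrite /h spsi// spsi1// expr0n !mulr0 subr0.
have sH : supp_in a b H by exact: supp_inMl.
have sH1 := supp_in_derive dH sH.
have cpsi : continuous psi by exact: has_derive_continuous dpsi.
have cpsi1 : continuous psi1 by exact: has_derive_continuous dpsi1.
have cpsi2 : continuous psi2 by exact: (smooth1_bump'' c T 0).
have cX m : continuous (X m) := sX m 0%N.
have cc_ (f : R -> R) : continuous f -> supp_in a b f -> Cc (fun x : 'rV[R]_N => f (log_radius x)).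
  by move=> cf sf; exact: Cc_log_radius a0 sf cf.
have kc (r : R) : continuous (fun _ : R => r) by exact: cst_continuous.
have cH : continuous H by exact: has_derive_continuous dH.
have cH1 : continuous H1.
  rewrite (_ : H1 = fun t => X (- N%:R) t * (psi1 t * psi1 t + psi t * psi2 t
     + (- 2 * ns) * (psi t * psi1 t) + (- N%:R) * h t)).
    apply: continuous_funM; first exact: cX.
    apply: continuous_funD; last first.
      by apply: continuous_funM; [exact: kc|exact: has_derive_continuous dh].
    apply: continuous_funD; last by apply: continuous_funM; [exact: kc|exact: continuous_funM].
    by apply: continuous_funD; exact: continuous_funM.
  by apply/funext => t; rewrite /H1 /h1; ring.
pose F (i : 'I_N) (x : 'rV[R]_N) := x ord0 i * H (log_radius x).
pose G (i : 'I_N) (x : 'rV[R]_N) := H (log_radius x) +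
   x ord0 i * (x ord0 i * (H1 (log_radius x) * X (- 2) (log_radius x))).
have cx (i : 'I_N) : continuous (fun x : 'rV[R]_N => x ord0 i) by exact: continuous_coord.
have ccF i : Cc (F i) by apply: Cc_mull; [exact: cx|exact: cc_].
have ccG i : Cc (G i).
  apply: Cc_add; first exact: cc_.
  apply: Cc_mull; first exact: cx.
  apply: Cc_mull; first exact: cx.
  apply: (cc_ (fun t => H1 t * X (- 2) t)); last exact: supp_inMr.
  by apply: continuous_funM => //; exact: cX.
have dF i x : is_derive x (delta_mx ord0 i) (F i) (G i x).
  have d1 := is_derive_coord x i i; rewrite eqxx in d1.
  have d2 := is_derive_comp_log_radius x i a0 sH dH.
  by apply: is_derive_eq (is_derive_dirM d1 d2) _; rewrite /G /X /= mulr1n mulr1 addrC.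
have ccS : Cc (fun x => \sum_i G i x) by exact: Cc_sum.
pose W t := X (- N%:R) t * (psi t * psi t).
have ccW : Cc (fun x : 'rV[R]_N => W (log_radius x)).
  apply: cc_; last by apply: supp_inMl; exact: supp_inMl.
  by apply: continuous_funM; [exact: cX|exact: continuous_funM].
(* After the divergence has integrated to zero, [- delta / 2] times this integral bounds the
   quadratic form. The integrand is positive at a point with [ln |x| = T], the centre of the
   bump. *)
have W_gt0 : 0 < integral_rV (fun x : 'rV[R]_N => W (log_radius x)).
  pose i0 := Ordinal N0; pose x0 : 'rV[R]_N := expR T *: delta_mx ord0 i0.
  have ex0 : enorm x0 = expR T.
    rewrite /enorm (bigD1 i0)//= big1.
      by rewrite !mxE !eqxx mulr1 addr0 sqrtr_sqr ger0_norm ?expR_ge0.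
    by move=> i ii0; rewrite !mxE (negbTE ii0) andbF mulr0 expr0n.
  apply: (@integral_rV_gt0 _ _ _ x0) => // [y|].
    by rewrite mulr_ge0 ?expR_ge0// -expr2 sqr_ge0.
  have psiT : 0 < psi T by exact: bump_center.
  by rewrite /log_radius ex0 expRK /W mulr_gt0 ?expR_gt0// mulr_gt0.
have le_int : integral_rV (energy_density nu p u phi) <=
   integral_rV (fun x => \sum_i G i x + - (delta / 2) * W (log_radius x)).
  apply: le_integral_rV => //.
    by apply: Cc_add => //; exact: Cc_scale.
  move=> x; have [->|x0] := eqVneq x 0.
    have z0 : (0 : R) < a \/ b < 0 by left.
    rewrite /energy_density sqr_enorm_gradient.
    have za := hz g sg; have zh := @normr0_lt_annulus R N e (expR b) e0.
    rewrite (_ : phi 0 = 0); last exact: (za 0 zh).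
    rewrite expr0n !mul0r !mulr0 !addr0 /W log_radius0 spsi// !mulr0 addr0.
    rewrite [leLHS]big1; last by move=> i _; rewrite (annular_partial _ za zh) expr0n.
    by rewrite big1// => i _; rewrite /G log_radius0 sH// sH1// !mul0r !mulr0 addr0.
  have s0 := sqsum_gt0 x0.
  set t := log_radius x.
  have XE : X (- 2) t = (sqsum x)^-1 by rewrite /X expR_log_radius.
  pose A := X (- 2 * ns) t.
  have A0 : 0 < A by exact: expR_gt0.
  have XA : X (- ns) t ^+ 2 = A by rewrite /A /X -expRM_natr; congr expR; ring.
  have XN : X (- N%:R) t = A / sqsum x.
    by rewrite -XE /A /X -expRD NE; congr expR; ring.
  have gx2 : phi x ^+ 2 = A * psi t ^+ 2 by rewrite /phi /g exprMn XA.
  have grad : \sum_i partial i phi x ^+ 2 = A * (psi1 t - ns * psi t) ^+ 2 / sqsum x.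
    transitivity (\sum_i (g1 t * (sqsum x)^-1) ^+ 2 * x ord0 i ^+ 2).
      apply: eq_bigr => i _.
      have d := is_derive_comp_log_radius x i a0 sg dg.
      rewrite /partial (@derive_val _ _ _ _ _ _ _ d) -/t [expR _]XE; ring.
    rewrite -mulr_sumr -/(sqsum x) -XA /g1; field.
    exact: lt0r_neq0.
  have SG : \sum_i G i x = A / sqsum x * h1 t.
    transitivity (\sum_(i < N) H t + (H1 t / sqsum x) * \sum_i x ord0 i ^+ 2).
      rewrite mulr_sumr -big_split /=; apply: eq_bigr => i _.
      by rewrite /G -/t XE; ring.
    rewrite sumr_const card_ord -mulr_natl -/(sqsum x) /H /H1 XN; field.
    exact: lt0r_neq0.
  rewrite /energy_density sqr_enorm_gradient grad gx2 sqr_enorm SG /W -/t XN -expr2.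
  have := @unstable_pointwise (p * u x `^ (p - 1)) (sqsum x) c (psi t) (psi1 t)
    (psi2 t) A cE (ltW A0) s0 (bump''_ge c T t).
  have hV : (nu ^+ 2 + delta) / sqsum x * (A * psi t ^+ 2) <= p * u x `^ (p - 1) * (A * psi t ^+ 2).
    have [ta|ta] := ltP t a.
      by rewrite spsi ?expr0n ?mulr0//; left.
    apply: ler_wpM2r; first by rewrite mulr_ge0 ?(ltW A0) ?sqr_ge0.
    by rewrite -sqr_enorm; apply: u_large => //; exact: ltW (lt_le_trans T0a ta).
  by move=> /(_ hV); congr (_ + _ <= _); ring.
rewrite leNgt => /negP; apply; apply: le_lt_trans le_int _.
rewrite integral_rVD//; last exact: Cc_scale.
rewrite (divergence_theorem ccF ccG dF) add0r integral_rVZ//.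
by rewrite mulNr oppr_lt0 mulr_gt0// divr_gt0.
Qed.

End instability.

Theorem theorem3p1 (R : realType) (N : nat) (nu p : R) :
  (3 <= N)%N -> 0 < nu -> p_S N < p -> (p%:E < p_star N nu)%E ->
  (forall lam : R, 0 < lam ->
     exists2 V : R -> R, is_U_lambda N nu p lam V &
       forall W : R -> R, is_U_lambda N nu p lam W ->
         forall r, 0 < r -> W r = V r) /\
  (forall U : R -> R -> R,
     (forall lam, 0 < lam -> is_U_lambda N nu p lam (U lam)) ->
     let Ue := extend_family N nu p U in
     (* [V |-> kappa `^ (2 / (p - 1)) * V (kappa * _)] multiplies the limit at 0
        by [kappa `^ (2 / (p - 1) + nu - nu_star N)], so this [kappa] carries the
        limit 1 to the limit [lam]; the exponent is positive, as p < p_star. *)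
     (forall lam r : R, 0 < lam -> 0 < r ->
        let kappa := lam `^ (2 / (p - 1) + nu - nu_star N)^-1 in
        U lam r = kappa `^ (2 / (p - 1)) * U 1 (kappa * r)) /\
     (p * C_pnu N nu p `^ (p - 1) <= nu ^+ 2 ->
        (forall l : \bar R, (0 < l)%E -> stable nu p (@radial R N (Ue l))) /\
        (forall l1 l2 : \bar R, (0 < l1)%E -> (l1 < l2)%E ->
           (forall r, 0 < r -> Ue l1 r < Ue l2 r) /\
           (exists2 L : \bar R, (0 < L)%E &
              ((Ue l2 r - Ue l1 r) / r `^ (- nu_star N))%:E
                @[r --> +oo] --> L))) /\
     (nu ^+ 2 < p * C_pnu N nu p `^ (p - 1) ->
        (forall l : \bar R, (0 < l)%E -> unstable nu p (@radial R N (Ue l))) /\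
        (forall l1 l2 : \bar R, (0 < l1)%E -> (l1 < l2)%E ->
           forall rho : R, 0 < rho ->
             changes_sign_on `]rho, +oo[ (fun r => Ue l2 r - Ue l1 r)))).
Proof.
move=> N3 nu0 pS pT; split.
  move=> lam lam0; have [V HV] := is_U_lambda_exists N3 pS pT lam0.
  by exists V => // W HW; exact: (is_U_lambda_unique N3 nu0 pS pT lam0 HW HV).
move=> U HU Ue.
have cu l : (0 < l)%E -> forall x : 'rV[R]_N, x != 0 ->
    {for x, continuous (fun y => radial (Ue l) y `^ (p - 1))}.
  move=> l0 x x0; have e0 := enorm_gt0 x0.
  have u0 := extend_family_gt0 N3 nu0 pS pT HU l0 e0.
  apply: (@continuous_point_comp _ _ (radial (Ue l)) (fun s => s `^ (p - 1))).
    apply: continuous_point_comp; first exact: continuous_enorm.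
    exact: (extend_family_continuous N3 nu0 pS pT HU l0 e0).
  exact/is_derive_continuous/is_derive1_powR.
split; [|split].
- move=> lam r lam0 r0.
  exact: (is_U_lambda_scaling N3 nu0 pS pT lam0 r0 (HU 1 ltr01) (HU lam lam0)).
- move=> stab; split.
    move=> l l0; apply: (hardy_stable (cu l l0)) => x x0.
    exact: (extend_family_stable_potential N3 nu0 pS pT HU stab l0 (enorm_gt0 x0)).
  by move=> l1 l2; exact: (extend_family_ordered N3 nu0 pS pT HU stab).
- move=> unst; split.
    move=> l l0.
    have [delta d0 [T hT]] := extend_family_unstable_potential N3 nu0 pS pT HU unst l0.
    apply: (@large_potential_unstable _ _ nu p delta T) => //.
    + exact: leq_trans N3.
    + exact: cu.
    + by move=> x x0; apply: hT; exact: enorm_gt0.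
  by move=> l1 l2 l10 l12 rho; exact: (extend_family_oscillate N3 nu0 pS pT HU unst).
Qed.
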